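(* Assume that $$\lim_{n\to\infty}\ \sup_{\alpha\in nP\cap\mathbb{Z}_+^d}\left|\frac1n\log|c_{\alpha,n}|-\log f(\alpha/n)\right|=0$$ and that $$\mathbb{P}\big(\log(1+|\xi_0|)>t\big)=o(t^{-d})\qquad\text{as } t\to\infty .$$ Then, in probability, $$\frac1n\log|\mathbf{P}_n|\longrightarrow \Phi_{P,f}\qquad\text{in } L^1_{\mathrm{loc}}(\mathbb{C}^d)\ \text{as } n\to\infty .$$
   Context: Fix an integer $d\ge 1$. Write $\mathbb{R}_+^d=[0,\infty)^d$ and $\mathbb{Z}_+^d=\{0,1,2,\dots\}^d$. Let $P\subset\mathbb{R}_+^d$ be a convex body (compact, convex, with nonempty interior) with $0\in P$, and $nP=\{nt:t\in P\}$ for $n\in\mathbb{N}$. Let $(\Omega,\mathcal{F},\mathbb{P})$ be a probability space and $(\xi_\alpha)_{\alpha\in\mathbb{Z}_+^d}$ i.i.d. complex-valued random variables on it, with $\xi_0$ non-degenerate (not almost surely constant). Let $f:P\to(0,\infty)$ be continuous and let $c_{\alpha,n}$ ($n\in\mathbb{N}$, $\alpha\in nP\cap\mathbb{Z}_+^d$) be deterministic complex coefficients (with the convention $\log 0=-\infty$). The random $P$-polynomials are $$\mathbf{P}_n(z,\omega)=\sum_{\alpha\in nP\cap\mathbb{Z}_+^d}\xi_\alpha(\omega)\,c_{\alpha,n}\,z^\alpha,\qquad z\in\mathbb{C}^d,\quad z^\alpha=z_1^{\alpha_1}\cdots z_d^{\alpha_d}.$$ For $s\in\mathbb{R}^d$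 put $I_{P,f}(s)=\sup_{t\in P}\big(\langle s,t\rangle+\log f(t)\big)$, with $\langle s,t\rangle=\sum_j s_jt_j$. For $z\in(\mathbb{C}^* )^d$ let $\operatorname{Log}(z)=(\log|z_1|,\dots,\log|z_d|)$, and define $$\Phi_{P,f}(z)=\limsup_{\zeta\to z,\ \zeta\in(\mathbb{C}^* )^d} I_{P,f}(\operatorname{Log}\zeta),\qquad z\in\mathbb{C}^d;$$ on $(\mathbb{C}^* )^d$ this equals $I_{P,f}(\operatorname{Log} z)$, and $\Phi_{P,f}$ is plurisubharmonic on $\mathbb{C}^d$. Convention: on the event $\{\mathbf{P}_n\equiv 0\}$ one sets $\frac1n\log|\mathbf{P}_n|:=0$. Convergence in probability in $L^1_{\mathrm{loc}}(\mathbb{C}^d)$ is with respect to a metric inducing the standard topology, e.g. $d(u,v)=\sum_{m\ge1}2^{-m}\min\{1,\|u-v\|_{L^1(B_m)}\}$, $B_m=\{z\in\mathbb{C}^d:\|z\|\le m\}$. *)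

(* Defs.v *)
From HB Require Import structures.
From mathcomp Require Import all_boot all_order all_algebra finmap.
From mathcomp Require Import all_classical all_reals all_analysis.
From mathcomp Require Import complex.

Set Implicit Arguments.
Unset Strict Implicit.
Unset Printing Implicit Defensive.

Import Order.TTheory GRing.Theory Num.Theory.
Import numFieldNormedType.Exports.

Local Open Scope classical_set_scope.
Local Open Scope ring_scope.
Local Open Scope complex_scope.

(* The library declares the norm topology on every abstract numClosedFieldType,
   but not on the concrete type R[i]. *)
HB.instance Definition _ (R : realType) := NormedModule.copy R[i] R[i]^o.

(* Lets `f =o_+oo g` typecheck: the filter at +oo has no canonical structure. *)
Canonical pinfty_filter_on (R : realType) :=
  FilterType (pinfty_nbhs R) (@filter_filter R _ proper_pinfty_nbhs).

(* Image of a sigma-finite measure under an embedding f; left inverses keep it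
   sigma-finite, so that iterated products can be formed. *)
Section image_measure.
Context d1 d2 (T1 : measurableType d1) (T2 : measurableType d2) (R : realType).
Variables (mu : {sigma_finite_measure set T1 -> \bar R}).
Variables (f : T1 -> T2) (g : T2 -> T1).
Hypotheses (mf : measurable_fun setT f) (mg : measurable_fun setT g).
Hypothesis fK : cancel f g.

Let image_mu : {measure set T2 -> \bar R} :=
  measure_function_pushforward__canonical__measure_function_Measure mu mf.

Lemma image_measure_sigma_finite : sigma_finite setT (pushforward mu f).
Proof.
have [F UF mF] := sigma_finiteT mu.
exists (fun k => g @^-1` F k).
  by rewrite -preimage_bigcup -UF preimage_setT.
move=> k; have [mFk Fkoo] := mF k; split.
  by rewrite -[X in measurable X]setTI; exact: mg.
rewrite /pushforward -comp_preimage (_ : g \o f = id)//.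
by apply/funext => x; exact: fK.
Qed.

Let image_nu : set T2 -> \bar R := pushforward mu f.

HB.instance Definition _ := Measure.copy image_nu image_mu.

HB.instance Definition _ :=
  @Measure_isSigmaFinite.Build _ _ _ image_nu image_measure_sigma_finite.

Definition image_measure : {sigma_finite_measure set T2 -> \bar R} := image_nu.

Lemma image_measureE A : image_measure A = mu (f @^-1` A).
Proof. by []. Qed.

End image_measure.

(* The library's sigma-finite structure on m1 \x m2 is shadowed by the one for
   subprobabilities, hence the repackaging. *)
Section prod_measure.
Context d1 d2 (T1 : measurableType d1) (T2 : measurableType d2) (R : realType).
Variables (m1 : {sigma_finite_measure set T1 -> \bar R}).
Variables (m2 : {sigma_finite_measure set T2 -> \bar R}).

Let prod_nu : set (T1 * T2) -> \bar R := (m1 \x m2)%E.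

HB.instance Definition _ := Measure.copy prod_nu (m1 \x m2)%E.

Lemma prod_measure_sigma_finite : sigma_finite setT prod_nu.
Proof.
have /sigma_finiteP[F [TF ndF Foo]] := sigma_finiteT m1.
have /sigma_finiteP[G [TG ndG Goo]] := sigma_finiteT m2.
exists (fun n => F n `*` G n).
  rewrite -setXTT TF TG predeqE => -[x y]; split.
    move=> [/= [n _ Fnx] [k _ Gky]]; exists (maxn n k) => //; split.
    - by move: x Fnx; exact/subsetPset/ndF/leq_maxl.
    - by move: y Gky; exact/subsetPset/ndG/leq_maxr.
  by move=> [n _ []/= ? ?]; split; exists n.
move=> k; have [? ?] := Foo k; have [? ?] := Goo k.
split; first exact: measurableX.
by rewrite /prod_nu product_measure1E// lte_mul_pinfty// ge0_fin_numE.
Qed.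

HB.instance Definition _ :=
  @Measure_isSigmaFinite.Build _ _ _ prod_nu prod_measure_sigma_finite.

Definition prod_measure : {sigma_finite_measure set (T1 * T2)%type -> \bar R} :=
  prod_nu.

Lemma prod_measureE : prod_measure = (m1 \x m2)%E :> (set (T1 * T2) -> \bar R).
Proof. by []. Qed.

End prod_measure.

Section borel_complex.
Context {R : realType}.

Definition complex_of_pair (p : measurableTypeR R * measurableTypeR R) : R[i] := p.1 +i* p.2.

(* Borel sets of C, transported from R * R; measurableTypeR R is R. *)
Definition measurable_complex : set (set R[i]) :=
  [set A | measurable (complex_of_pair @^-1` A)].

Let measurable_complex0 : measurable_complex set0.
Proof. by rewrite /measurable_complex /= preimage_set0; exact: measurable0. Qed.

Let measurable_complexC A : measurable_complex A -> measurable_complex (~` A).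
Proof. by rewrite /measurable_complex /= preimage_setC; exact: measurableC. Qed.

Let measurable_complex_bigcup (F : (set R[i])^nat) :
  (forall i, measurable_complex (F i)) -> measurable_complex (\bigcup_i F i).
Proof.
move=> mF; rewrite /measurable_complex /= preimage_bigcup.
by apply: bigcup_measurable => k _; exact: mF.
Qed.

HB.instance Definition _ := @isMeasurable.Build default_measure_display R[i]
  measurable_complex measurable_complex0 measurable_complexC
  measurable_complex_bigcup.

Lemma measurable_complex_of_pair :
  measurable_fun setT complex_of_pair.
Proof. by move=> _ A mA; rewrite setTI. Qed.

Definition pair_of_complex (z : R[i]) : measurableTypeR R * measurableTypeR R :=
  (complex.Re z, complex.Im z).

Lemma complex_of_pairK : cancel complex_of_pair pair_of_complex.
Proof. by case. Qed.

Lemma measurable_pair_of_complex : measurable_fun setT pair_of_complex.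
Proof.
move=> _ A mA; rewrite setTI; rewrite /measurable /= /measurable_complex /=.
by rewrite -comp_preimage (_ : _ \o _ = id)//; apply/funext => -[].
Qed.

Definition lebesgue_complex : {sigma_finite_measure set R[i] -> \bar R} :=
  image_measure (prod_measure lebesgue_measure lebesgue_measure)
    measurable_complex_of_pair measurable_pair_of_complex complex_of_pairK.

End borel_complex.

Section measurable_matrix.
Context d (T : measurableType d) (m n : nat).

Definition mx_entries : set (set 'M[T]_(m, n)) :=
  \bigcup_(ij in [set: 'I_m * 'I_n])
    preimage_set_system setT (fun M : 'M[T]_(m, n) => M ij.1 ij.2) measurable.

HB.instance Definition _ := @isMeasurable.Build d 'M[T]_(m, n)
  <<s mx_entries >> (@sigma_algebra0 _ _ _) (@sigma_algebraC _ _)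
  (@sigma_algebra_bigcup _ _ _).

Lemma measurable_mx_entry i j :
  measurable_fun [set: 'M[T]_(m, n)] (fun M : 'M[T]_(m, n) => M i j).
Proof.
move=> _ A mA; apply: sub_sigma_algebra; exists (i, j) => //.
by exists A.
Qed.

Lemma measurable_mxP d' (U : measurableType d') (f : U -> 'M[T]_(m, n)) :
  (forall i j, measurable_fun [set: U] (fun x => f x i j)) ->
  measurable_fun [set: U] f.
Proof.
move=> mf; apply: (@measurability _ _ _ _ _ _ mx_entries) => //.
move=> _ [_ [[i j] _ [A mA <-]] <-].
by rewrite setTI; exact: mf.
Qed.

End measurable_matrix.

Section rV_power.
Context d (T : measurableType d) (R : realType).

Definition rV_cons n (p : T * 'rV[T]_n) : 'rV[T]_n.+1 :=
  \row_j (if unlift ord0 j is Some k then p.2 ord0 k else p.1).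

Definition rV_uncons n (v : 'rV[T]_n.+1) : T * 'rV[T]_n :=
  (v ord0 ord0, \row_k v ord0 (lift ord0 k)).

Lemma rV_consK n : cancel (@rV_cons n) (@rV_uncons n).
Proof.
move=> [x v]; rewrite /rV_uncons mxE unlift_none; congr (_, _).
by apply/rowP => k; rewrite !mxE liftK.
Qed.

Lemma measurable_rV_cons n : measurable_fun setT (@rV_cons n).
Proof.
apply: measurable_mxP => i j.
case: (unliftP ord0 j) => [k ->|->].
  rewrite (_ : (fun _ => _) = (fun v : 'rV[T]_n => v ord0 k) \o snd).
    by apply: measurableT_comp => //; exact: measurable_mx_entry.
  by apply/funext => p; rewrite mxE liftK.
rewrite (_ : (fun _ => _) = fst)//.
by apply/funext => p; rewrite mxE unlift_none.
Qed.

Lemma measurable_rV_uncons n : measurable_fun setT (@rV_uncons n).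
Proof.
apply: measurable_fun_pair; first exact: measurable_mx_entry.
apply: measurable_mxP => i j.
rewrite (_ : (fun _ => _) = fun v : 'rV[T]_n.+1 => v ord0 (lift ord0 j)).
  exact: measurable_mx_entry.
by apply/funext => v; rewrite mxE.
Qed.

(* n-fold product measure on 'rV[T]_n *)
Fixpoint rV_power (mu : {sigma_finite_measure set T -> \bar R}) (n : nat) :
    {sigma_finite_measure set 'rV[T]_n -> \bar R} :=
  match n with
  | 0 => dirac point
  | n'.+1 => image_measure (prod_measure mu (rV_power mu n'))
      (@measurable_rV_cons n') (@measurable_rV_uncons n') (@rV_consK n')
  end.

End rV_power.

Lemma rV_power_box d (T : measurableType d) (R : realType)
    (mu : {sigma_finite_measure set T -> \bar R}) n (A : 'I_n -> set T) :
  (forall j, measurable (A j)) ->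
  rV_power mu n [set v | forall j, A j (v ord0 j)] = (\prod_j mu (A j))%E.
Proof.
elim: n A => [|n IHn] A mA.
  rewrite big_ord0 /= diracE; apply/eqP; rewrite eqe pnatr_eq1 eqb1 inE.
  by move=> -[].
have mB : measurable [set v : 'rV[T]_n | forall j, A (lift ord0 j) (v ord0 j)].
  rewrite (_ : [set v | _] = \bigcap_(j in [set: 'I_n])
      (fun v : 'rV[T]_n => v ord0 j) @^-1` A (lift ord0 j)).
    apply: fin_bigcap_measurable => [|j _]; first exact: finite_finset.
    rewrite -[X in measurable X]setTI.
    exact: (measurable_mx_entry (T := T) ord0 j measurableT).
  by apply/seteqP; split=> v /= vA j => [_|]; exact: vA.
rewrite big_ord_recl -IHn// -product_measure1E//.
transitivity ((mu \x rV_power mu n)%E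
  (@rV_cons _ T n @^-1` [set v | forall j, A j (v ord0 j)])); first by [].
congr (_ _); apply/seteqP; split=> -[x v] /=.
  move=> vA; split; first by have := vA ord0; rewrite mxE unlift_none.
  by move=> j; have := vA (lift ord0 j); rewrite mxE liftK.
move=> [xA vA] j; rewrite mxE.
by case: (unliftP ord0 j) => [k ->|->]; [exact: vA|].
Qed.

Section probability_notions.
Context d (Omega : measurableType d) (R : realType) (Pr : probability Omega R).

Definition mutually_independent d' (T : measurableType d') (I : choiceType)
    (X : I -> {RV Pr >-> T}) : Prop :=
  forall (J : {fset I}) (B : I -> set T),
    (forall i, i \in J -> measurable (B i)) ->
    Pr (\bigcap_(i in [set` J]) X i @^-1` B i) =
      (\prod_(i <- J) Pr (X i @^-1` B i))%E.

Definition identically_distributed d' (T : measurableType d') (I : Type)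
    (X : I -> {RV Pr >-> T}) : Prop :=
  forall i j (B : set T), measurable B ->
    distribution Pr (X i) B = distribution Pr (X j) B.

Definition nondegenerate_RV d' (T : measurableType d') (X : {RV Pr >-> T}) : Prop :=
  ~ exists a : T, {ae Pr, forall w, X w = a}.

End probability_notions.

Section P_polynomials.
Context {R : realType} {d : nat}.
Implicit Types (P : set 'rV[R]_d) (f : 'rV[R]_d -> R) (z : 'rV[R[i]]_d).

Definition convex_body P : Prop :=
  [/\ compact P, convex_set (P : set (convex_lmodType 'rV[R]_d)) & P° !=set0].

Definition orthant : set 'rV[R]_d := [set t | forall j, 0 <= t ord0 j].

Definition natv (a : 'rV[nat]_d) : 'rV[R]_d := map_mx (fun k => k%:R) a.

Definition lattice_points P (n : nat) : set 'rV[nat]_d :=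
  [set a | [set n%:R *: t | t in P] (natv a)].

Definition monomial z (a : 'rV[nat]_d) : R[i] :=
  \prod_j z ord0 j ^+ a ord0 j.

(* For bounded P the range is finite; on an infinite support \sum_(a \in A)
   would default to 0. *)
Definition P_polynomial P (n : nat) (x c : 'rV[nat]_d -> R[i]) z : R[i] :=
  \sum_(a \in lattice_points P n) x a * c a * monomial z a.

(* lne 0 = -oo *)
Definition log_modulus (w : R[i]) : \bar R := lne (Normc.normc w)%:E.

(* n^-1 log|p|, with the convention that it is 0 when p vanishes identically *)
Definition normalized_log (n : nat) (p : 'rV[R[i]]_d -> R[i]) z : \bar R :=
  if `[< forall z', p z' = 0 >] then 0%E
  else (n%:R^-1%:E * log_modulus (p z))%E.

Definition weighted_support P f (s : 'rV[R]_d) : \bar R :=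
  ereal_sup [set (\sum_j s ord0 j * t ord0 j + ln (f t))%:E | t in P].

Definition torus : set 'rV[R[i]]_d := [set z | forall j, z ord0 j != 0].

Definition Log z : 'rV[R]_d := map_mx (fun w => ln (Normc.normc w)) z.

(* Restricting the neighbourhood filter to the torus makes the junk value
   ln 0 = 0 in Log irrelevant. *)
Definition Phi P f z : \bar R :=
  limf_esup (fun zeta => weighted_support P f (Log zeta))
    (within torus (nbhs z)).

End P_polynomials.

Section L1loc.
Context {R : realType} {d : nat}.
Implicit Types u v : 'rV[R[i]]_d -> \bar R.

Definition lebesgue_Cd : {sigma_finite_measure set 'rV[R[i]]_d -> \bar R} :=
  rV_power lebesgue_complex d.

Definition euclidean_norm (z : 'rV[R[i]]_d) : R :=
  Num.sqrt (\sum_j Normc.normc (z ord0 j) ^+ 2).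

Definition euclidean_cball (r : R) : set 'rV[R[i]]_d :=
  [set z | euclidean_norm z <= r].

(* Functions are \bar R-valued since log|p| is -oo at the zeros of p; the
   distance is +oo when u - v is not integrable on the ball. *)
Definition L1_dist (r : R) u v : \bar R :=
  (\int[lebesgue_Cd]_(z in euclidean_cball r) `|u z - v z|)%E.

Definition L1loc_dist u v : \bar R :=
  (\sum_(1 <= m <oo) (2^-1 ^+ m)%:E * mine 1 (L1_dist m%:R u v))%E.

End L1loc.

Definition cvg_in_probability_L1loc d0 (Omega : measurableType d0)
    (R : realType) (Pr : probability Omega R) (d : nat)
    (u : nat -> Omega -> 'rV[R[i]]_d -> \bar R) (v : 'rV[R[i]]_d -> \bar R) :
    Prop :=
  forall eps : R, 0 < eps ->
    Pr [set w | (eps%:E < L1loc_dist (u n w) v)%E] @[n --> \oo] --> 0%E.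

(* Main.v *)
Require Import Defs.
From HB Require Import structures.
From mathcomp Require Import all_boot all_order all_algebra finmap.
From mathcomp Require Import all_classical all_reals all_analysis.
From mathcomp Require Import measurable_realfun.
From mathcomp Require Import complex.
From mathcomp Require Import ring lra.

Set Implicit Arguments.
Unset Strict Implicit.
Unset Printing Implicit Defensive.

Import Order.TTheory GRing.Theory Num.Theory.
Import numFieldNormedType.Exports.

Local Open Scope classical_set_scope.
Local Open Scope ring_scope.
Local Open Scope complex_scope.

(** Why the theorem holds. Write I for the function [support P f], so that
    Phi z = I (Log z) on the torus, and u_n for n^-1 log|P_n|. Three estimates
    are combined.

    Upper bound. The tail condition and a union bound over the O(n^d) lattice
    points of nP show that, with probability tending to 1, every |xi_a| in use is
    at most e^(n e) ([large_event_near]). On that event the triangle inequality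
    gives |P_n(z)| <= e^(n (I(log Z) + 3 e)) as soon as |z_j| <= Z_j for all j
    ([P_polynomial_upper]).

    Lower bound at one point near a given w. The supremum I(Log w) is almost
    attained on a whole ball inside P, because P is convex with nonempty interior
    and f is continuous; hence for large n this ball contains the rescaled points
    of an arithmetic progression a_0, ..., a_(m-1) of lattice points of
    consecutive degrees, and each of the m terms |c_a w^a| exceeds
    e^(n (I(Log w) - e/2)). The monomial z^a is homogeneous, so in the value
    at q^i w its term gets multiplied by (q^(deg a))^i: Lagrange interpolation
    recovers from the m values P_n(q^i w), i < m, the linear forms
    xi_(a_k) + (a combination of the other xi_b), up to a factor that depends on
    m and q only ([extraction_bound]). If all m values were smaller than
    e^(n (I(Log w) - e)), these m forms would all be tiny. By independence and
    non-degeneracy this has probability at most theta^m, with some fixed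
    theta < 1 ([small_ball_linear], [small_event_near]). As m is arbitrary and q
    may be taken close to 1, with probability close to 1 there is a point w'
    close to w with u_n(w') > I(Log w) - e.

    From one point to L^1. The function log|P_n| satisfies the sub-mean value
    inequality on polydiscs ([polydisc_log_mean]). Applied to the nonnegative
    function A - u_n on a polydisc centred at w', where A is the upper bound, it
    bounds the L^1 distance between u_n and Phi on a polydisc around w by the
    oscillation of Phi plus a multiple of e, times a volume ([local_L1]).
    A ball is covered by finitely many polydiscs for which the sum of
    oscillation times volume is small ([exists_pieces]): small cells away from
    the coordinate hyperplanes, where Log is Lipschitz, and thin slabs around the
    hyperplanes, where Phi is bounded and the volume is small. Only finitely many
    centres occur, so the exceptional events are controlled by a union bound.

    The sub-mean value inequality itself rests on the rotation invariance of the
    area: the mean of log|b - z| over the rotations of z by the roots of unity of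
    order N = 2^k is N^-1 log|b^N - z^N|, which tends to max(log|b|, log|z|) off
    the circle |z| = |b| ([log_mean]). *)

(** * Lebesgue measure on the plane: invariance and measurability *)

Section complex_lebesgue.
Context {R : realType}.
Local Notation C := R[i].
Local Notation mR := (measurableTypeR R).
Local Notation leb := (@lebesgue_measure R).
Local Notation area := (@lebesgue_complex R).
Local Notation normc := (@Normc.normc R).

(** Uniqueness of Lebesgue measure: the shifted measure has the same value on intervals. *)
Lemma lebesgue_measure_shift (a : R) (A : set mR) : measurable A ->
  leb ((fun y : mR => y + a : mR) @^-1` A) = leb A.
Proof.
have mf : measurable_fun [set: mR] (fun y : mR => y + a : mR).
  exact: measurable_funD.
move=> mA; apply/esym.
have := @lebesgue_measure_unique R
  (measure_function_pushforward__canonical__measure_function_Measure leb mf).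
apply => //= _ [[u v]] _ <-; rewrite /pushforward.
rewrite (_ : _ @^-1` _ = `]u - a, v - a]%classic); last first.
  by apply/seteqP; split=> y /=; rewrite !in_itv /= ltrBlDr lerBrDr.
by rewrite !lebesgue_measure_itv /= !lte_fin ltrD2r; case: ifP => // _;
  congr EFin; ring.
Qed.

Definition preserves d (T : measurableType d) (mu : set T -> \bar R)
  (g : T -> T) := forall A, measurable A -> mu (g @^-1` A) = mu A.

Lemma preserves_comp d (T : measurableType d) (mu : set T -> \bar R) (g h : T -> T) :
  measurable_fun [set: T] g -> preserves mu g -> preserves mu h -> preserves mu (g \o h).
Proof.
move=> mg pg ph A mA; rewrite comp_preimage ph ?pg//.
by rewrite -[X in measurable X]setTI; exact: mg.
Qed.

(** The shears (x, y) -> (x, y + h x) and (x, y) -> (x + h y, y) translate each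
    line of one of the two directions, so Fubini reduces their invariance to the
    translation invariance on the line. They generate the translations and, three
    at a time, the rotations of the plane; no change of variables is needed. *)
Definition vshear (h : mR -> mR) (p : mR * mR) : mR * mR := (p.1, p.2 + h p.1).
Definition hshear (h : mR -> mR) (p : mR * mR) : mR * mR := (p.1 + h p.2, p.2).

Lemma measurable_vshear h : measurable_fun setT h -> measurable_fun setT (vshear h).
Proof.
move=> mh; apply: measurable_fun_pair; first exact: measurable_fst.
apply: measurable_funD; first exact: measurable_snd.
by apply: measurableT_comp => //; exact: measurable_fst.
Qed.

Lemma measurable_hshear h : measurable_fun setT h -> measurable_fun setT (hshear h).
Proof.
move=> mh; apply: measurable_fun_pair; last exact: measurable_snd.
apply: measurable_funD; first exact: measurable_fst.
by apply: measurableT_comp => //; exact: measurable_snd.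
Qed.

Lemma vshear_preserves h : measurable_fun setT h ->
  preserves (leb \x leb)%E (vshear h).
Proof.
move=> mh A mA; rewrite /product_measure1; apply: eq_integral => x _ /=.
rewrite (_ : xsection _ x = (fun y : mR => y + h x : mR) @^-1` xsection A x).
  by rewrite lebesgue_measure_shift//; exact: measurable_xsection.
by apply/seteqP; split=> y; rewrite /xsection /= !inE.
Qed.

(** Horizontal shears act on the sections in the second variable, on which the
    other iterated integral is computed. *)
Lemma product_measure12 (A : set (mR * mR)) : measurable A ->
  (leb \x leb)%E A = (leb \x^ leb)%E A.
Proof.
by move=> mA; apply: product_measure_unique => //= B D mB mD; exact: product_measure2E.
Qed.

Lemma hshear_preserves h : measurable_fun setT h ->
  preserves (leb \x leb)%E (hshear h).
Proof.
move=> mh A mA; rewrite !product_measure12//; last first.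
  by rewrite -[X in measurable X]setTI; exact: measurable_hshear.
rewrite /product_measure2; apply: eq_integral => x _ /=.
rewrite (_ : ysection _ x = (fun y : mR => y + h x : mR) @^-1` ysection A x).
  by rewrite lebesgue_measure_shift//; exact: measurable_ysection.
by apply/seteqP; split=> y; rewrite /ysection /= !inE.
Qed.

Lemma ge0_integral_preserves d (T : measurableType d) (mu : {measure set T -> \bar R})
    (g : T -> T) (D : set T) (f : T -> \bar R) :
  measurable_fun setT g -> preserves mu g -> measurable D ->
  measurable_fun D f -> (forall x, D x -> 0 <= f x)%E ->
  (\int[mu]_(x in g @^-1` D) f (g x) = \int[mu]_(x in D) f x)%E.
Proof.
move=> mg pg mD mf f0; rewrite -(ge0_integral_pushforward mg)//.
  apply: (@eq_measure_integral _ _ _ D mu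
    (measure_function_pushforward__canonical__measure_function_Measure mu mg)).
  by move=> A mA _; exact: pg.
by move=> x; rewrite inE; exact: f0.
Qed.

Lemma lebesgue_complexE (A : set C) :
  area A = (leb \x leb)%E (@complex_of_pair R @^-1` A).
Proof. by []. Qed.

Definition conj_pair (g : mR * mR -> mR * mR) (z : C) : C :=
  complex_of_pair (g (pair_of_complex z)).

Lemma conj_pair_preserves g : preserves (leb \x leb)%E g -> preserves area (conj_pair g).
Proof.
move=> pg A mA; rewrite !lebesgue_complexE -[RHS]pg//.
Qed.

Lemma measurable_Re : measurable_fun [set: C] (fun z : C => complex.Re z : mR).
Proof. exact: (measurableT_comp measurable_fst measurable_pair_of_complex). Qed.

Lemma measurable_Im : measurable_fun [set: C] (fun z : C => complex.Im z : mR).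
Proof. exact: (measurableT_comp measurable_snd measurable_pair_of_complex). Qed.

Lemma measurable_complexP d (T : measurableType d) (f : T -> C) :
  measurable_fun setT (fun x => complex.Re (f x) : mR) ->
  measurable_fun setT (fun x => complex.Im (f x) : mR) ->
  measurable_fun setT f.
Proof.
move=> mr mi; rewrite (_ : f = complex_of_pair \o
    (fun x => (complex.Re (f x) : mR, complex.Im (f x) : mR))).
  apply: (measurableT_comp measurable_complex_of_pair).
  exact: measurable_fun_pair.
by apply/funext => x /=; rewrite /complex_of_pair /=; case: (f x).
Qed.

Lemma measurable_ReP d (T : measurableType d) (f : T -> C) :
  measurable_fun setT f -> measurable_fun setT (fun x => complex.Re (f x) : mR).
Proof. exact: measurableT_comp measurable_Re. Qed.

Lemma measurable_ImP d (T : measurableType d) (f : T -> C) :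
  measurable_fun setT f -> measurable_fun setT (fun x => complex.Im (f x) : mR).
Proof. exact: measurableT_comp measurable_Im. Qed.

Lemma measurable_complexD d (T : measurableType d) (f g : T -> C) :
  measurable_fun setT f -> measurable_fun setT g -> measurable_fun setT (fun x => f x + g x).
Proof.
move=> mf mg; apply: measurable_complexP.
- rewrite (_ : (fun _ => _) = (fun x => complex.Re (f x) + complex.Re (g x))).
    by apply: measurable_funD; exact: measurable_ReP.
  by apply/funext => x; case: (f x) => a b; case: (g x).
- rewrite (_ : (fun _ => _) = (fun x => complex.Im (f x) + complex.Im (g x))).
    by apply: measurable_funD; exact: measurable_ImP.
  by apply/funext => x; case: (f x) => a b; case: (g x).
Qed.

Lemma measurable_complexM d (T : measurableType d) (f g : T -> C) :
  measurable_fun setT f -> measurable_fun setT g -> measurable_fun setT (fun x => f x * g x).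
Proof.
move=> mf mg; apply: measurable_complexP.
- rewrite (_ : (fun _ => _) = (fun x => complex.Re (f x) * complex.Re (g x)
     - complex.Im (f x) * complex.Im (g x))).
    by apply: measurable_funB; apply: measurable_funM;
      (exact: measurable_ReP || exact: measurable_ImP).
  by apply/funext => x; case: (f x) => a b; case: (g x).
- rewrite (_ : (fun _ => _) = (fun x => complex.Re (f x) * complex.Im (g x)
     + complex.Im (f x) * complex.Re (g x))).
    by apply: measurable_funD; apply: measurable_funM;
      (exact: measurable_ReP || exact: measurable_ImP).
  by apply/funext => x; case: (f x) => a b; case: (g x).
Qed.

Lemma measurable_complex_sum d (T : measurableType d) (I : Type) (s : seq I)
    (f : I -> T -> C) : (forall i, measurable_fun setT (f i)) ->
  measurable_fun setT (fun x => \sum_(i <- s) f i x).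
Proof.
move=> mf; elim: s => [|i s IH].
  by under eq_fun do rewrite big_nil; exact: measurable_cst.
by under eq_fun do rewrite big_cons; exact: measurable_complexD.
Qed.

Lemma measurable_complex_prod d (T : measurableType d) (I : Type) (s : seq I)
    (f : I -> T -> C) : (forall i, measurable_fun setT (f i)) ->
  measurable_fun setT (fun x => \prod_(i <- s) f i x).
Proof.
move=> mf; elim: s => [|i s IH].
  by under eq_fun do rewrite big_nil; exact: measurable_cst.
by under eq_fun do rewrite big_cons; exact: measurable_complexM.
Qed.

Lemma measurable_complexX d (T : measurableType d) (f : T -> C) n :
  measurable_fun setT f -> measurable_fun setT (fun x => f x ^+ n).
Proof.
move=> mf; elim: n => [|n IH].
  by under eq_fun do rewrite expr0; exact: measurable_cst.
by under eq_fun do rewrite exprS; exact: measurable_complexM.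
Qed.

Lemma measurable_horner (p : {poly C}) : measurable_fun setT (fun z => p.[z]).
Proof.
under eq_fun do rewrite horner_coef.
apply: measurable_complex_sum => i; apply: measurable_complexM.
  exact: measurable_cst.
exact: measurable_complexX.
Qed.

Lemma measurable_normc d (T : measurableType d) (f : T -> C) :
  measurable_fun setT f -> measurable_fun setT (fun x => normc (f x) : mR).
Proof.
move=> mf.
rewrite (_ : (fun _ => _) = (fun x => Num.sqrt (complex.Re (f x) ^+ 2 + complex.Im (f x) ^+ 2))).
  apply: (measurableT_comp (f := fun x : mR => Num.sqrt x : mR)).
    apply: continuous_measurable_fun; exact: sqrt_continuous.
  apply: measurable_funD; apply: measurable_funX;
    (exact: measurable_ReP || exact: measurable_ImP).
by apply/funext => x; case: (f x).
Qed.

Lemma measurable_lne_EFin : measurable_fun [set: mR] (fun x : mR => lne x%:E).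
Proof.
rewrite /lne; apply: measurable_fun_ifT.
- by apply: measurable_fun_ler => //; exact: measurable_cst.
- exact: measurable_cst.
- by apply: (measurableT_comp (f := EFin)) => //; exact: measurable_ln.
Qed.

Lemma measurable_log_modulus d (T : measurableType d) (f : T -> C) :
  measurable_fun setT f -> measurable_fun setT (fun x => log_modulus (f x)).
Proof.
move=> mf; apply: (measurableT_comp measurable_lne_EFin).
exact: measurable_normc.
Qed.

End complex_lebesgue.

(** * Modulus and its logarithm *)

Section log_modulus_algebra.
Context {R : realType}.
Local Notation C := R[i].
Local Notation normc := (@Normc.normc R).

Lemma normc_ge0 (z : C) : 0 <= normc z.
Proof. by case: z => a b; exact: sqrtr_ge0. Qed.

Lemma normc_eq0 (z : C) : (normc z == 0) = (z == 0).
Proof.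
apply/eqP/eqP => [/Normc.eq0_normc//|->]; exact: Normc.normc0.
Qed.

Lemma normc_gt0 (z : C) : (0 < normc z) = (z != 0).
Proof. by rewrite lt0r normc_eq0 normc_ge0 andbT. Qed.

Lemma normc_normr (z : C) : (normc z)%:C = `|z|.
Proof. by []. Qed.

Lemma normcX (z : C) n : normc (z ^+ n) = normc z ^+ n.
Proof.
elim: n => [|n IH]; first by rewrite !expr0 Normc.normc1.
by rewrite !exprS Normc.normcM IH.
Qed.

Lemma normcB (x y : C) : normc (x - y) = normc (y - x).
Proof. by rewrite -(opprB y x); exact: normcN. Qed.

Lemma normcD_le (x y : C) : normc (x + y) <= normc x + normc y.
Proof. exact: le_normcD. Qed.

Lemma normcB_ge (x y : C) : normc x - normc y <= normc (x - y).
Proof. by rewrite lerBlDr; have := normcD_le (x - y) y; rewrite subrK. Qed.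

Lemma normc_sum (I : Type) (s : seq I) (P : pred I) (F : I -> C) :
  normc (\sum_(i <- s | P i) F i) <= \sum_(i <- s | P i) normc (F i).
Proof.
elim/big_ind2: _ => [|x a y b xa yb|//]; first by rewrite Normc.normc0.
by rewrite (le_trans (normcD_le _ _))// lerD.
Qed.

Lemma normc_prod (I : Type) (s : seq I) (P : pred I) (F : I -> C) :
  normc (\prod_(i <- s | P i) F i) = \prod_(i <- s | P i) normc (F i).
Proof.
elim/big_ind2: _ => [|x a y b <- <-|//]; [exact: Normc.normc1|exact: Normc.normcM].
Qed.

Lemma normc_real (x : R) : normc x%:C = `|x|.
Proof. by rewrite /= expr0n /= addr0 sqrtr_sqr. Qed.

Lemma log_modulus0 : log_modulus (0 : C) = -oo%E.
Proof. by rewrite /log_modulus Normc.normc0 /= lexx. Qed.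

Lemma log_modulusE (z : C) : z != 0 -> log_modulus z = (ln (normc z))%:E.
Proof. by move=> z0; rewrite /log_modulus lne_EFin// normc_gt0. Qed.

Lemma log_modulus_neqy (z : C) : log_modulus z != +oo%E.
Proof.
by have [->|z0] := eqVneq z 0; rewrite ?log_modulus0// log_modulusE.
Qed.

Lemma log_modulusM (x y : C) : log_modulus (x * y) = (log_modulus x + log_modulus y)%E.
Proof.
have [->|x0] := eqVneq x 0; first by rewrite mul0r log_modulus0 addNye// log_modulus_neqy.
have [->|y0] := eqVneq y 0; first by rewrite mulr0 log_modulus0 addeNy.
rewrite !log_modulusE ?mulf_neq0// Normc.normcM lnM ?posrE ?normc_gt0//.
Qed.

Lemma log_modulus_prod (I : Type) (s : seq I) (F : I -> C) :
  log_modulus (\prod_(i <- s) F i) = (\sum_(i <- s) log_modulus (F i))%E.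
Proof.
elim: s => [|i s IH]; first by rewrite !big_nil log_modulusE ?oner_eq0// Normc.normc1 ln1.
by rewrite !big_cons log_modulusM IH.
Qed.

Lemma log_modulus_le (z : C) (a : R) : normc z <= expR a -> (log_modulus z <= a%:E)%E.
Proof.
move=> za; have [->|z0] := eqVneq z 0; first by rewrite log_modulus0 leNye.
by rewrite log_modulusE// lee_fin -[leRHS]expRK ler_ln// posrE ?normc_gt0 ?expR_gt0.
Qed.

End log_modulus_algebra.

(** * Rotations and discs *)

Section disc_mean.
Context {R : realType}.
Local Notation C := R[i].
Local Notation mR := (measurableTypeR R).
Local Notation area := (@lebesgue_complex R).
Local Notation normc := (@Normc.normc R).

Definition disc (w : C) (r : R) : set C := [set z | normc (z - w) < r].

Lemma measurable_disc w r : measurable (disc w r).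
Proof.
rewrite -[X in measurable X]setTI.
have := @measurable_fun_ltr _ _ R setT (fun z : C => normc (z - w)) (cst r).
apply => //.
by apply: measurable_normc; apply: measurable_complexD.
Qed.

Lemma preserves_translation (w : C) : preserves area (fun z => z + w).
Proof.
case: w => a b.
rewrite (_ : (fun _ => _) = conj_pair (vshear (cst b) \o hshear (cst a))).
  apply: conj_pair_preserves; apply: preserves_comp.
  - apply: measurable_vshear; exact: measurable_cst.
  - apply: vshear_preserves; exact: measurable_cst.
  - apply: hshear_preserves; exact: measurable_cst.
by apply/funext => -[x y].
Qed.

(** The rotation of angle x is the product of three shears, with slopes
    -tan(x/2), sin x and -tan(x/2); here tan(x/2) = s / (1 + c), which excludes
    the half turn c = -1. *)
Lemma preserves_rotation_shear (u : C) : normc u = 1 -> complex.Re u != -1 ->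
  preserves area (fun z => u * z).
Proof.
case: u => c s /= cs c1.
have {}cs : c ^+ 2 + s ^+ 2 = 1.
  by rewrite -(sqr_sqrtr (a := c ^+ 2 + s ^+ 2)) ?cs ?expr1n// addr_ge0 ?sqr_ge0.
have c10 : 1 + c != 0 by rewrite addrC addr_eq0.
pose t := s / (1 + c).
have ts : t * s = 1 - c.
  apply: (mulIf c10); rewrite /t; rewrite mulrAC mulfVK//; rewrite -expr2.
  by rewrite -[s ^+ 2](addKr (c ^+ 2)) cs; ring.
have mt k : measurable_fun [set: mR] (fun y : mR => k * y : mR).
  by apply: measurable_funM => //; exact: measurable_cst.
rewrite (_ : (fun _ => _) = conj_pair (hshear (fun y => - t * y) \o
   (vshear (fun x => s * x) \o hshear (fun y => - t * y)))).
  apply: conj_pair_preserves; apply: preserves_comp.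
  - exact: measurable_hshear.
  - exact: hshear_preserves.
  apply: preserves_comp.
  - exact: measurable_vshear.
  - exact: vshear_preserves.
  - exact: hshear_preserves.
apply/funext => -[x y]; rewrite /conj_pair /hshear /vshear /complex_of_pair /=.
have tc : t * (1 + c) = s by rewrite /t mulfVK.
apply/eqP; rewrite eq_complex /=; apply/andP; split; apply/eqP.
- transitivity ((1 - t * s) * x - t * (1 + (1 - t * s)) * y); last by ring.
  by rewrite ts opprB addrCA subrr addr0 tc; ring.
- transitivity ((1 - t * s) * y + s * x); last by ring.
  by rewrite ts opprB addrCA subrr addr0; ring.
Qed.

Lemma measurable_complexMl (u : C) : measurable_fun [set: C] (fun z : C => u * z).
Proof. by apply: measurable_complexM => //; exact: measurable_cst. Qed.

(** The half turn is the square of a quarter turn. *)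
Lemma preserves_rotation (u : C) : normc u = 1 -> preserves area (fun z => u * z).
Proof.
move=> u1; have [u_1|] := eqVneq (complex.Re u) (-1); last exact: preserves_rotation_shear.
have -> : u = 'i * 'i.
  case: u u1 u_1 => a b /= ab a1; rewrite a1 in ab *; apply/eqP; rewrite eq_complex /=.
  rewrite !mul0r !mul1r sub0r addr0 eqxx /=.
  move: ab => /(congr1 (fun x => x ^+ 2)); rewrite sqr_sqrtr ?addr_ge0 ?sqr_ge0//.
  rewrite sqrrN expr1n => /eqP; rewrite -subr_eq0 addrAC subrr add0r.
  by rewrite sqrf_eq0.
have pi : preserves area (fun z => 'i * z).
  apply: preserves_rotation_shear => /=.
    by rewrite expr0n expr1n /= add0r sqrtr1.
  by rewrite eq_sym oppr_eq0 oner_eq0.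
rewrite (_ : (fun _ => _) = (fun z : C => 'i * z) \o (fun z : C => 'i * z)).
  apply: preserves_comp => //; exact: measurable_complexMl.
by apply/funext => z /=; rewrite mulrA.
Qed.

(** Every vertical line meets a circle in at most two points. *)
Lemma circle_null (a : R) : area [set z | normc z = a] = 0%E.
Proof.
rewrite lebesgue_complexE /product_measure1.
apply: integral0_eq => x _ /=; apply: countable_lebesgue_measure0.
apply: (@sub_countable _ _ _ [set Num.sqrt (a ^+ 2 - x ^+ 2); - Num.sqrt (a ^+ 2 - x ^+ 2)]).
  apply: subset_card_le => y; rewrite /xsection /= inE /= => <-.
  rewrite sqr_sqrtr ?addr_ge0 ?sqr_ge0// addrAC subrr add0r sqrtr_sqr.
  have [y0|y0] := leP 0 y; first by left; rewrite ger0_norm.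
  by right; rewrite ltr0_norm// opprK.
by apply: finite_set_countable; rewrite finite_setU; split; exact: finite_set1.
Qed.

End disc_mean.

(** * The sub-mean value inequality on discs *)

Arguments log_modulus {R} w%_ring_scope.

Section mean_value.
Context {R : realType}.
Local Notation C := R[i].
Local Notation leb := (@lebesgue_measure R).
Local Notation area := (@lebesgue_complex R).
Local Notation normc := (@Normc.normc R).

Lemma area_disc_le (w : C) r : (area (disc w r) <= ((2 * r) ^+ 2)%:E)%E.
Proof.
have [r0|r0] := ltP r 0.
  rewrite (_ : disc w r = set0) ?measure0 ?lee_fin ?sqr_ge0//.
  apply/seteqP; split=> z //=; rewrite /disc /= => /(le_lt_trans (normc_ge0 _)).
  by rewrite ltNge ltW.
case: w => a b; rewrite lebesgue_complexE.
have h (c : R) : leb `]c - r, c + r[%classic = (2 * r)%:E.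
  rewrite lebesgue_measure_itv /= lte_fin; case: ifPn => [_|].
    by rewrite -EFinD; congr EFin; ring.
  rewrite -leNgt => ?; have -> : r = 0 by lra.
  by rewrite mulr0.
rewrite expr2 EFinM -{1}(h a) -(h b) -product_measure1E//.
apply: le_measure; rewrite ?inE//.
- rewrite -[X in measurable X]setTI; apply: measurable_complex_of_pair => //.
  exact: measurable_disc.
- exact: measurableX.
move=> [x y]; rewrite /disc /= !in_itv /= => h1.
have hx : `|x - a| < r.
  apply: le_lt_trans h1; rewrite -sqrtr_sqr ler_wsqrtr// lerDl sqr_ge0//.
have hy : `|y - b| < r.
  apply: le_lt_trans h1; rewrite -sqrtr_sqr ler_wsqrtr// lerDr sqr_ge0//.
by move: hx hy; rewrite !ltr_norml => /andP[? ?] /andP[? ?]; split; apply/andP; split; lra.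
Qed.

Lemma area_disc_fin w r : area (disc w r) \is a fin_num.
Proof.
by rewrite ge0_fin_numE// (le_lt_trans (area_disc_le _ _))// ltry.
Qed.

Lemma area_disc_gt0 (w : C) r : 0 < r -> (0 < area (disc w r))%E.
Proof.
move=> r0; case: w => a b; rewrite lebesgue_complexE.
have h (c : R) : leb `]c - r / 2, c + r / 2[%classic = r%:E.
  rewrite lebesgue_measure_itv /= lte_fin ifT; last lra.
  by rewrite -EFinD; congr EFin; field.
apply: (@lt_le_trans _ _ (r%:E * r%:E)%E); first by rewrite -EFinM lte_fin mulr_gt0.
rewrite -{1}(h a) -(h b) -product_measure1E//.
apply: le_measure; rewrite ?inE//.
- exact: measurableX.
- rewrite -[X in measurable X]setTI; apply: measurable_complex_of_pair => //.
  exact: measurable_disc.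
move=> [x y]; rewrite /disc /= !in_itv /= => -[/andP[? ?] /andP[? ?]].
rewrite -[ltRHS](gtr0_norm r0) -sqrtr_sqr ltr_sqrt ?exprn_gt0//; nra.
Qed.

Lemma exists_root_m1 (k : nat) : exists2 u : C, normc u = 1 & u ^+ (2 ^ k) = -1.
Proof.
elim: k => [|k [u u1 uk]].
  by exists (-1); rewrite ?expr1//; exact: (etrans (normcN _) (@Normc.normc1 R)).
exists (sqrtc u); last by rewrite expnS exprM sqr_sqrtc.
have : normc (sqrtc u) ^+ 2 = 1 by rewrite -normcX sqr_sqrtc.
by move/eqP; rewrite sqrp_eq1 ?normc_ge0// => /eqP.
Qed.

(** The mean of A - log|b - u z| over the u with u^N = 1, N = 2^k. The N factors
    b - u z multiply to b^N - z^N, whence the closed form. Orders that are powers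
    of 2 allow an induction on k that uses one rotation at a time. The constant A
    is an upper bound of log|b - z|, so that only nonnegative functions get
    integrated. *)
Definition rotation_avg (A : R) (b : C) (k : nat) (z : C) : \bar R :=
  (A%:E - (2%:R ^- k)%:E * log_modulus (b ^+ (2 ^ k) - z ^+ (2 ^ k))%R)%E.

Arguments rotation_avg A b%_R k%_N z%_R.

Lemma measurable_rotation_avg A b k : measurable_fun setT (rotation_avg A b k).
Proof.
apply: emeasurable_funB; first exact: measurable_cst.
apply: emeasurable_funM; first exact: measurable_cst.
apply: measurable_log_modulus.
under eq_fun do rewrite -mulN1r.
apply: measurable_complexD; first exact: measurable_cst.
apply: measurable_complexM; first exact: measurable_cst.
by apply: measurable_complexX.
Qed.

(** |b^N - z^N| <= |b|^N + |z|^N <= (|b| + r)^N. *)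
Lemma rotation_avg_ge0 (b : C) r k z : normc z <= r -> 0 < r ->
  (0 <= rotation_avg (ln (normc b + r)) b k z)%E.
Proof.
move=> zr r0; have br0 : 0 < normc b + r by rewrite ltr_wpDl// normc_ge0.
rewrite /rotation_avg.
have h : (log_modulus (b ^+ (2 ^ k) - z ^+ (2 ^ k)) <= (2%:R ^+ k * ln (normc b + r))%:E)%E.
  apply: log_modulus_le.
  rewrite -natrX mulr_natl -lnXn// lnK ?posrE ?exprn_gt0//.
  apply: (le_trans (normcD_le _ _)).
  rewrite (_ : normc (- _) = normc z ^+ (2 ^ k)); last by rewrite -normcX; exact: normcN.
  rewrite normcX; apply: (@le_trans _ _ ((normc b + normc z) ^+ (2 ^ k))); last first.
    by apply: lerXn2r; rewrite ?nnegrE ?addr_ge0 ?normc_ge0 ?(ltW r0) ?lerD2l.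
  have : (0 < 2 ^ k)%N by rewrite expn_gt0.
  case: (2 ^ k)%N => // n _.
  elim: n => [|n IH]; first by rewrite !expr1.
  rewrite exprS [in X in _ + X <= _]exprS [in leRHS]exprS mulrDl.
  rewrite lerD// ler_wpM2l ?normc_ge0//.
    by rewrite (le_trans _ IH)// lerDl exprn_ge0 ?normc_ge0.
  by rewrite (le_trans _ IH)// lerDr exprn_ge0 ?normc_ge0.
have p2 : 0 < (2%:R ^- k : R) by rewrite invr_gt0 exprn_gt0.
have [/eqP z0|z0] := boolP (b ^+ (2 ^ k) - z ^+ (2 ^ k) == 0).
  by rewrite z0 log_modulus0 gt0_muleNy ?lte_fin//= leey.
move: h; rewrite log_modulusE// -EFinM -EFinB !lee_fin subr_ge0 => h.
by rewrite mulrC ler_pdivrMr ?exprn_gt0// mulrC.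
Qed.

(** From b^2N - z^2N = (b^N - z^N) (b^N + z^N), where the second factor is the
    first one at u z since u^N = -1. *)
Lemma rotation_avg_halve A b k (u z : C) : u ^+ (2 ^ k) = -1 ->
  (rotation_avg A b k.+1 z = (2^-1)%:E * (rotation_avg A b k z + rotation_avg A b k (u * z)))%E.
Proof.
move=> uk; rewrite /rotation_avg.
have -> : b ^+ (2 ^ k.+1) - z ^+ (2 ^ k.+1) =
    (b ^+ (2 ^ k) - z ^+ (2 ^ k)) * (b ^+ (2 ^ k) - (u * z) ^+ (2 ^ k)).
  by rewrite expnS mulnC !exprM subr_sqr exprMn uk mulN1r opprK.
set X := _ - _; set Y := _ - _; rewrite log_modulusM.
have p2 j : 0 < (2%:R ^- j : R) by rewrite invr_gt0 exprn_gt0.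
have [->|X0] := eqVneq X 0.
  rewrite log_modulus0 addNye ?log_modulus_neqy// !gt0_muleNy ?lte_fin ?p2//=.
  have -> : (A%:E + +oo = +oo)%E by [].
  rewrite addye ?gt0_muley ?lte_fin ?invr_gt0//.
  have := log_modulus_neqy Y; case: (log_modulus Y) => [y| |]//= _.
  by rewrite gt0_muleNy ?lte_fin ?p2.
have [->|Y0] := eqVneq Y 0.
  rewrite log_modulus0 addeNy ?log_modulus_neqy// !gt0_muleNy ?lte_fin ?p2//=.
  have -> : (A%:E + +oo = +oo)%E by [].
  rewrite addey ?gt0_muley ?lte_fin ?invr_gt0//.
  by rewrite log_modulusE.
rewrite !log_modulusE// -!(EFinM, EFinB, EFinD); congr EFin.
by rewrite exprS invfM; field; rewrite expf_neq0.
Qed.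

#[local] Opaque rotation_avg.

(** On a rotation invariant set all the averages have the integral of the first
    one. *)
Lemma integral_rotation_avg (r : R) b k (S : set C) : 0 < r -> measurable S ->
  S `<=` [set z | normc z <= r] ->
  (forall u z, normc u = 1 -> S (u * z) <-> S z) ->
  (\int[area]_(z in S) rotation_avg (ln (normc b + r)) b k z =
   \int[area]_(z in S) rotation_avg (ln (normc b + r)) b 0 z)%E.
Proof.
move=> r0 mS Sr Srot; elim: k => // k <-.
have [u u1 uk] := exists_root_m1 k.
under eq_integral do rewrite (rotation_avg_halve _ _ _ uk).
have a0 z : S z -> (0 <= rotation_avg (ln (normc b + r)) b k z)%E by move=> /Sr zr; exact: rotation_avg_ge0.
have mk : measurable_fun S (rotation_avg (ln (normc b + r)) b k).
  apply: measurable_funTS; exact: measurable_rotation_avg.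
have mu1 : measurable_fun S (fun z => rotation_avg (ln (normc b + r)) b k (u * z)).
  apply: measurable_funTS.
  exact: (measurableT_comp (measurable_rotation_avg _ _ _) (measurable_complexMl u)).
have a1 z : S z -> (0 <= rotation_avg (ln (normc b + r)) b k (u * z))%E.
  by move=> Sz; apply: a0; apply/Srot.
rewrite ge0_integralZl//; last 2 first.
- exact: emeasurable_funD.
- by move=> z Sz; apply: adde_ge0; [exact: a0|exact: a1].
rewrite ge0_integralD//.
have -> : (\int[area]_(z in S) rotation_avg (ln (normc b + r)) b k (u * z) =
    \int[area]_(z in S) rotation_avg (ln (normc b + r)) b k z)%E.
  rewrite -[RHS](ge0_integral_preserves (measurable_complexMl u) (preserves_rotation u1))//.
  by congr (integral _ _ _); apply/seteqP; split=> z /=; rewrite Srot.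
set I := (\int[_]_(_ in _) _)%E.
have I0 : (0 <= I)%E by exact: integral_ge0.
rewrite ge0_muleDr// -ge0_muleDl ?lee_fin ?invr_ge0// -EFinD.
by rewrite (_ : 2^-1 + 2^-1 = 1 :> R) ?mul1e//; field.
Qed.

End mean_value.

Arguments disc {R} w%_ring_scope r%_ring_scope.

Section disc_mean_value.
Context {R : realType}.
Local Notation C := R[i].
Local Notation mR := (measurableTypeR R).
Local Notation area := (@lebesgue_complex R).
Local Notation normc := (@Normc.normc R).

#[local] Transparent rotation_avg.

Lemma rotation_avg0E (A : R) (b z : C) : rotation_avg A b 0 z = (A%:E - log_modulus (b - z))%E.
Proof. by rewrite /rotation_avg expr0 invr1 mul1e !expr1. Qed.

(** Off the circle |z| = |b|, one of |b|^N and |z|^N is at least twice the other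
    once N is large (Bernoulli), so |b^N - z^N| >= |b|^N / 2. *)
Lemma rotation_avg_off_circle (A : R) (b : C) k (z : C) (e : R) : b != 0 -> 0 < e -> 1 <= (2 ^ k)%:R * e ->
  normc z * (1 + e) <= normc b \/ normc b * (1 + e) <= normc z ->
  (rotation_avg A b k z <= (A - ln (normc b) + ln 2 * 2%:R ^- k)%:E)%E.
Proof.
move=> b0 e0 ke hz; set N := (2 ^ k)%N in ke *.
have pow2 : 2 <= (1 + e) ^+ N.
  have : 1 + N%:R * e <= (1 + e) ^+ N.
    elim: N {ke} => [|N IH]; first by rewrite mul0r addr0 expr0.
    rewrite exprS; apply: le_trans (_ : (1 + e) * (1 + N%:R * e) <= _); last first.
      by rewrite ler_wpM2l// addr_ge0// ltW.
    have N0 : 0 <= N%:R :> R by [].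
    rewrite -natr1; nra.
  by apply: le_trans; lra.
have e1 : 0 <= 1 + e by lra.
have nb0 : 0 < normc b by rewrite normc_gt0.
have bN0 : 0 < normc b ^+ N by rewrite exprn_gt0.
have low : normc b ^+ N / 2 <= normc (b ^+ N - z ^+ N).
  case: hz => hz.
    have zb : normc z ^+ N * 2 <= normc b ^+ N.
      apply: le_trans (_ : (normc z * (1 + e)) ^+ N <= _).
        by rewrite exprMn ler_wpM2l ?exprn_ge0 ?normc_ge0.
      by apply: lerXn2r; rewrite ?nnegrE ?mulr_ge0 ?normc_ge0.
    apply: le_trans (normcB_ge _ _); rewrite !normcX; lra.
  have zb : normc b ^+ N * 2 <= normc z ^+ N.
    apply: le_trans (_ : (normc b * (1 + e)) ^+ N <= _).
      by rewrite exprMn ler_wpM2l ?exprn_ge0 ?normc_ge0.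
    by apply: lerXn2r; rewrite ?nnegrE ?mulr_ge0 ?normc_ge0.
  rewrite normcB; apply: le_trans (normcB_ge _ _); rewrite !normcX; lra.
have w0 : b ^+ N - z ^+ N != 0.
  by rewrite -normc_gt0 (lt_le_trans _ low)// divr_gt0.
rewrite /rotation_avg -/N log_modulusE// -EFinM -EFinB lee_fin.
have : ln (normc b ^+ N / 2) <= ln (normc (b ^+ N - z ^+ N)).
  by rewrite ler_ln ?posrE ?divr_gt0// normc_gt0.
rewrite ln_div ?posrE// lnXn// -[_ *+ N]mulr_natl.
have -> : 2 ^- k = (N%:R)^-1 :> R by rewrite natrX.
have N0 : 0 < N%:R :> R by rewrite ltr0n expn_gt0.
move=> h; rewrite -addrA lerD2l -(ler_pM2l N0) mulrN mulrA divff ?gt_eqF// mul1r.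
rewrite mulrDr mulrN (mulrCA N%:R) divff ?gt_eqF// mulr1; lra.
Qed.

#[local] Opaque rotation_avg.

Lemma exists_pow2 (j : nat) (x : R) : exists2 k, (j < 2 ^ k)%N & x <= 2%:R ^+ k.
Proof.
exists (maxn j (Num.truncn x).+1).
  by apply: leq_ltn_trans (ltn_expl _ _) => //; exact: leq_maxl.
rewrite ltW//; apply: (lt_le_trans (truncnS_gt _)); rewrite -natrX ler_nat.
by apply: (leq_trans (leq_maxr j _)); rewrite ltnW// ltn_expl.
Qed.

(** The set F_j where |z| and |b| differ by a factor at least 1 + 1/(j+1) is
    rotation invariant: there the integrand may be replaced by its average of any
    order 2^k, which for large k is at most A - log|b| up to an arbitrarily small
    error. The sets F_j exhaust the disc up to the null circle |z| = |b|. *)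
Lemma log_mean (b : C) (r : R) : b != 0 -> 0 < r ->
  (\int[area]_(z in disc 0 r) ((ln (normc b + r))%:E - log_modulus (b - z))
   <= (ln (normc b + r) - ln (normc b))%:E * area (disc 0 r))%E.
Proof.
move=> b0 r0; set A := ln (normc b + r); set D := disc 0 r.
have Dr : D `<=` [set z | normc z <= r] by move=> z; rewrite /D /disc /= subr0 => /ltW.
have eD : (\int[area]_(z in D) (A%:E - log_modulus (b - z)) =
    \int[area]_(z in D) rotation_avg A b 0 z)%E.
  by apply: eq_integral => z _; rewrite rotation_avg0E.
rewrite eD.
have mD : measurable D by exact: measurable_disc.
pose F (j : nat) := D `&` [set z | normc z * (1 + j.+1%:R^-1) <= normc b \/
   normc b * (1 + j.+1%:R^-1) <= normc z].
have mn : measurable_fun [set: C] (fun z : C => normc z : mR) by exact: measurable_normc.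
have mF j : measurable (F j).
  apply: measurableI => //; rewrite -[X in measurable X]setTI.
  rewrite (_ : [set z | _] = [set z | normc z * (1 + j.+1%:R^-1) <= normc b] `|`
     [set z | normc b * (1 + j.+1%:R^-1) <= normc z])//.
  rewrite setIUr; apply: measurableU.
    by apply: measurable_fun_ler => //; apply: measurable_funM.
  by apply: measurable_fun_ler.
have nb0 : 0 < normc b by rewrite normc_gt0.
have Fle j : (\int[area]_(z in F j) rotation_avg A b 0 z <= (A - ln (normc b))%:E * area D)%E.
  have aD := area_disc_fin 0 r; rewrite -/D in aD.
  have aF : (area (F j) <= area D)%E by apply: le_measure; rewrite ?inE// => z [].
  have AB : 0 <= A - ln (normc b).
    by rewrite subr_ge0 ler_ln ?posrE// ?addr_gt0// lerDl ltW.
  have step k : (j < 2 ^ k)%N -> (\int[area]_(z in F j) rotation_avg A b 0 z <=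
      (A - ln (normc b) + ln 2 * 2%:R ^- k)%:E * area D)%E.
    move=> jk; rewrite -(@integral_rotation_avg _ r b k)//; last 2 first.
    - by move=> z [/Dr].
    - move=> u z u1; rewrite /F /D /disc /= !subr0 Normc.normcM u1 mul1r//.
    apply: (@le_trans _ _ (\int[area]_(z in F j) cst (A - ln (normc b) + ln 2 * 2%:R ^- k)%:E z)%E).
      apply: ge0_le_integral => //.
      - by move=> z [/Dr zr _]; exact: rotation_avg_ge0.
      - apply: measurable_funTS; exact: measurable_rotation_avg.
      - move=> z [_ hz]; apply: (@rotation_avg_off_circle _ _ _ _ (j.+1%:R^-1)) => //.
        by rewrite ler_pdivlMr// mul1r ler_nat.
    rewrite integral_cst// lee_wpmul2l// lee_fin addr_ge0// mulr_ge0 ?invr_ge0//.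
    by rewrite ln_ge0// ler1n.
  apply/lee_addgt0Pr => e e0.
  have [v aDv] : exists v, area D = v%:E by exists (fine (area D)); rewrite fineK.
  have v0 : 0 <= v by rewrite -lee_fin -aDv.
  have [k [jk ke]] : exists k, (j < 2 ^ k)%N /\ ln 2 * v <= e * 2%:R ^+ k.
    have [k jk xk] := exists_pow2 j (ln 2 * v / e).
    by exists k; split=> //; rewrite [leRHS]mulrC -ler_pdivrMr.
  apply: (le_trans (step k jk)); rewrite aDv -!EFinM -EFinD lee_fin mulrDl lerD2l.
  by rewrite mulrAC ler_pdivrMr// exprn_gt0.
have Fnd : nondecreasing_seq F.
  move=> i j ij; apply/subsetPset => z [Dz hz]; split=> //.
  have hij : j.+1%:R^-1 <= i.+1%:R^-1 :> R by rewrite lef_pV2 ?posrE// ler_nat.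
  case: hz => hz; [left|right]; apply: le_trans hz; rewrite ler_wpM2l ?normc_ge0 ?lerD2l//.
have UF : \bigcup_j F j = D `\` [set z | normc z = normc b].
  apply/seteqP; split=> [z [j _ [Dz hz]]|z [Dz /= zb]].
    split=> //= zb; have j0 : 0 < j.+1%:R^-1 :> R by rewrite invr_gt0.
    case: hz; rewrite zb mulrDr mulr1 gerDl leNgt mulr_gt0//.
  have [zb'|bz|] := ltgtP (normc z) (normc b); last by [].
    have : exists j : nat, normc z * j.+1%:R^-1 <= normc b - normc z.
      exists (Num.truncn (normc z / (normc b - normc z))).
      rewrite ler_pdivrMr// mulrC -ler_pdivrMr ?subr_gt0// ltW// truncnS_gt//.
    by move=> [j hj]; exists j => //; split=> //; left; rewrite mulrDr mulr1 -lerBrDl.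
  have : exists j : nat, normc b * j.+1%:R^-1 <= normc z - normc b.
    exists (Num.truncn (normc b / (normc z - normc b))).
    rewrite ler_pdivrMr// mulrC -ler_pdivrMr ?subr_gt0// ltW// truncnS_gt//.
  by move=> [j hj]; exists j => //; split=> //; right; rewrite mulrDr mulr1 -lerBrDl.
have mcirc : measurable [set z : C | normc z = normc b].
  rewrite -[X in measurable X]setTI.
  have := mn measurableT _ (measurable_set1 (normc b)).
  by [].
have := @ge0_nondecreasing_set_cvg_integral _ _ _ F (rotation_avg A b 0) area Fnd mF.
move=> /(_ (fun i => measurable_funTS (measurable_rotation_avg A b 0))).
move=> /(_ (fun i z h => rotation_avg_ge0 b 0 (Dr _ h.1) r0)) cvF.
have -> : (\int[area]_(z in D) rotation_avg A b 0 z = \int[area]_(z in \bigcup_j F j) rotation_avg A b 0 z)%E.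
  rewrite UF; apply: ge0_negligible_integral => //.
  - apply: measurable_funTS; exact: measurable_rotation_avg.
  - by move=> z /Dr zr; exact: rotation_avg_ge0.
  - exact: circle_null.
apply: (cvge_le _ cvF); exact: nearW.
Qed.

End disc_mean_value.

Section change_constant.
Context d (T : measurableType d) (R : realType) (mu : {measure set T -> \bar R}).

(** When a grows by h both sides grow by h v, so the inequality holds for one upper
    bound of f if and only if it holds for all of them. It serves to pass from the
    sum of the bounds that suit the linear factors of a polynomial to a given
    bound of the polynomial; upper bounds keep the integrands nonnegative. *)
Lemma integral_change_cst (D : set T) (f : T -> \bar R) (a a' l v : R) :
  measurable D -> mu D = v%:E -> measurable_fun D f ->
  (forall x, D x -> f x <= a%:E)%E -> (forall x, D x -> f x <= a'%:E)%E ->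
  (\int[mu]_(x in D) (a%:E - f x) <= (a - l)%:E * v%:E)%E ->
  (\int[mu]_(x in D) (a'%:E - f x) <= (a' - l)%:E * v%:E)%E.
Proof.
move=> mD mv mf fa fa' h.
have mB k : measurable_fun D (fun x => k%:E - f x)%E.
  by apply: emeasurable_funB => //; exact: measurable_cst.
have key (s t : R) : s <= t -> (forall x, D x -> f x <= s%:E)%E ->
    (\int[mu]_(x in D) (t%:E - f x) = \int[mu]_(x in D) (s%:E - f x) + ((t - s) * v)%:E)%E.
  move=> st fs; rewrite EFinM -mv -integral_cst// -ge0_integralD//.
  - apply: eq_integral => x /[!inE] Dx; rewrite /cst -addeA addeC.
    rewrite -addeA -EFinD subrK; exact: addeC.
  - by move=> x Dx; rewrite sube_ge0 ?orbT ?fs.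
  - by move=> x Dx; rewrite lee_fin subr_ge0.
have [aa|/ltW aa] := leP a a'.
  rewrite (key a a')// (_ : (a' - l)%:E * v%:E = (a - l)%:E * v%:E + ((a' - a) * v)%:E)%E.
    by rewrite leeD2r.
  by rewrite -!EFinM -EFinD; congr EFin; ring.
move: h; rewrite (key a' a)// (_ : (a - l)%:E * v%:E = (a' - l)%:E * v%:E + ((a - a') * v)%:E)%E.
  by rewrite leeD2rE.
by rewrite -!EFinM -EFinD; congr EFin; ring.
Qed.

End change_constant.

Section polynomial_mean_value.
Context {R : realType}.
Local Notation C := R[i].
Local Notation area := (@lebesgue_complex R).
Local Notation normc := (@Normc.normc R).

Lemma log_mean_at (zeta w : C) (r : R) : zeta != w -> 0 < r ->
  (\int[area]_(z in disc w r) ((ln (normc (zeta - w) + r))%:E - log_modulus (zeta - z))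
   <= (ln (normc (zeta - w) + r) - ln (normc (zeta - w)))%:E * area (disc w r))%E.
Proof.
move=> zw r0; set b := zeta - w.
have b0 : b != 0 by rewrite subr_eq0.
have eD : disc w r = (fun z => z + (- w)) @^-1` disc 0 r.
  by apply/seteqP; split=> z; rewrite /disc /= subr0.
have -> : area (disc w r) = area (disc 0 r).
  rewrite eD; exact: (preserves_translation _ (measurable_disc _ _)).
apply: le_trans (log_mean b0 r0).
have mf : measurable_fun [set: C] (fun z => (ln (normc b + r))%:E - log_modulus (b - z))%E.
  apply: emeasurable_funB; first exact: measurable_cst.
  apply: measurable_log_modulus; under eq_fun do rewrite -mulN1r.
  apply: measurable_complexD; first exact: measurable_cst.
  exact: measurable_complexMl.
rewrite -(ge0_integral_preserves _ (preserves_translation (- w)) (measurable_disc 0 r)).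
- rewrite -eD le_eqVlt; apply/orP; left; apply/eqP; apply: eq_integral => z _.
  by congr (_ - log_modulus _)%E; rewrite /b opprB addrA addrNK.
- by apply: measurable_complexD => //; exact: measurable_cst.
- exact: measurable_funTS.
- move=> z; rewrite /disc /= subr0 => zr; rewrite sube_ge0 ?orbT//.
  apply: log_modulus_le; rewrite lnK ?posrE ?addr_gt0 ?normc_gt0//.
  by rewrite (le_trans (normcD_le _ _))// lerD2l (_ : normc (- z) = normc z) ?ltW//; exact: normcN.
Qed.

Lemma sum_subE (I : eqType) (s : seq I) (a : I -> R) (l : I -> \bar R) :
  (forall i, l i != +oo)%E ->
  (\sum_(i <- s) ((a i)%:E - l i) = (\sum_(i <- s) a i)%:E - \sum_(i <- s) l i)%E
  /\ (\sum_(i <- s) l i)%E != +oo%E.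
Proof.
move=> ly; elim: s => [|i s [IH IHy]]; first by rewrite !big_nil sube0.
rewrite !big_cons IH; move: (ly i) IHy; case: (l i) => [x| |]//= _;
  case: (\sum_(_ <- _) _)%E => [y| |]//= _; split=> //.
by rewrite -!(EFinD,EFinB) opprD addrACA.
Qed.

(** Factor q into linear terms and add up the inequalities for log|x - z|; if q
    vanishes at the centre the right-hand side is infinite. *)
Lemma polynomial_log_mean (q : {poly C}) (w : C) (r B : R) : 0 < r ->
  (forall z, disc w r z -> log_modulus q.[z] <= B%:E)%E ->
  (\int[area]_(z in disc w r) (B%:E - log_modulus q.[z])
   <= (B%:E - log_modulus q.[w]) * area (disc w r))%E.
Proof.
move=> r0 qB; have mD := measurable_disc w r.
have [qw|qw] := eqVneq q.[w] 0.
  rewrite qw log_modulus0 /= gt0_mulye ?leey//; exact: area_disc_gt0.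
have [s qE] := closed_field_poly_normal q.
have qN0 : q != 0 by apply: contra_neq qw => ->; rewrite horner0.
have hq z : q.[z] = lead_coef q * \prod_(x <- s) (z - x).
  rewrite {1}qE hornerZ horner_prod; congr (_ * _).
  by apply: eq_bigr => x _; rewrite hornerXsubC.
have lc0 : lead_coef q != 0 by rewrite lead_coef_eq0.
have swF x : x \in s -> x != w.
  move=> xs; apply: contra_neq qw => <-; rewrite hq.
  by rewrite (big_rem _ xs) /= subrr mul0r mulr0.
pose A x := ln (normc (x - w) + r).
have [v Dv] : exists v, area (disc w r) = v%:E.
  by exists (fine (area (disc w r))); rewrite fineK//; exact: area_disc_fin.
have logq z : log_modulus q.[z] = ((ln (normc (lead_coef q)))%:E +
    \sum_(x <- s) log_modulus (x - z))%E.
  rewrite hq log_modulusM log_modulusE// log_modulus_prod; congr (_ + _)%E.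
  by apply: eq_bigr => x _; rewrite /log_modulus normcB.
pose a := ln (normc (lead_coef q)) + \sum_(x <- s) A x.
have aq z : (a%:E - log_modulus q.[z] = \sum_(x <- s) ((A x)%:E - log_modulus (x - z)))%E.
  have [-> sy] := @sum_subE _ s A (fun x => log_modulus (x - z)) (fun x => log_modulus_neqy _).
  rewrite logq /a; move: sy; case: (\sum_(_ <- _) _)%E => [y| |]// _.
  by rewrite -!(EFinD,EFinB); congr EFin; ring.
have Age x z : disc w r z -> (0 <= (A x)%:E - log_modulus (x - z))%E.
  move=> zr; rewrite sube_ge0 ?orbT//; apply: log_modulus_le.
  rewrite lnK ?posrE; last by rewrite ltr_wpDl ?normc_ge0.
  rewrite (_ : x - z = (x - w) + (w - z)); last by ring.
  by rewrite (le_trans (normcD_le _ _))// lerD2l normcB ltW.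
have ml x : measurable_fun [set: C] (fun z => log_modulus (x - z)).
  apply: measurable_log_modulus; under eq_fun do rewrite -mulN1r.
  apply: measurable_complexD; first exact: measurable_cst.
  exact: measurable_complexMl.
have qa z : disc w r z -> (log_modulus q.[z] <= a%:E)%E.
  by move=> zr; rewrite -sube_ge0 ?orbT// aq sume_ge0// => x _; exact: Age.
rewrite log_modulusE// -EFinB Dv.
apply: (integral_change_cst (a := a)) => //.
  by apply: measurable_funTS; apply: measurable_log_modulus; exact: measurable_horner.
under eq_integral do rewrite aq.
rewrite ge0_integral_sum//; last first.
  by move=> x; apply: measurable_funTS; apply: emeasurable_funB => //; exact: measurable_cst.
rewrite (_ : a - _ = \sum_(x <- s) (A x - ln (normc (x - w)))); last first.
  apply: EFin_inj; rewrite EFinB -log_modulusE// aq -sumEFin.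
  rewrite big_seq [RHS]big_seq; apply: eq_bigr => x xs.
  by rewrite log_modulusE// subr_eq0 swF.
rewrite -EFinM mulr_suml -sumEFin big_seq [leRHS]big_seq; apply: lee_sum => x xs.
rewrite EFinM -Dv; apply: log_mean_at => //; exact: swF.
Qed.

End polynomial_mean_value.

(** * The sub-mean value inequality on polydiscs *)

Section rV_power_integral.
Context d (T : measurableType d) (R : realType).
Variable mu : {sigma_finite_measure set T -> \bar R}.

Lemma ge0_integral_rV_powerS n (f : 'rV[T]_n.+1 -> \bar R) :
  measurable_fun setT f -> (forall v, 0 <= f v)%E ->
  (\int[rV_power mu n.+1]_v f v =
   \int[mu]_x \int[rV_power mu n]_v f (rV_cons (x, v)))%E.
Proof.
move=> mf f0.
have mfc : measurable_fun setT (f \o @rV_cons _ T n).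
  exact: (measurableT_comp mf (@measurable_rV_cons _ T n)).
rewrite -(@fubini_tonelli1 _ _ _ _ _ mu (rV_power mu n) (f \o @rV_cons _ T n) mfc); last first.
  by move=> x; exact: f0.
have := @ge0_integral_pushforward _ _ _ _ _ _ (@measurable_rV_cons _ T n)
  (mu \x rV_power mu n)%E setT f measurableT mf (fun v _ => f0 v).
by rewrite preimage_setT => <-.
Qed.

Lemma measurable_rV_slice n (f : 'rV[T]_n.+1 -> \bar R) :
  measurable_fun setT f -> (forall v, 0 <= f v)%E ->
  measurable_fun setT (fun x => \int[rV_power mu n]_v f (rV_cons (x, v)))%E.
Proof.
move=> mf f0.
have mfc : measurable_fun setT (f \o @rV_cons _ T n).
  exact: (measurableT_comp mf (@measurable_rV_cons _ T n)).
by apply: (@measurable_fun_fubini_tonelli_F _ _ _ _ _ (rV_power mu n) _ mfc) => x; exact: f0.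
Qed.

Lemma measurable_rV_box n (A : 'I_n -> set T) : (forall j, measurable (A j)) ->
  measurable [set v : 'rV[T]_n | forall j, A j (v ord0 j)].
Proof.
move=> mA; rewrite (_ : [set v | _] = \bigcap_(j in [set: 'I_n])
    (fun v : 'rV[T]_n => v ord0 j) @^-1` A j).
  apply: fin_bigcap_measurable => [|j _]; first exact: finite_finset.
  rewrite -[X in measurable X]setTI.
  exact: (measurable_mx_entry (T := T) ord0 j measurableT).
by apply/seteqP; split=> v /= vA j => [_|]; exact: vA.
Qed.

End rV_power_integral.

Section polydisc_mean.
Context {R : realType}.
Local Notation C := R[i].
Local Notation area := (@lebesgue_complex R).

Definition polydisc n (w : 'rV[C]_n) (r : 'I_n -> R) : set 'rV[C]_n :=
  [set z | forall j, disc (w ord0 j) (r j) (z ord0 j)].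

Lemma measurable_polydisc n (w : 'rV[C]_n) r : measurable (polydisc w r).
Proof.
by apply: (@measurable_rV_box _ _ n (fun j => disc (w ord0 j) (r j))) => j; exact: measurable_disc.
Qed.

Lemma volume_polydisc n (w : 'rV[C]_n) r :
  rV_power area n (polydisc w r) = (\prod_j area (disc (w ord0 j) (r j)))%E.
Proof.
by rewrite -(@rV_power_box _ _ _ area n (fun j => disc (w ord0 j) (r j)))// => j;
  exact: measurable_disc.
Qed.

Definition update n (v : 'rV[C]_n) (j : 'I_n) (x : C) : 'rV[C]_n :=
  \row_k (if k == j then x else v ord0 k).

(** All that the induction on the dimension uses about p; it passes to the slices
    of p, in contrast to the shape of a sum over lattice points. *)
Definition separately_polynomial n (p : 'rV[C]_n -> C) :=
  forall v j, exists q : {poly C}, forall x, p (update v j x) = q.[x].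

Lemma update_rV_cons0 n (x : C) (v : 'rV[C]_n) (y : C) :
  update (rV_cons (y, v)) ord0 x = rV_cons (x, v).
Proof.
apply/rowP => k; rewrite !mxE; by case: unliftP => [k' ->|->].
Qed.

Lemma update_rV_consS n (x : C) (v : 'rV[C]_n) (j : 'I_n) (y : C) :
  update (rV_cons (x, v)) (lift ord0 j) y = rV_cons (x, update v j y).
Proof.
apply/rowP => k; rewrite !mxE; case: unliftP => [k' ->|->] //.
by rewrite (inj_eq lift_inj) mxE.
Qed.

(** Fubini: the induction hypothesis for the slice p(x, .) bounds the inner
    integral by V (B - log|p(x, w)|), and x -> p(x, w) is a polynomial in one
    variable. *)
Lemma polydisc_log_mean n (p : 'rV[C]_n -> C) w r (B : R) :
  separately_polynomial p -> measurable_fun setT p -> (forall j, 0 < r j) ->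
  (forall z, polydisc w r z -> log_modulus (p z) <= B%:E)%E ->
  (\int[rV_power area n]_(z in polydisc w r) (B%:E - log_modulus (p z))
   <= (B%:E - log_modulus (p w)) * rV_power area n (polydisc w r))%E.
Proof.
elim: n p w r => [|n IH] p w r sp mp r0 pB.
  have e0 (v : 'rV[C]_0) : v = point by apply/rowP => -[].
  have -> : polydisc w r = setT by apply/seteqP; split=> // z _ [].
  rewrite integral_dirac//; last first.
    by apply: emeasurable_funB; [exact: measurable_cst|exact: measurable_log_modulus].
  by rewrite (e0 w) muleC.
set D := polydisc w r; pose w0 := w ord0 ord0.
pose w' := (\row_k w ord0 (lift ord0 k)) : 'rV[C]_n.
pose r' := r \o lift ord0; pose D0 := disc w0 (r ord0); pose D' := polydisc w' r'.
have we : w = rV_cons (w0, w').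
  apply/rowP => k; rewrite mxE; case: unliftP => [k' ->|->]//=; by rewrite mxE.
have mD : measurable D by exact: measurable_polydisc.
have mD0 : measurable D0 by exact: measurable_disc.
have mD' : measurable D' by exact: measurable_polydisc.
have De x v : D (rV_cons (x, v)) <-> D0 x /\ D' v.
  split=> [h|[h0 h'] j].
    split; first by have := h ord0; rewrite mxE unlift_none.
    by move=> k; have := h (lift ord0 k); rewrite /w' !mxE liftK.
  rewrite mxE; case: unliftP => [k ->|->]//.
  by have := h' k; rewrite /w' mxE.
pose f (z : 'rV[C]_n.+1) := (B%:E - log_modulus (p z))%E.
have mlp : measurable_fun setT (fun z => log_modulus (p z)) by exact: measurable_log_modulus.
have mf : measurable_fun setT f.
  by apply: emeasurable_funB => //; exact: measurable_cst.
have f0 z : D z -> (0 <= f z)%E by move=> /pB h; rewrite sube_ge0 ?orbT.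
have mfD : measurable_fun setT (f \_ D).
  by apply/(measurable_restrictT _ mD); exact: measurable_funTS.
have fD0 z : (0 <= (f \_ D) z)%E by apply: erestrict_ge0.
rewrite integral_mkcond ge0_integral_rV_powerS//.
have inner x : (\int[rV_power area n]_v (f \_ D) (rV_cons (x, v)) =
   ((fun x => \int[rV_power area n]_(v in D') f (rV_cons (x, v))) \_ D0) x)%E.
  rewrite [RHS]/patch; case: ifPn => [|] xD0.
    rewrite [RHS]integral_mkcond; apply: eq_integral => v _.
    rewrite /patch; congr (if _ then _ else _); apply/idP/idP; rewrite !inE.
      by move=> /De[].
    by move=> ?; apply/De; split=> //; rewrite inE in xD0.
  rewrite (_ : (fun v => _) = cst 0%E) ?integral_cst//; last first.
    apply/funext => v; rewrite /patch ifF//; apply/negbTE; apply: contra xD0.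
    by rewrite !inE => /De[].
  by rewrite mul0e.
under eq_integral do rewrite inner.
rewrite -integral_mkcond.
pose V' := rV_power area n D'.
have mp' x : measurable_fun setT (fun v : 'rV[C]_n => p (rV_cons (x, v))).
  apply: (measurableT_comp (measurableT_comp mp (@measurable_rV_cons _ C n))).
  apply: measurable_fun_pair; [exact: measurable_cst|exact: measurable_id].
have mp0 : measurable_fun setT (fun x : C => p (rV_cons (x, w'))).
  apply: (measurableT_comp (measurableT_comp mp (@measurable_rV_cons _ C n))).
  apply: measurable_fun_pair; [exact: measurable_id|exact: measurable_cst].
have [q qE] := sp (rV_cons (w0, w')) ord0.
have {}qE x : p (rV_cons (x, w')) = q.[x] by rewrite -qE update_rV_cons0.
have D'w' : D' w' by move=> j; rewrite /disc /= subrr Normc.normc0; exact: r0.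
have V'0 : (0 <= V')%E by exact: measure_ge0.
apply: (@le_trans _ _ (\int[area]_(x in D0) (V' * (B%:E - log_modulus q.[x])))%E).
  apply: ge0_le_integral => //.
  - move=> x D0x; apply: integral_ge0 => v D'v; apply: f0; exact/De.
  - apply/(measurable_restrictT _ mD0).
    rewrite (_ : _ \_ _ = (fun x => \int[rV_power area n]_v (f \_ D) (rV_cons (x, v)))%E).
      exact: measurable_rV_slice.
    by apply/funext => x; rewrite inner.
  - apply: emeasurable_funM; first exact: measurable_cst.
    apply: emeasurable_funB; first exact: measurable_cst.
    by apply: measurable_funTS; apply: measurable_log_modulus; exact: measurable_horner.
  - move=> x D0x; rewrite -qE muleC; apply: IH => //.
    + move=> v j; have [q' q'E] := sp (rV_cons (x, v)) (lift ord0 j).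
      by exists q' => y; rewrite -q'E update_rV_consS.
    + by move=> j; exact: r0.
    + by move=> v D'v; apply: pB; exact/De.
rewrite ge0_integralZl//; last 2 first.
- apply: emeasurable_funB; first exact: measurable_cst.
  by apply: measurable_funTS; apply: measurable_log_modulus; exact: measurable_horner.
- by move=> x D0x; rewrite -qE; apply: f0; exact/De.
have -> : rV_power area n.+1 D = (area D0 * V')%E.
  rewrite /V' !volume_polydisc big_ord_recl; congr (_ * _)%E.
  by apply: eq_bigr => j _; rewrite /w' /r' mxE.
rewrite [leRHS]muleA [leRHS]muleC lee_wpmul2l//.
have -> : p w = q.[w0] by rewrite -qE -we.
apply: polynomial_log_mean => // x D0x.
by rewrite -qE; apply: pB; exact/De.
Qed.

End polydisc_mean.

(** * Anticoncentration of linear forms in independent variables *)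

Section spread.
Context disp (Omega : measurableType disp) (R : realType) (Pr : probability Omega R).
Local Notation C := R[i].
Local Notation normc := (@Normc.normc R).

Lemma measurable_normc_gt (X : Omega -> C) (x : C) (t : R) :
  measurable_fun setT X -> measurable [set w | t < normc (X w - x)].
Proof.
move=> mX; rewrite -[X in measurable X]setTI; apply: measurable_fun_ltr => //.
apply: measurable_normc; apply: measurable_complexD => //; exact: measurable_cst.
Qed.

(** Otherwise, for every k some point x_k has |X - x_k| <= 1/(k+1) with probability
    at least 1 - 2^-(k+1); by Borel-Cantelli X is almost surely the limit of the
    x_k, hence constant. To avoid constructing that limit, X is compared with its
    own value at one point outside the exceptional set. *)
Lemma nondegenerate_spread (X : {RV Pr >-> C}) : nondegenerate_RV X ->
  exists2 del : R, 0 < del &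
  exists2 eps : R, 0 < eps & forall x, (eps%:E < Pr [set w | del < normc (X w - x)]%R)%E.
Proof.
move=> ndX; apply: contrapT => H; apply: ndX.
have mX : measurable_fun setT X by exact: measurable_funPT.
have {H} : forall k : nat, exists x, (Pr [set w | k.+1%:R^-1 < normc (X w - x)]%R <=
    (1 / (2 ^ k.+1)%:R)%:E)%E.
  move=> k; apply: contrapT => /forallNP h; apply: H.
  exists k.+1%:R^-1; first by rewrite invr_gt0.
  exists (1 / (2 ^ k.+1)%:R); first by rewrite divr_gt0// ltr0n expn_gt0.
  by move=> x; rewrite ltNge; apply/negP; exact: h.
move=> /choice[x_ xP].
pose A k := [set w | k.+1%:R^-1 < normc (X w - x_ k)].
have mA k : measurable (A k) by exact: measurable_normc_gt.
have A0 : Pr (lim_sup_set A) = 0%E.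
  apply: lim_sup_set_cvg0 => //; apply: le_lt_trans (ltry 1).
  apply: le_trans (@epsilon_trick0 R 1 xpredT ler01).
  by apply: lee_nneseries => k _ //; exact: xP.
have mL : measurable (lim_sup_set A).
  by apply: bigcap_measurable => // k _; exact: bigcup_measurable.
have [w0 w0A] : exists w0, ~ lim_sup_set A w0.
  apply: contrapT => /forallNP h; have : lim_sup_set A = setT.
    by apply/seteqP; split=> // w _; apply: contrapT; exact: h.
  by move=> AT; move: A0; rewrite AT probability_setT => /eqP; rewrite onee_eq0.
have out w : ~ lim_sup_set A w -> exists n, forall k, (n <= k)%N -> normc (X w - x_ k) <= k.+1%:R^-1.
  move=> /existsNP[n /not_implyP[_ h]]; exists n => k nk; rewrite leNgt; apply/negP => hk.
  by apply: h; exists k.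
exists (X w0); exists (lim_sup_set A); split=> // w /= Xw; apply: contrapT => wA; apply: Xw.
have [n hn] := out _ wA; have [n0 hn0] := out _ w0A.
apply/eqP; rewrite -subr_eq0 -normc_eq0; apply/negPn/negP => neq0.
have p0 : 0 < normc (X w - X w0) by rewrite lt0r neq0 normc_ge0.
pose e := normc (X w - X w0) / 2; have e0 : 0 < e by rewrite divr_gt0.
have [k [kn kn0 ke]] : exists k, [/\ (n <= k)%N, (n0 <= k)%N & k.+1%:R^-1 < e].
  exists (maxn (Num.truncn e^-1) (maxn n n0)); split.
  - by rewrite !leq_max leqnn orbT.
  - by rewrite !leq_max leqnn !orbT.
  rewrite invf_plt ?posrE//; apply: (lt_le_trans (truncnS_gt _)).
  by rewrite ler_nat ltnS leq_max leqnn.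
have : normc (X w - X w0) <= k.+1%:R^-1 + k.+1%:R^-1.
  rewrite (_ : X w - X w0 = (X w - x_ k) + (x_ k - X w0)); last by ring.
  by apply: (le_trans (normcD_le _ _)); rewrite lerD ?hn// normcB hn0.
by apply/negP; rewrite -ltNge [ltRHS]splitr; exact: ltrD.
Qed.

End spread.

Section independence.
Context disp (Omega : measurableType disp) (R : realType) (Pr : probability Omega R).
Context d' (T : measurableType d') (I : choiceType) (X : I -> {RV Pr >-> T}).
Hypothesis Xindep : mutually_independent X.

(** A pi-system that generates the sigma-algebra of the variables with index in J. *)
Definition cylinders (J : {fset I}) : set (set Omega) :=
  [set A | exists2 B : I -> set T, (forall i, measurable (B i)) &
     A = \bigcap_(i in [set` J]) X i @^-1` B i].

Local Notation OmegaJ J := (g_sigma_algebraType (cylinders J)).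

Lemma cylinders_measurable J A : <<s cylinders J >> A -> measurable A.
Proof.
move: A; apply: smallest_sub; first exact: sigma_algebra_measurable.
move=> _ [B mB ->]; apply: fin_bigcap_measurable => [|i _]; first exact: finite_fset.
by rewrite -[X in measurable X]setTI; apply: measurable_funPT.
Qed.

Lemma setI_closed_cylinders J : setI_closed (cylinders J).
Proof.
move=> _ _ [B mB ->] [B' mB' ->]; exists (fun i => B i `&` B' i).
  by move=> i; exact: measurableI.
by rewrite -bigcapI; apply: eq_bigcapr => i _; rewrite preimage_setI.
Qed.

Lemma cylinder_RV_measurable (J : {fset I}) i : i \in J ->
  measurable_fun [set: OmegaJ J] (X i : OmegaJ J -> T).
Proof.
move=> iJ _ B mB; rewrite setTI; apply: sub_sigma_algebra.
exists (fun k => if k == i then B else setT); first by move=> k; case: ifP.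
apply/seteqP; split=> [w Bw k /= kJ|w /(_ i iJ)]; last by rewrite /= eqxx.
by case: eqP => [->|].
Qed.

(** Dynkin induction: for a cylinder A this is the product rule for J with i
    added. *)
Lemma indep_cylinder (J : {fset I}) i (B : set T) A : i \notin J -> measurable B ->
  <<s cylinders J >> A -> Pr (A `&` X i @^-1` B) = (Pr A * Pr (X i @^-1` B))%E.
Proof.
move=> iJ mB; move: A.
have mXB : measurable (X i @^-1` B).
  by rewrite -[X in measurable X]setTI; apply: measurable_funPT.
pose P (A : set (OmegaJ J)) := Pr (A `&` X i @^-1` B) = (Pr A * Pr (X i @^-1` B))%E.
have meas (A : set (OmegaJ J)) : measurable A -> disp.-measurable (A : set Omega).
  exact: cylinders_measurable.
apply: (@dynkin_induction _ (OmegaJ J) (cylinders J) P) => //.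
- exact: setI_closed_cylinders.
- by rewrite /P setTI probability_setT mul1e.
- move=> A [B' mB' AE]; rewrite /P.
  pose B2 k := if k == i then B else B' k.
  have e1 : A = \bigcap_(k in [set` J]) X k @^-1` B2 k.
    rewrite AE; apply: eq_bigcapr => k /= kJ; rewrite /B2 ifN//.
    by apply: contraNneq iJ => <-.
  have mB2 k : measurable (B2 k) by rewrite /B2; case: ifP.
  have e2 : A `&` X i @^-1` B = \bigcap_(k in [set` (i |` J)%fset]) X k @^-1` B2 k.
    rewrite e1; apply/seteqP; split=> [w [h hi] k /=|w h].
      rewrite in_fset1U => /orP[/eqP->|]; first by rewrite /B2 eqxx.
      exact: h.
    split; last by have := h i; rewrite /= /B2 eqxx; apply; rewrite in_fset1U eqxx.
    by move=> k /= kJ; apply: h; rewrite /= in_fset1U kJ orbT.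
  rewrite e2 Xindep// e1 Xindep// big_fsetU1//= muleC; congr (_ * Pr _)%E.
  by rewrite /B2 eqxx.
- move=> A mA; rewrite /P => PA; have mA' := meas _ mA.
  rewrite setIC -setDE measureD//; last by rewrite (le_lt_trans (probability_le1 _ _)) ?ltry.
  rewrite [X in (_ - X)%E](etrans (congr1 _ (setIC _ _)) PA) probability_setC//.
  have [x ->] : exists x, Pr A = x%:E.
    by exists (fine (Pr A)); rewrite fineK// fin_num_measure.
  have [y yE] : exists y, Pr (X i @^-1` B) = y%:E.
    by exists (fine (Pr (X i @^-1` B))); rewrite fineK// fin_num_measure.
  transitivity (y%:E - x%:E * y%:E)%E; first by rewrite -yE.
  transitivity ((1%:E - x%:E) * y%:E)%E; last by rewrite -yE.
  by rewrite -!(EFinM, EFinB); congr EFin; ring.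
- move=> F mF tF PF; rewrite /P.
  rewrite setI_bigcupl measure_bigcup//; last 2 first.
  + by move=> k _; apply: measurableI => //; exact: meas.
  + exact: trivIset_setIr.
  rewrite measure_bigcup//; last by move=> k _; exact: meas.
  have [y yE] : exists y, Pr (X i @^-1` B) = y%:E.
    by exists (fine (Pr (X i @^-1` B))); rewrite fineK// fin_num_measure.
  rewrite [in RHS]yE muleC -nneseriesZl//.
  by apply: eq_eseriesr => k _; rewrite -yE muleC; exact: PF.
Qed.

End independence.

Section anticoncentration.
Context disp (Omega : measurableType disp) (R : realType) (Pr : probability Omega R).
Local Notation C := R[i].
Local Notation normc := (@Normc.normc R).
Context (I : choiceType) (X : I -> {RV Pr >-> C}).
Hypothesis Xindep : mutually_independent X.

Local Notation OmegaJ J := (g_sigma_algebraType (cylinders X J)).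

Section one_step.
Variables (J : {fset I}) (i : I).
Hypothesis iJ : i \notin J.

Let idJ : Omega -> OmegaJ J := id.

Let measurable_idJ : measurable_fun setT idJ.
Proof. by move=> _ A mA; rewrite setTI; exact: cylinders_measurable mA. Qed.

HB.instance Definition _ := isMeasurableFun.Build _ _ _ _ idJ measurable_idJ.

Let joint : Omega -> (OmegaJ J * C)%type := fun w => (idJ w, X i w).

Let measurable_joint : measurable_fun setT joint.
Proof.
by apply: measurable_fun_pair; [exact: measurable_idJ|exact: measurable_funPT].
Qed.

HB.instance Definition _ := isMeasurableFun.Build _ _ _ _ joint measurable_joint.

(** Independence, read as a product law: the pair consists of the information on
    the X_j, j in J, and of X_i. The first component is the identity of Omega onto
    the coarser measurable space, which avoids tuples indexed by J. *)
Lemma joint_law (A : set (OmegaJ J * C)) : measurable A ->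
  Pr (joint @^-1` A) =
  (\int[distribution Pr idJ]_w (distribution Pr (X i)) (xsection A w))%E.
Proof.
move=> mA; apply/esym.
apply: (@product_measure_unique _ _ _ _ _ (distribution Pr idJ) (distribution Pr (X i))
  (distribution Pr joint)) => // A1 B mA1 mB.
rewrite /distribution /= /pushforward.
exact: (indep_cylinder Xindep iJ mB mA1).
Qed.

(** Integrate over X_i first, with Y frozen by independence. *)
Lemma small_ball_step (theta del : R) (E : set (OmegaJ J)) (Y : OmegaJ J -> C) :
  (forall x, Pr [set w | normc (X i w + x) <= del]%R <= theta%:E)%E ->
  0 <= theta -> measurable E -> measurable_fun setT Y ->
  (Pr ((E : set Omega) `&` [set w | normc (X i w + Y w) <= del]%R) <= theta%:E * Pr E)%E.
Proof.
move=> small th0 mE mY.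
pose A : set (OmegaJ J * C) := [set p | E p.1 /\ normc (p.2 + Y p.1) <= del].
have mA : measurable A.
  rewrite (_ : A = (E `*` setT) `&` [set p | normc (p.2 + Y p.1) <= del]); last first.
    by apply/seteqP; split=> p [] // [].
  apply: measurableI; first exact: measurableX.
  rewrite -[X in measurable X]setTI; apply: measurable_fun_ler => //.
  apply: measurable_normc; apply: measurable_complexD; first exact: measurable_snd.
  by apply: measurableT_comp => //; exact: measurable_fst.
have := joint_law mA; rewrite [LHS](_ : _ = Pr ((E : set Omega) `&` [set w | normc (X i w + Y w) <= del]))// => ->.
apply: (@le_trans _ _ (\int[distribution Pr idJ]_w (theta%:E * (\1_E w)%:E))%E).
  apply: ge0_le_integral => //.
  - exact: measurable_fun_xsection.
  - apply: emeasurable_funM; first exact: measurable_cst.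
    by apply/measurable_EFinP; exact: measurable_indic.
  - move=> w _; rewrite indicE; case: (boolP (w \in E)) => wE.
      rewrite mule1; apply: le_trans (small (Y w)).
      rewrite /distribution /= /pushforward.
      apply: le_measure; rewrite ?inE //.
      + rewrite -[X in measurable X]setTI; apply: measurable_funPT => //.
        exact: measurable_xsection.
      + rewrite -[X in measurable X]setTI; apply: measurable_fun_ler => //.
        apply: measurable_normc; apply: measurable_complexD; [exact: measurable_funPT|exact: measurable_cst].
      + by move=> w' /=; rewrite /xsection /= inE => -[].
    rewrite mule0 (_ : xsection A w = set0) ?measure0//.
    apply/seteqP; split=> // x; rewrite /xsection /= inE => -[/= Ew _].
    by move: wE; rewrite notin_setE.
rewrite ge0_integralZl//; last first.
  by apply/measurable_EFinP; exact: measurable_indic.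
by rewrite integral_indic// setIT.
Qed.

End one_step.

Lemma measurable_linear_form (J B : {fset I}) (y : I -> C) : {subset B <= J} ->
  measurable_fun [set: OmegaJ J] (fun w : OmegaJ J => \sum_(b <- B) y b * X b w).
Proof.
move=> BJ.
rewrite (_ : (fun _ => _) = fun w => \sum_(b <- B) (if b \in J then y b * X b w else 0)).
  apply: measurable_complex_sum => b; case: (boolP (b \in J)) => bJ; last exact: measurable_cst.
  apply: measurable_complexM; [exact: measurable_cst|exact: cylinder_RV_measurable].
apply/funext => w; rewrite big_seq [RHS]big_seq; apply: eq_bigr => b bB.
by rewrite BJ.
Qed.

(** Peel off X_(alpha 0), ..., X_(alpha (m-1)) one at a time: the first k events
    depend on the variables in B and on X_(alpha l), l < k, all of which are
    independent of X_(alpha k). *)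
Lemma small_ball_linear (theta del : R) (alpha : nat -> I) (B : {fset I})
    (y : nat -> I -> C) (m : nat) :
  (forall i x, Pr [set w | normc (X i w + x) <= del]%R <= theta%:E)%E ->
  0 <= theta -> (forall k, (k < m)%N -> alpha k \notin B) ->
  (forall k l, (k < m)%N -> (l < m)%N -> alpha k = alpha l -> k = l) ->
  (Pr [set w | forall k, (k < m)%N ->
     normc (X (alpha k) w + \sum_(b <- B) y k b * X b w) <= del]%R <= (theta ^+ m)%:E)%E.
Proof.
move=> small th0 aB ainj.
pose J k : {fset I} := (B `|` [fset alpha l | l in iota 0 k])%fset.
pose E k : set Omega := [set w | forall l, (l < k)%N ->
     normc (X (alpha l) w + \sum_(b <- B) y l b * X b w) <= del].
have mE k j : (k <= j)%N -> measurable (E k : set (OmegaJ (J j))).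
  elim: k => [_|k IH kj].
    by rewrite (_ : E 0 = setT)//; apply/seteqP; split.
  rewrite (_ : E k.+1 = E k `&` [set w | normc (X (alpha k) w + \sum_(b <- B) y k b * X b w) <= del]).
    apply: measurableI; first by apply: IH; exact: ltnW.
    rewrite -[X in measurable X]setTI; apply: measurable_fun_ler => //.
    apply: measurable_normc; apply: measurable_complexD.
      apply: cylinder_RV_measurable; rewrite inE; apply/orP; right.
      by apply/imfsetP; exists k => //=; rewrite mem_iota add0n.
    by apply: measurable_linear_form => b bB; rewrite inE bB.
  apply/seteqP; split=> [w h|w [h hk] l].
    by split=> [l lk|]; apply: h; rewrite ?ltnS// ltnW.
  by rewrite ltnS leq_eqVlt => /predU1P[->|]//; exact: h.
suff h k : (k <= m)%N -> (Pr (E k) <= (theta ^+ k)%:E)%E by exact: (h m).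
elim: k => [_|k IH km]; first by rewrite expr0; exact/probability_le1/(cylinders_measurable (mE 0%N 0%N isT)).
have E1 : E k.+1 = E k `&` [set w | normc (X (alpha k) w + \sum_(b <- B) y k b * X b w) <= del].
  apply/seteqP; split=> [w h|w [h hk] l].
    by split=> [l lk|]; apply: h; rewrite ?ltnS// ltnW.
  by rewrite ltnS leq_eqVlt => /predU1P[->|]//; exact: h.
have kJ : alpha k \notin J k.
  rewrite inE negb_or aB//=; apply/negP => /imfsetP[l /=].
  rewrite mem_iota add0n => /andP[_ lk] /ainj kl.
  by have := lk; rewrite -kl ?ltnn// (ltn_trans lk km).
rewrite E1; apply: le_trans (@small_ball_step (J k) (alpha k) kJ theta del (E k)
   (fun w => \sum_(b <- B) y k b * X b w) (small _) th0 _ _) _.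
- exact: mE.
- by apply: measurable_linear_form => b bB; rewrite inE bB.
by rewrite exprS EFinM lee_wpmul2l// ?lee_fin// IH// ltnW.
Qed.

End anticoncentration.

Section iid_small_ball.
Context disp (Omega : measurableType disp) (R : realType) (Pr : probability Omega R).
Local Notation C := R[i].
Local Notation normc := (@Normc.normc R).
Context (I : choiceType) (X : I -> {RV Pr >-> C}).

(** The constant theta is common to all the variables and to all the centres x;
    this uniformity is what conditioning on the other variables requires. *)
Lemma iid_small_ball i0 : identically_distributed X -> nondegenerate_RV (X i0) ->
  exists2 del : R, 0 < del & exists2 theta : R, 0 <= theta < 1 &
  forall i x, (Pr [set w | normc (X i w + x) <= del]%R <= theta%:E)%E.
Proof.
move=> idX /nondegenerate_spread[del del0 [eps eps0 h]]; exists del => //.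
have mX i : measurable_fun setT (X i) by exact: measurable_funPT.
exists (1 - eps).
  have := lt_le_trans (h 0) (probability_le1 Pr (measurable_normc_gt _ _ (mX i0))).
  by rewrite lte_fin subr_ge0 gtrBl eps0 andbT => /ltW.
move=> i x.
have mB : measurable [set z : C | normc (z + x) <= del].
  rewrite -[X in measurable X]setTI; apply: measurable_fun_ler => //.
  by apply: measurable_normc; apply: measurable_complexD => //; exact: measurable_cst.
have -> : Pr [set w | normc (X i w + x) <= del] = Pr [set w | normc (X i0 w + x) <= del].
  exact: (idX i i0 _ mB).
rewrite (_ : [set w | _] = ~` [set w | del < normc (X i0 w - (- x))]); last first.
  by apply/seteqP; split=> w /=; rewrite opprK leNgt => /negP.
rewrite probability_setC; last exact: measurable_normc_gt.
by rewrite EFinB; apply: leeB => //; exact/ltW.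
Qed.

End iid_small_ball.

(** * The weighted support function *)

Section weighted_support_theory.
Context {R : realType} {d : nat}.
Variables (P : set 'rV[R]_d) (f : 'rV[R]_d -> R).
Hypothesis P_orthant : P `<=` orthant.
Hypothesis P_body : convex_body P.
Hypothesis P0 : P 0.
Hypothesis f_gt0 : forall t, P t -> 0 < f t.
Hypothesis f_cont : {within P, continuous f}.

Lemma body_bounded : exists2 T : R, 0 < T & forall (t : 'rV[R]_d) j, P t -> 0 <= t ord0 j <= T.
Proof.
have [cP _ _] := P_body.
have bj (j : 'I_d) : exists M : R, forall t, P t -> t ord0 j <= M.
  have cj : compact ((fun t : 'rV[R]_d => t ord0 j) @` P).
    apply: continuous_compact => //; apply: continuous_subspaceT.
    exact: coord_continuous.
  have [M [_ hM]] := compact_bounded cj; exists (M + 1) => t Pt.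
  have := hM (M + 1); rewrite ltrDl ltr01 => /(_ isT (t ord0 j)).
  by move=> h; apply: le_trans (ler_norm _) (h _); exists t.
have /choice[M hM] := bj.
exists (1 + \sum_j `|M j|); first by rewrite ltr_pwDl// sumr_ge0.
move=> t j Pt; apply/andP; split; first exact: P_orthant.
apply: (le_trans (hM j t Pt)); apply: (le_trans (ler_norm _)).
by rewrite (bigD1 j)//= addrCA lerDl addr_ge0// sumr_ge0.
Qed.

Lemma ln_f_continuous : {within P, continuous (fun t => ln (f t))}.
Proof.
apply/subspace_continuousP => t Pt.
apply: (@continuous_cvg _ _ _ (within P (nbhs t)) _ f (@ln R)).
  exact: continuous_ln (f_gt0 Pt).
by move/subspace_continuousP : f_cont; exact.
Qed.

Lemma ln_f_bounded : exists L : R, forall t, P t -> `|ln (f t)| <= L.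
Proof.
have [cP _ _] := P_body.
have [L [_ hL]] := compact_bounded (continuous_compact ln_f_continuous cP).
exists (L + 1) => t Pt.
by apply: (hL (L + 1)); rewrite ?ltrDl//; exists t.
Qed.

Definition weight (s t : 'rV[R]_d) : R := \sum_j s ord0 j * t ord0 j + ln (f t).

Definition support (s : 'rV[R]_d) : R := fine (weighted_support P f s).

Lemma weighted_supportE s : weighted_support P f s = (support s)%:E.
Proof.
have [T T0 hT] := body_bounded; have [L hL] := ln_f_bounded.
rewrite /support fineK// fin_real//; apply/andP; split.
  apply: (@lt_le_trans _ _ (weight s 0)%:E); first exact: ltNyr.
  by apply: ereal_sup_ubound; exists 0.
apply: (@le_lt_trans _ _ (\sum_j `|s ord0 j| * T + L)%:E); last exact: ltry.
apply: ge_ereal_sup => _ [t Pt <-]; rewrite lee_fin; apply: lerD.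
  apply: ler_sum => j _; have /andP[t0 tT] := hT t j Pt.
  apply: le_trans (_ : `|s ord0 j| * t ord0 j <= _); last exact: ler_wpM2l.
  by apply: ler_wpM2r => //; exact: ler_norm.
by apply: le_trans (ler_norm _) (hL _ Pt).
Qed.

Lemma support_ub s t : P t -> weight s t <= support s.
Proof.
by move=> Pt; rewrite -lee_fin -weighted_supportE; apply: ereal_sup_ubound; exists t.
Qed.

Lemma support_le s M : (forall t, P t -> weight s t <= M) -> support s <= M.
Proof.
move=> h; rewrite -lee_fin -weighted_supportE; apply: ge_ereal_sup => _ [t Pt <-].
by rewrite lee_fin; exact: h.
Qed.

Lemma support_adherent s e : 0 < e -> exists2 t, P t & support s - e < weight s t.
Proof.
move=> e0; apply: contrapT => /forall2NP h.
suff : support s <= support s - e by rewrite leNgt gtrBl e0.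
by apply: support_le => t Pt; have [//|/negP] := h t; rewrite -leNgt.
Qed.

Lemma support_ge_ln0 s : ln (f 0) <= support s.
Proof.
apply: le_trans (support_ub s P0); rewrite /weight big1 ?add0r//.
by move=> j _; rewrite mxE mulr0.
Qed.

(** On P the coordinates lie in [0, T], so moving s by eta in each coordinate
    changes the weight by at most eta d T. *)
Lemma support_shift (T eta : R) (s s' : 'rV[R]_d) : (forall (t : 'rV[R]_d) j, P t -> 0 <= t ord0 j <= T) ->
  0 <= eta -> (forall j, s' ord0 j <= s ord0 j + eta) ->
  support s' <= support s + eta * (d%:R * T).
Proof.
move=> hT eta0 hs; apply: support_le => t Pt.
apply: (@le_trans _ _ (weight s t + eta * (d%:R * T))); last by rewrite lerD2r support_ub.
rewrite /weight addrAC lerD2r.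
have -> : eta * (d%:R * T) = \sum_(j < d) eta * T.
  by rewrite sumr_const card_ord -mulr_natl; ring.
rewrite -big_split /=; apply: ler_sum => j _; have /andP[t0 tT] := hT t j Pt.
apply: le_trans (ler_wpM2r t0 (hs j)) _.
by rewrite mulrDl lerD2l ler_wpM2l.
Qed.

Lemma support_mono (s s' : 'rV[R]_d) : (forall j, s' ord0 j <= s ord0 j) -> support s' <= support s.
Proof.
move=> h; have [T _ hT] := body_bounded.
have := @support_shift T 0 s s' hT (lexx 0); rewrite mul0r addr0; apply.
by move=> j; rewrite addr0.
Qed.

Lemma weight_continuous s : {within P, continuous (weight s)}.
Proof.
apply/subspace_continuousP => t Pt; apply: cvgD; last first.
  by move/subspace_continuousP : ln_f_continuous; exact.
apply: cvg_within_filter.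
elim: (index_enum _) => [|j r IH].
  by rewrite big_nil; under eq_fun do rewrite big_nil; exact: cvg_cst.
rewrite big_cons; under eq_fun do rewrite big_cons.
by apply: cvgD => //; apply: cvgMl_tmp; exact: coord_continuous.
Qed.

(** Take a near maximiser ts, an interior point p0, and t1 on the segment from ts
    to p0, close to ts. By convexity t1 is interior to P (a ball around p0 is
    shrunk towards ts), and by continuity the weight stays near its supremum on a
    small ball around t1. *)
Lemma interior_adherent s e : 0 < e -> exists t1 : 'rV[R]_d, exists2 rho : R, 0 < rho &
  forall t : 'rV[R]_d, (forall j, `|t ord0 j - t1 ord0 j| < rho) -> P t /\ support s - e <= weight s t.
Proof.
move=> e0; have [cP convP [p0 p0P]] := P_body.
have e30 : 0 < e / 3 by rewrite divr_gt0.
have [ts Pts hts] := support_adherent s e30.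
have /nbhs_ballP[r /= r0 hr] : nbhs p0 P by exact: p0P.
have Pp0 : P p0 by apply: hr; exact: ballxx.
have hr' (t : 'rV[R]_d) : (forall j, `|t ord0 j - p0 ord0 j| < r) -> P t.
  move=> h; apply: hr; split=> // i j; rewrite (ord1 i) -ball_normE /=.
  by rewrite distrC; exact: h.
have near (t : 'rV[R]_d) (a : R) : P t -> 0 < a -> exists2 rho : R, 0 < rho &
    forall t' : 'rV[R]_d, P t' -> (forall j, `|t' ord0 j - t ord0 j| < rho) -> `|weight s t - weight s t'| < a.
  move=> Pt a0; move/subspace_continuousP : (@weight_continuous s) => /(_ t Pt).
  move=> /cvgrPdist_lt/(_ a a0); rewrite near_withinE => /nbhs_ballP[rho /= rho0 h].
  exists rho => // t' Pt' ht'; apply: h => //; split=> // i j; rewrite (ord1 i) -ball_normE /=.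
  by rewrite distrC; exact: ht'.
have conv (t : 'rV[R]_d) (l : R) : P t -> 0 <= l <= 1 -> P ((1 - l) *: ts + l *: t).
  move=> Pt /andP[l0 l1].
  have h : 0 <= 1 - l <= 1 by rewrite subr_ge0 l1 gerBl l0.
  have key : P ((1 - l) *: ts + (1 - (1 - l)) *: t).
    exact: (set_mem (convP ts t (Itv01 (andP h).1 (andP h).2) (mem_set Pts) (mem_set Pt))).
  by move: key; rewrite subKr.
have [T T0 hT] := body_bounded.
have [rho1 rho10 h1] := near _ _ Pts e30.
(* The point t1 = (1 - l) ts + l p0 is then within rho1 of ts. *)
pose l := Num.min 1 (rho1 / (T + 1) / 2).
have T10 : 0 < T + 1 by rewrite addr_gt0.
have l0 : 0 < l by rewrite lt_min ltr01 !divr_gt0.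
have l1 : l <= 1 by rewrite ge_min lexx.
have l2 : l * (T + 1) < rho1.
  apply: (@le_lt_trans _ _ (rho1 / (T + 1) / 2 * (T + 1))).
    by rewrite ler_wpM2r ?(ltW T10)// ge_min lexx orbT.
  by rewrite mulrAC divfK ?gt_eqF//; lra.
have [t1 t1E] : exists t1 : 'rV[R]_d, t1 = (1 - l) *: ts + l *: p0 by eexists.
have Pt1 : P t1 by rewrite t1E; apply: conv => //; rewrite l1 (ltW l0).
have [rho2 rho20 h2] := near _ _ Pt1 e30.
exists t1; exists (Num.min rho2 (l * r)); first by rewrite lt_min rho20 mulr_gt0.
move=> t ht.
have Pt : P t.
  pose p := p0 + l^-1 *: (t - t1).
  have -> : t = (1 - l) *: ts + l *: p.
    rewrite /p scalerDr scalerA divff ?gt_eqF// scale1r addrA -t1E.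
    by rewrite addrCA subrr addr0.
  apply: conv; last by rewrite l1 (ltW l0).
  apply: hr' => j; rewrite /p !mxE addrAC subrr add0r normrM.
  rewrite gtr0_norm ?invr_gt0// ltr_pdivrMl//.
  by have := ht j; rewrite lt_min => /andP[_].
split=> //.
have a1 : `|weight s ts - weight s t1| < e / 3.
  apply: h1 => // j; rewrite t1E !mxE.
  rewrite (_ : _ - _ = l * (p0 ord0 j - ts ord0 j)); last by ring.
  rewrite normrM gtr0_norm//; apply: le_lt_trans l2; rewrite ler_wpM2l ?(ltW l0)//.
  have /andP[? ?] := hT _ j Pp0; have /andP[? ?] := hT _ j Pts.
  by rewrite ler_norml; apply/andP; split; lra.
have a2 : `|weight s t1 - weight s t| < e / 3.
  by apply: h2 => // j; have := ht j; rewrite lt_min => /andP[].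
move: a1 a2; rewrite !ltr_norml => /andP[_ a1] /andP[_ a2]; lra.
Qed.

End weighted_support_theory.

(** * Lattice points and P-polynomials *)

Section lattice_polynomials.
Context {R : realType} {d : nat}.
Local Notation C := R[i].
Variable P : set 'rV[R]_d.
Variable T : R.
Hypothesis PT : forall (t : 'rV[R]_d) j, P t -> 0 <= t ord0 j <= T.

Lemma lattice_pointsP n a : (0 < n)%N ->
  lattice_points P n a <-> P (n%:R^-1 *: natv a).
Proof.
move=> n0; have nR : (n%:R : R) != 0 by rewrite pnatr_eq0 -lt0n.
split=> [[t Pt <-]|Pa]; first by rewrite scalerA mulVf// scale1r.
by exists (n%:R^-1 *: natv a) => //; rewrite scalerA mulfV// scale1r.
Qed.

(** As the image of a finite type it is finite by construction, with an explicit
    bound for its cardinality. *)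
Definition lattice_box (K : nat) : {fset 'rV[nat]_d} :=
  [fset a in codom (fun g : {ffun 'I_d -> 'I_K} => (\row_j (g j : nat))%R : 'rV[nat]_d)]%fset.

Lemma card_lattice_box K : (#|` lattice_box K| <= K ^ d)%N.
Proof.
rewrite card_fseq (leq_trans (size_undup _))// size_codom card_ffun.
by rewrite !card_ord.
Qed.

Definition lattice_bound n := (Num.truncn (n%:R * T)).+1.

Lemma lattice_coord_lt n a j : lattice_points P n a -> (a ord0 j < lattice_bound n)%N.
Proof.
move=> [t Pt ta]; have /andP[t0 tT] := PT j Pt.
have e : n%:R * t ord0 j = (a ord0 j)%:R.
  by have := congr1 (fun v : 'rV[R]_d => v ord0 j) ta; rewrite !mxE.
have h : (a ord0 j)%:R <= n%:R * T by rewrite -e ler_wpM2l.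
by rewrite /lattice_bound ltnS -[leqLHS](@natrK R) le_truncn.
Qed.

Lemma lattice_sub_box n : lattice_points P n `<=` [set` lattice_box (lattice_bound n)].
Proof.
move=> a aP /=; rewrite inE; apply/codomP.
exists [ffun j => Ordinal (lattice_coord_lt j aP)] => //.
by apply/rowP => j; rewrite mxE ffunE.
Qed.

Lemma lattice_finite n : finite_set (lattice_points P n).
Proof. exact: sub_finite_set (@lattice_sub_box n) (finite_fset _). Qed.

Definition lattice n : {fset 'rV[nat]_d} := fset_set (lattice_points P n).

Lemma in_lattice n a : (a \in lattice n) = (a \in lattice_points P n).
Proof. by rewrite /lattice in_fset_set//; exact: lattice_finite. Qed.

Lemma card_lattice n : (#|` lattice n| <= lattice_bound n ^ d)%N.
Proof.
apply: leq_trans (card_lattice_box _); apply: fsubset_leq_card.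
by apply/fsubsetP => a; rewrite in_lattice inE => /lattice_sub_box.
Qed.

Lemma P_polynomialE n x c (z : 'rV[C]_d) :
  P_polynomial P n x c z = \sum_(a <- lattice n) x a * c a * monomial z a.
Proof. by rewrite /P_polynomial fsbig_finite//; exact: lattice_finite. Qed.

Lemma monomial_update (v : 'rV[C]_d) j x (a : 'rV[nat]_d) :
  monomial (update v j x) a = x ^+ a ord0 j * \prod_(k | k != j) v ord0 k ^+ a ord0 k.
Proof.
rewrite /monomial (bigD1 j)//= mxE eqxx; congr (_ * _).
by apply: eq_bigr => k kj; rewrite mxE (negbTE kj).
Qed.

Lemma P_polynomial_separately n x c :
  separately_polynomial (P_polynomial P n x c : 'rV[C]_d -> C).
Proof.
move=> v j; exists (\sum_(a <- lattice n)
  (x a * c a * \prod_(k | k != j) v ord0 k ^+ a ord0 k) *: 'X^(a ord0 j)) => y.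
rewrite P_polynomialE horner_sum; apply: eq_bigr => a _.
by rewrite hornerZ hornerXn monomial_update [_ ^+ _ * _]mulrC mulrA.
Qed.

Lemma measurable_monomial (a : 'rV[nat]_d) : measurable_fun setT (fun z : 'rV[C]_d => monomial z a).
Proof.
rewrite /monomial; apply: measurable_complex_prod => j; apply: measurable_complexX.
exact: measurable_mx_entry.
Qed.

Lemma measurable_P_polynomial_joint d' (O : measurableType d') n (X : 'rV[nat]_d -> O -> C) c :
  (forall a, measurable_fun setT (X a)) ->
  measurable_fun setT (fun p : O * 'rV[C]_d => P_polynomial P n (fun a => X a p.1) c p.2).
Proof.
move=> mX; under eq_fun do rewrite P_polynomialE.
apply: measurable_complex_sum => a; apply: measurable_complexM.
  apply: measurable_complexM; last exact: measurable_cst.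
  by apply: measurableT_comp => //; exact: measurable_fst.
by apply: (measurableT_comp (measurable_monomial a)); exact: measurable_snd.
Qed.

Lemma measurable_P_polynomial n x c :
  measurable_fun setT (P_polynomial P n x c : 'rV[C]_d -> C).
Proof.
rewrite (_ : P_polynomial _ _ _ _ = fun z => \sum_(a <- lattice n) x a * c a * monomial z a).
  apply: measurable_complex_sum => a; apply: measurable_complexM; first exact: measurable_cst.
  exact: measurable_monomial.
by apply/funext => z; exact: P_polynomialE.
Qed.

Lemma measurable_P_polynomial_at d' (O : measurableType d') n (X : 'rV[nat]_d -> O -> C) c z :
  (forall a, measurable_fun setT (X a)) ->
  measurable_fun setT (fun w => P_polynomial P n (fun a => X a w) c z).
Proof.
move=> mX; under eq_fun do rewrite P_polynomialE.
apply: measurable_complex_sum => a; apply: measurable_complexM; last exact: measurable_cst.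
by apply: measurable_complexM; last exact: measurable_cst.
Qed.

End lattice_polynomials.

Section kronecker_substitution.
Context {R : realType} {d : nat}.
Local Notation C := R[i].

(** Kronecker substitution z_j = y^(K^j): it turns distinct multi-indices with
    coordinates below K into distinct exponents, by uniqueness of the digits in
    base K. *)
Definition kronecker (K : nat) (a : 'rV[nat]_d) : nat := \sum_j a ord0 j * K ^ j.

Lemma poly_eq0_of_values (p : {poly C}) : (forall x, p.[x] = 0) -> p = 0.
Proof.
move=> h; apply: (@roots_geq_poly_eq0 _ p [seq (i%:R : C) | i <- iota 0 (size p)]).
- by apply/allP => _ /mapP[i _ ->]; rewrite /root h.
- by rewrite map_inj_uniq ?iota_uniq// => i j /eqP; rewrite eqr_nat => /eqP.
- by rewrite size_map size_iota.
Qed.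

End kronecker_substitution.

Lemma digits_inj d K (a b : 'I_d -> nat) : (forall j, a j < K)%N ->
  (forall j, b j < K)%N ->
  (\sum_j a j * K ^ j = \sum_j b j * K ^ j)%N -> a =1 b.
Proof.
elim: d a b => [|d IH] a b aK bK; first by move=> _ [].
rewrite !big_ord_recl /= !muln1.
have e (g : 'I_d.+1 -> nat) : (\sum_(i < d) g (lift ord0 i) * K ^ (bump 0 i) = (\sum_(i < d) g (lift ord0 i) * K ^ i) * K)%N.
  by rewrite big_distrl /=; apply: eq_bigr => i _; rewrite -mulnA -expnSr.
rewrite !e => h.
have K0 : (0 < K)%N by apply: leq_trans (aK ord0).
have h0 : a ord0 = b ord0.
  have := congr1 (fun x => x %% K)%N h; rewrite !(addnC (_ ord0)) !modnMDl.
  by rewrite !modn_small.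
have h1 : (\sum_(i < d) a (lift ord0 i) * K ^ i = \sum_(i < d) b (lift ord0 i) * K ^ i)%N.
  by apply/eqP; rewrite -(eqn_pmul2r K0) -(eqn_add2l (a ord0)) [X in (_ == X + _)%N]h0 h.
move=> j; case: (unliftP ord0 j) => [k ->|->]//.
by apply: (IH (fun k => a (lift ord0 k)) (fun k => b (lift ord0 k))).
Qed.

Lemma kronecker_inj d K (a b : 'rV[nat]_d) : (forall j, (a ord0 j < K)%N) ->
  (forall j, (b ord0 j < K)%N) -> kronecker K a = kronecker K b -> a = b.
Proof. by move=> aK bK ab; apply/rowP; exact: digits_inj ab. Qed.

Section zero_polynomial.
Context {R : realType} {d : nat}.
Local Notation C := R[i].
Variable P : set 'rV[R]_d.
Variable T : R.
Hypothesis PT : forall (t : 'rV[R]_d) j, P t -> 0 <= t ord0 j <= T.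

(** The event that the random polynomial vanishes identically is thereby a finite
    intersection of events on the coefficients, hence measurable. *)
Lemma P_polynomial_eq0 n x c :
  (forall z : 'rV[C]_d, P_polynomial P n x c z = 0) <->
  (forall a, a \in lattice P n -> x a * c a = 0).
Proof.
split=> h; last first.
  move=> z; rewrite (P_polynomialE PT) big_seq big1// => a aP.
  by rewrite h// mul0r.
pose K := lattice_bound T n.
pose p : {poly C} := \sum_(a <- lattice P n) (x a * c a) *: 'X^(kronecker K a).
have p0 : p = 0.
  apply: poly_eq0_of_values => y; rewrite /p horner_sum.
  rewrite -[RHS](h (\row_j y ^+ (K ^ j))) (P_polynomialE PT); apply: eq_bigr => a _.
  rewrite hornerZ hornerXn; congr (_ * _).
  rewrite /monomial /kronecker expr_sum; apply: eq_bigr => j _.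
  by rewrite mxE -exprM mulnC.
move=> a aP; have := congr1 (fun q : {poly C} => q`_(kronecker K a)) p0.
rewrite /p coef_sum coef0 (big_fsetD1 a)//= coefZ coefXn eqxx mulr1 big_seq big1 ?addr0//.
move=> b; rewrite !inE => /andP[ba bP]; rewrite coefZ coefXn.
case: eqP => [e|]; last by rewrite mulr0.
have lt a' : a' \in lattice P n -> forall j, (a' ord0 j < K)%N.
  by rewrite (in_lattice PT) inE => a'P j; exact: (lattice_coord_lt PT).
by move: ba; rewrite (kronecker_inj (lt _ aP) (lt _ bP) e) eqxx.
Qed.

End zero_polynomial.

(** * Growth of P-polynomials *)

Section growth.
Context {R : realType} {d : nat}.
Local Notation C := R[i].
Local Notation normc := (@Normc.normc R).
Variables (P : set 'rV[R]_d) (f : 'rV[R]_d -> R).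
Hypothesis P_orthant : P `<=` orthant.
Hypothesis P_body : convex_body P.
Hypothesis P0 : P 0.
Hypothesis f_gt0 : forall t, P t -> 0 < f t.
Hypothesis f_cont : {within P, continuous f}.
Variable T : R.
Hypothesis PT : forall (t : 'rV[R]_d) j, P t -> 0 <= t ord0 j <= T.

Definition log_vec (Z : 'I_d -> R) : 'rV[R]_d := \row_j ln (Z j).

(** The multiplied-out form of the hypothesis on the coefficients at a fixed n:
    |c_a| is e^(n log f(a/n)) up to a factor e^(n e) or e^(-n e). *)
Definition coef_bounds (n : nat) (c : 'rV[nat]_d -> C) (e : R) :=
  forall a, a \in lattice P n -> c a != 0 /\
    `|ln (normc (c a)) - n%:R * ln (f (n%:R^-1 *: natv a))| <= n%:R * e.

Lemma coef_bounds_near (c : nat -> 'rV[nat]_d -> C) e : 0 < e ->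
  (ereal_sup [set `| n%:R^-1%:E * log_modulus (c n a)
                    - (ln (f (n%:R^-1 *: natv a)))%:E |%E
            | a in lattice_points P n] @[n --> \oo] --> 0%E) ->
  \forall n \near \oo, coef_bounds n (c n) e.
Proof.
move=> e0 hc.
move: hc => /(_ [set x : \bar R | (x < e%:E)%E]) [].
  apply: open_nbhs_nbhs; split; first exact: open_ereal_lt_ereal.
  by rewrite /= lte_fin.
move=> N _ hN; exists (maxn N 1) => // n /=; rewrite geq_max => /andP[nN n0].
have nR : 0 < n%:R :> R by rewrite ltr0n.
move=> a; rewrite (in_lattice PT) inE => aP.
have /= h := hN n nN.
have {h} : (`| n%:R^-1%:E * log_modulus (c n a) - (ln (f (n%:R^-1 *: natv a)))%:E | < e%:E)%E.
  by apply: le_lt_trans h; apply: ereal_sup_ubound; exists a.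
have [->|c0] := eqVneq (c n a) 0.
  by rewrite log_modulus0 gt0_muleNy ?lte_fin ?invr_gt0//= ltNge leey.
rewrite log_modulusE// -EFinM -EFinB abse_EFin lte_fin => h; split=> //.
rewrite (_ : _ - _ = n%:R * (n%:R^-1 * ln (normc (c n a)) - ln (f (n%:R^-1 *: natv a)))).
  by rewrite normrM ger0_norm ?ler0n// ler_wpM2l ?ler0n// ltW.
by rewrite mulrBr mulrA divff ?gt_eqF// mul1r.
Qed.

Lemma monomial_le (Z : 'I_d -> R) (z : 'rV[C]_d) (a : 'rV[nat]_d) n :
  (0 < n)%N -> (forall j, 0 < Z j) -> (forall j, normc (z ord0 j) <= Z j) ->
  normc (monomial z a) <= expR (n%:R * \sum_j (log_vec Z) ord0 j * (n%:R^-1 *: (natv a : 'rV[R]_d)) ord0 j).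
Proof.
move=> n0 Z0 zZ; rewrite /monomial normc_prod mulr_sumr expR_sum.
apply: ler_prod => j _; rewrite normc_ge0 normcX /= !mxE.
have -> : n%:R * (ln (Z j) * (n%:R^-1 * (a ord0 j)%:R)) = (a ord0 j)%:R * ln (Z j).
  by field; rewrite pnatr_eq0 -lt0n.
rewrite mulr_natl -lnXn// lnK ?posrE ?exprn_gt0//.
by apply: lerXn2r; rewrite ?nnegrE ?normc_ge0// ltW.
Qed.

Lemma monomial_eq (w : 'rV[C]_d) (a : 'rV[nat]_d) n :
  (0 < n)%N -> (forall j, w ord0 j != 0) ->
  normc (monomial w a) = expR (n%:R * \sum_j (Log w) ord0 j * (n%:R^-1 *: (natv a : 'rV[R]_d)) ord0 j).
Proof.
move=> n0 w0; rewrite /monomial normc_prod mulr_sumr expR_sum.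
apply: eq_bigr => j _; rewrite normcX /= !mxE.
have -> : n%:R * (ln (normc (w ord0 j)) * (n%:R^-1 * (a ord0 j)%:R)) = (a ord0 j)%:R * ln (normc (w ord0 j)).
  by field; rewrite pnatr_eq0 -lt0n.
by rewrite mulr_natl -lnXn ?normc_gt0// lnK ?posrE ?exprn_gt0 ?normc_gt0.
Qed.

(** Each term is at most e^(n (I(log Z) + 2 e)), and there are at most e^(n e)
    terms. *)
Lemma P_polynomial_upper n (x c : 'rV[nat]_d -> C) (e : R) (Z : 'I_d -> R) (z : 'rV[C]_d) :
  (0 < n)%N -> coef_bounds n c e ->
  (forall a, a \in lattice P n -> normc (x a) <= expR (n%:R * e)) ->
  (#|` lattice P n|)%:R <= expR (n%:R * e) ->
  (forall j, 0 < Z j) -> (forall j, normc (z ord0 j) <= Z j) ->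
  normc (P_polynomial P n x c z) <= expR (n%:R * (support P f (log_vec Z) + 3%:R * e)).
Proof.
move=> n0 hc hx hA Z0 zZ; rewrite (P_polynomialE PT).
apply: le_trans (normc_sum _ _ _) _; rewrite big_seq.
set B := expR (n%:R * (support P f (log_vec Z) + 2 * e)).
apply: (@le_trans _ _ (\sum_(a <- lattice P n | a \in lattice P n) B)).
  apply: ler_sum => a aP; have [c0 hca] := hc a aP.
  rewrite !Normc.normcM.
  have Pa : P (n%:R^-1 *: natv a).
    by apply/lattice_pointsP => //; move: aP; rewrite (in_lattice PT) inE.
  have hca' : normc (c a) <= expR (n%:R * (ln (f (n%:R^-1 *: natv a)) + e)).
    rewrite -[leLHS]lnK ?posrE ?normc_gt0// ler_expR.
    by move: hca; rewrite ler_norml => /andP[_]; rewrite lerBlDl mulrDr.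
  apply: le_trans (_ : expR (n%:R * e) * expR (n%:R * (ln (f (n%:R^-1 *: natv a)) + e))
     * expR (n%:R * \sum_j (log_vec Z) ord0 j * (n%:R^-1 *: (natv a : 'rV[R]_d)) ord0 j) <= _).
    apply: ler_pM; rewrite ?mulr_ge0 ?normc_ge0//; last exact: monomial_le.
    by apply: ler_pM; rewrite ?normc_ge0// hx.
  rewrite -!expRD ler_expR -!mulrDr ler_wpM2l ?ler0n//.
  have := support_ub P_orthant P_body P0 f_gt0 f_cont (log_vec Z) Pa.
  by rewrite /weight => h; lra.
rewrite -big_seq big_const_seq count_predT iter_addr addr0 -[B *+ _]mulr_natl.
apply: le_trans (ler_wpM2r (expR_ge0 _) hA) _.
by rewrite -expRD ler_expR -mulrDr ler_wpM2l ?ler0n//; lra.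
Qed.

End growth.

(** * Extraction of coefficients by Lagrange interpolation *)

Section extraction.
Context {R : realType} {d : nat}.
Local Notation C := R[i].
Local Notation normc := (@Normc.normc R).

Definition degree (a : 'rV[nat]_d) : nat := \sum_j a ord0 j.

Lemma monomial_scale (q : C) (w : 'rV[C]_d) (a : 'rV[nat]_d) :
  monomial (q *: w) a = q ^+ degree a * monomial w a.
Proof.
rewrite /monomial /degree expr_sum -big_split; apply: eq_bigr => j _ /=.
by rewrite mxE exprMn.
Qed.

Definition node (q : R) (k : nat) : C := (q%:C) ^+ k.

Lemma node_inj q : 1 < q -> injective (node q).
Proof.
move=> q1 k l /(congr1 normc); rewrite !normcX normc_real gtr0_norm; last lra.
by move=> e; apply/eqP; rewrite eqn_leq -!(ler_eXn2l q1) e lexx.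
Qed.

Definition lagrange (q : R) (m k : nat) : {poly C} :=
  (\prod_(l <- iota 0 m | l != k) (node q k - node q l))^-1 *:
  \prod_(l <- iota 0 m | l != k) ('X - (node q l)%:P).

Lemma lagrangeE q m k l : 1 < q -> (k < m)%N -> (l < m)%N ->
  (lagrange q m k).[node q l] = (k == l)%:R.
Proof.
move=> q1 km lm; rewrite /lagrange hornerZ horner_prod.
under [X in _ * X]eq_bigr do rewrite hornerXsubC.
case: eqP => [->|/eqP kl].
  rewrite mulVf// prodf_seq_neq0; apply/allP => j _; apply/implyP => jl.
  by rewrite subr_eq0; apply: contra_neq jl => /(node_inj q1).
rewrite [X in _ * X](_ : _ = 0) ?mulr0//; apply/eqP; rewrite prodf_seq_eq0.
by apply/hasP; exists l; rewrite ?mem_iota ?add0n// eq_sym kl subrr eqxx.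
Qed.

Lemma size_lagrange q m k : (k < m)%N -> (size (lagrange q m k) <= m)%N.
Proof.
move=> km; rewrite /lagrange (leq_trans (size_scale_leq _ _))//.
rewrite -big_filter size_prod_XsubC size_filter.
have := count_predC (pred1 k) (iota 0 m); rewrite size_iota.
rewrite (count_uniq_mem k (iota_uniq 0 m)) mem_iota add0n km /= => h.
by move: h; rewrite add1n => ->.
Qed.

Definition lagrange_norm (q : R) (m : nat) : R :=
  \sum_(k <- iota 0 m) \sum_(i < m) normc (lagrange q m k)`_i.

End extraction.

Section extraction_identity.
Context {R : realType} {d : nat}.
Local Notation C := R[i].
Local Notation normc := (@Normc.normc R).
Variables (q : R) (m s0 : nat) (A : {fset 'rV[nat]_d}) (alpha : nat -> 'rV[nat]_d).
Variables (c : 'rV[nat]_d -> C) (w : 'rV[C]_d).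
Hypothesis q1 : 1 < q.
Hypothesis alphaA : forall k, (k < m)%N -> alpha k \in A.
Hypothesis alpha_degree : forall k, (k < m)%N -> degree (alpha k) = (s0 + k)%N.

Let p (x : 'rV[nat]_d -> C) z := \sum_(a <- A) x a * c a * monomial z a.

Definition others : {fset 'rV[nat]_d} :=
  (A `\` [fset alpha k | k in iota 0 m])%fset.

Lemma alpha_others k : (k < m)%N -> alpha k \notin others.
Proof.
move=> km; rewrite inE negb_and negbK; apply/orP; left.
by apply/imfsetP; exists k => //=; rewrite mem_iota add0n.
Qed.

Lemma alpha_inj k l : (k < m)%N -> (l < m)%N -> alpha k = alpha l -> k = l.
Proof.
move=> km lm /(congr1 degree); rewrite !alpha_degree// => /eqP.
by rewrite eqn_add2l => /eqP.
Qed.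

Lemma node_neq0 k : node q k != 0.
Proof. by rewrite /node expf_neq0// -normc_gt0 normc_real normr_gt0 gt_eqF// (lt_trans _ q1). Qed.

(** The coefficient of x_b in the form extracted for the index k. It comes from
    evaluating the Lagrange polynomial at the possibly new node q^(deg b - s0);
    the quotient form allows deg b < s0. *)
Definition mixing (k : nat) (b : 'rV[nat]_d) : C :=
  (lagrange q m k).[node q (degree b) / node q s0] * (c b * monomial w b).

(** Put X_a = q^(deg a - s0). Then p(q^i w) / q^(s0 i) is the sum over a of
    x_a c_a w^a X_a^i, so combining these values with the coefficients of the
    Lagrange polynomial L_k gives the sum of x_a c_a w^a L_k(X_a). Among the
    alpha_l, whose X is the node q^l, only l = k survives. *)
Lemma extraction (x : 'rV[nat]_d -> C) k : (k < m)%N ->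
  x (alpha k) * (c (alpha k) * monomial w (alpha k)) + \sum_(b <- others) mixing k b * x b
  = \sum_(i < m) (lagrange q m k)`_i / node q s0 ^+ i * p x (node q i *: w).
Proof.
move=> km; pose L := lagrange q m k.
pose F a := x a * (c a * monomial w a) * L.[node q (degree a) / node q s0].
have Falpha l : (l < m)%N -> F (alpha l) = x (alpha l) * (c (alpha l) * monomial w (alpha l)) * (k == l)%:R.
  move=> lm; rewrite /F /L alpha_degree//.
  have -> : node q (s0 + l) / node q s0 = node q l.
    by rewrite {1}/node exprD mulrC mulKf// node_neq0.
  by rewrite lagrangeE.
transitivity (\sum_(a <- A) F a).
  rewrite [RHS](big_fsetD1 (alpha k)) ?alphaA// Falpha// eqxx mulr1; congr (_ + _).
  transitivity (\sum_(b <- others) F b).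
    by apply: eq_bigr => b _; rewrite /F /mixing mulrC mulrAC mulrA.
  apply: big_fset_incl => [|a].
    apply/fsubsetP => b; rewrite !inE => /andP[bal ->]; rewrite andbT.
    by apply: contraNneq bal => ->; apply/imfsetP; exists k => //=; rewrite mem_iota add0n.
  rewrite !inE => /andP[ak aA]; rewrite aA andbT negbK => /imfsetP[l /= ].
  rewrite mem_iota add0n => /andP[_ lm] al; rewrite al Falpha//.
  by case: eqP => [kl|]; [move: ak; rewrite al kl eqxx|rewrite mulr0].
rewrite /p; under [RHS]eq_bigr do rewrite mulr_sumr.
rewrite exchange_big /=; apply: eq_bigr => a _.
rewrite /F (@horner_coef_wide _ m) ?size_lagrange// mulr_sumr; apply: eq_bigr => i _.
rewrite monomial_scale exprMn exprVn /node -exprM mulnC exprM.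
set u := q%:C ^+ degree a ^+ i; set v := (q%:C ^+ s0 ^+ i)^-1.
by rewrite [q%:C ^+ i ^+ degree a]exprAC -/u /L; ring.
Qed.

(** The factors q^(-s0 i) are at most 1, so the constant does not involve the
    degree s0, which grows with n. *)
Lemma extraction_bound (x : 'rV[nat]_d -> C) k B : (k < m)%N -> 0 <= B ->
  (forall i, (i < m)%N -> normc (p x (node q i *: w)) <= B) ->
  normc (x (alpha k) * (c (alpha k) * monomial w (alpha k)) + \sum_(b <- others) mixing k b * x b)
   <= lagrange_norm q m * B.
Proof.
move=> km B0 hB; rewrite extraction//; apply: le_trans (normc_sum _ _ _) _.
apply: (@le_trans _ _ (\sum_(i < m) normc (lagrange q m k)`_i * B)); last first.
  rewrite -mulr_suml ler_wpM2r// /lagrange_norm (big_rem k) ?mem_iota ?add0n//=.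
  by rewrite lerDl; apply: sumr_ge0 => j _; apply: sumr_ge0 => i _; exact: normc_ge0.
apply: ler_sum => i _; rewrite !Normc.normcM ler_pM// ?mulr_ge0 ?normc_ge0// ?hB//.
have v0 : 0 < normc (node q s0 ^+ i) by rewrite normc_gt0 expf_neq0// node_neq0.
apply: ler_piMr; first exact: normc_ge0.
rewrite Normc.normcV invf_le1//.
rewrite !normcX normc_real gtr0_norm ?(lt_trans _ q1)//.
by rewrite exprn_ege1// exprn_ege1// ltW.
Qed.

End extraction_identity.

(** * Small values on a geometric progression are unlikely *)

Lemma measurable_forall_lt d' (O : measurableType d') (A : nat -> set O) m :
  (forall k, measurable (A k)) -> measurable [set w | forall k, (k < m)%N -> A k w].
Proof.
move=> mA; rewrite (_ : [set w | _] = \bigcap_(k in `I_m) A k).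
  by apply: fin_bigcap_measurable => // k _; exact: mA.
by apply/seteqP; split=> w h k /= km; exact: h.
Qed.

Lemma near_expR_decay (R : realType) (a C del : R) : 0 < a -> 0 < del ->
  \forall n \near \oo, C * expR (- (n%:R * a)) <= del.
Proof.
move=> a0 del0; exists (Num.truncn (`|C| / del / a)).+1 => // n /= hn.
apply: (@le_trans _ _ (`|C| * expR (- (n%:R * a)))).
  by rewrite ler_wpM2r ?expR_ge0// ler_norm.
rewrite expRN ler_pdivrMr ?expR_gt0// mulrC -ler_pdivrMr//.
have h : `|C| / del <= n%:R * a.
  rewrite -ler_pdivrMr// ltW//; apply: lt_le_trans (truncnS_gt _) _.
  by rewrite ler_nat.
apply: (le_trans h); apply: le_trans (expR_ge1Dx _).
by rewrite lerDr.
Qed.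

Section progression.
Context {R : realType} {d : nat} (hd : (1 <= d)%N).
Variables (P : set 'rV[R]_d) (f : 'rV[R]_d -> R).
Hypothesis P_orthant : P `<=` orthant.
Hypothesis P_body : convex_body P.
Hypothesis P0 : P 0.
Hypothesis f_gt0 : forall t, P t -> 0 < f t.
Hypothesis f_cont : {within P, continuous f}.
Variable T : R.
Hypothesis PT : forall (t : 'rV[R]_d) j, P t -> 0 <= t ord0 j <= T.

(** The degrees are consecutive, so that scaling by q sends these terms to
    consecutive nodes. *)
Definition progression (a0 : 'rV[nat]_d) (k : nat) : 'rV[nat]_d :=
  \row_j (a0 ord0 j + (j == Ordinal hd) * k)%N.

Lemma degree_progression a0 k : degree (progression a0 k) = (degree a0 + k)%N.
Proof.
rewrite /degree; under eq_bigr do rewrite mxE; rewrite big_split /=; congr addn.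
by rewrite (bigD1 (Ordinal hd)) // eqxx mul1n big1 => [|j /negbTE ->] //=; rewrite addn0.
Qed.

(** In each coordinate the progression that starts at the integer part of n t1
    stays within m of n t1, hence within n rho for large n. *)
Lemma progression_near (s : 'rV[R]_d) e m : 0 < e ->
  \forall n \near \oo, exists a0, forall k, (k < m)%N ->
    progression a0 k \in lattice P n /\
    support P f s - e <= weight f s (n%:R^-1 *: natv (progression a0 k)).
Proof.
move=> e0.
have [t1 [rho rho0 ht]] := interior_adherent P_orthant P_body P0 f_gt0 f_cont s e0.
have [Pt1 _] : P t1 /\ support P f s - e <= weight f s t1.
  by apply: ht => j; rewrite subrr normr0.
exists (Num.truncn (m.+1%:R / rho)).+1 => // n /= hn.
have n0 : (0 < n)%N by exact: leq_trans hn.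
have nR : 0 < n%:R :> R by rewrite ltr0n.
have hn' : m.+1%:R < n%:R * rho.
  rewrite -ltr_pdivrMr//; apply: lt_le_trans (truncnS_gt _) _.
  by rewrite ler_nat.
exists (\row_j Num.truncn (n%:R * t1 ord0 j)) => k km.
have [Pk wk] : P (n%:R^-1 *: natv (progression (\row_j Num.truncn (n%:R * t1 ord0 j)) k)) /\
    support P f s - e <= weight f s (n%:R^-1 *: natv (progression (\row_j Num.truncn (n%:R * t1 ord0 j)) k)).
  apply: ht => j; rewrite !mxE natrD.
  have /andP[t0 tT] := PT j Pt1.
  have nt0 : 0 <= n%:R * t1 ord0 j by rewrite mulr_ge0.
  set u : nat := Num.truncn _; set v : nat := (_ * k)%N.
  rewrite (_ : _ - _ = (u%:R + v%:R - n%:R * t1 ord0 j) / n%:R); last first.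
    by field; exact: lt0r_neq0.
  rewrite normrM normfV (gtr0_norm nR) ltr_pdivrMr// [ltRHS]mulrC.
  apply: le_lt_trans hn'.
  have := truncn_itv nt0; rewrite -/u => /andP[u1 u2].
  have k1 : v%:R + 1 <= m.+1%:R :> R.
    rewrite natr1 ler_nat ltnS (leq_trans _ (ltnW km))// /v.
    by case: (j == _); rewrite ?mul1n ?mul0n.
  have k0 : 0 <= v%:R :> R by [].
  rewrite -natr1 in u2.
  by rewrite ler_norml; apply/andP; split; lra.
by split=> //; rewrite (in_lattice PT) inE; apply/lattice_pointsP.
Qed.

End progression.

Section small_values.
Context {R : realType} {d : nat} (hd : (1 <= d)%N).
Local Notation C := R[i].
Local Notation normc := (@Normc.normc R).
Variables (P : set 'rV[R]_d) (f : 'rV[R]_d -> R).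
Hypothesis P_orthant : P `<=` orthant.
Hypothesis P_body : convex_body P.
Hypothesis P0 : P 0.
Hypothesis f_gt0 : forall t, P t -> 0 < f t.
Hypothesis f_cont : {within P, continuous f}.
Variable T : R.
Hypothesis PT : forall (t : 'rV[R]_d) j, P t -> 0 <= t ord0 j <= T.
Context disp (Omega : measurableType disp) (Pr : probability Omega R).
Variable xi : 'rV[nat]_d -> {RV Pr >-> C}.
Hypothesis xi_indep : mutually_independent xi.
Variables (theta del : R).
Hypothesis theta0 : 0 <= theta.
Hypothesis del0 : 0 < del.
Hypothesis small_ball : forall i x,
  (Pr [set o | normc (xi i o + x) <= del]%R <= theta%:E)%E.
Variable c : nat -> 'rV[nat]_d -> C.
Hypothesis c_asymp : forall e, 0 < e -> \forall n \near \oo, coef_bounds P f n (c n) e.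

Let poly n o := P_polynomial P n (fun a => xi a o) (c n) : 'rV[C]_d -> C.

Lemma measurable_poly_at n z : measurable_fun setT (fun o => poly n o z).
Proof.
by apply: (measurable_P_polynomial_at PT) => a; exact: measurable_funPT.
Qed.

Definition small_event n (w : 'rV[C]_d) (q : R) (m : nat) (r : R) : set Omega :=
  [set o | forall i, (i < m)%N -> normc (poly n o (node q i *: w)) <= r].

Lemma measurable_small_event n w q m r : measurable (small_event n w q m r).
Proof.
apply: (@measurable_forall_lt _ _ (fun i => [set o | normc (poly n o (node q i *: w)) <= r])) => i.
rewrite -[X in measurable X]setTI; apply: measurable_fun_ler => //.
by apply: measurable_normc; exact: measurable_poly_at.
Qed.

(** If all the values are at most r = e^(n (I - e)), the extracted forms, divided
    by their leading coefficients, which exceed e^(n (I - e/2)), are at most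
    lagrange_norm e^(-n e/2) <= del; then anticoncentration applies. *)
Lemma small_event_near (w : 'rV[C]_d) (q : R) (m : nat) (e : R) :
  (forall j, w ord0 j != 0) -> 1 < q -> 0 < e ->
  \forall n \near \oo, (Pr (small_event n w q m (expR (n%:R * (support P f (Log w) - e))))
     <= (theta ^+ m)%:E)%E.
Proof.
move=> w0 q1 e0; have e40 : 0 < e / 4 by rewrite divr_gt0.
have e20 : 0 < e / 2 by rewrite divr_gt0.
near=> n.
have n0 : (0 < n)%N by near: n; exact: nbhs_infty_gt.
have [a0 ha0] : exists a0, forall k, (k < m)%N ->
    progression hd a0 k \in lattice P n /\
    support P f (Log w) - e / 4 <= weight f (Log w) (n%:R^-1 *: natv (progression hd a0 k)).
  by near: n; exact: (progression_near hd P_orthant P_body P0 f_gt0 f_cont PT).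
have hc : coef_bounds P f n (c n) (e / 4) by near: n; exact: c_asymp.
have hdec : lagrange_norm q m * expR (- (n%:R * (e / 2))) <= del.
  by near: n; exact: near_expR_decay.
set r := expR _.
pose al := progression hd a0.
have alA k : (k < m)%N -> al k \in lattice P n by move=> /ha0[].
have ald k : (k < m)%N -> degree (al k) = (degree a0 + k)%N.
  by move=> _; exact: degree_progression.
pose lead k := c n (al k) * monomial w (al k).
have lead_ge k : (k < m)%N -> expR (n%:R * (support P f (Log w) - e / 2)) <= normc (lead k).
  move=> km; have [alP wk] := ha0 k km; have [c0 hck] := hc _ alP.
  rewrite /lead Normc.normcM (monomial_eq _ n0)// -[normc (c n _)]lnK ?posrE ?normc_gt0//.
  rewrite -expRD ler_expR.
  move: hck; rewrite ler_norml => /andP[hck _].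
  rewrite -/al in wk hck *; move: wk; rewrite /weight.
  set S := \sum_j _; set F := ln (f _) in hck *.
  set g := ln (normc _) in hck *.
  move=> wk; have : n%:R * (support P f (Log w) - e / 4) <= n%:R * (S + F) by rewrite ler_wpM2l.
  by rewrite !mulrDr !mulrN in hck *; lra.
have lead0 k : (k < m)%N -> lead k != 0.
  by move=> km; rewrite -normc_gt0 (lt_le_trans _ (lead_ge k km))// expR_gt0.
pose B := others m (lattice P n) al.
pose y k b := mixing q m (degree a0) (c n) w k b / lead k.
pose E := [set o | forall k, (k < m)%N ->
  normc (xi (al k) o + \sum_(b <- B) y k b * xi b o) <= del].
have mE : measurable E.
  apply: (@measurable_forall_lt _ _ (fun k => [set o | normc (xi (al k) o + \sum_(b <- B) y k b * xi b o) <= del])) => k.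
  rewrite -[X in measurable X]setTI; apply: measurable_fun_ler => //.
  apply: measurable_normc; apply: measurable_complexD; first exact: measurable_funPT.
  apply: measurable_complex_sum => b; apply: measurable_complexM; first exact: measurable_cst.
  exact: measurable_funPT.
apply: (@le_trans _ _ (Pr E)); last first.
  apply: (small_ball_linear xi_indep) => //.
  - by move=> k km; exact: alpha_others.
  - by move=> k l km lm; exact: (alpha_inj ald).
apply: le_measure; rewrite ?inE//; first exact: measurable_small_event.
move=> o ho k km /=.
have hp i : (i < m)%N -> normc (\sum_(a <- lattice P n) xi a o * c n a * monomial (node q i *: w) a) <= r.
  by move=> im; rewrite -(P_polynomialE PT); exact: ho.
have := extraction_bound q1 alA ald km (expR_ge0 _) hp.
rewrite -/(lead k) => hk.
have -> : xi (al k) o + \sum_(b <- B) y k b * xi b o =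
  (xi (al k) o * lead k + \sum_(b <- B) mixing q m (degree a0) (c n) w k b * xi b o) / lead k.
  rewrite mulrDl mulfK ?lead0// mulr_suml; congr (_ + _).
  by apply: eq_bigr => b _; rewrite /y mulrAC.
rewrite Normc.normcM Normc.normcV ler_pdivrMr ?normc_gt0 ?lead0//.
apply: (le_trans hk); apply: le_trans (_ : del * expR (n%:R * (support P f (Log w) - e / 2)) <= _); last first.
  by rewrite ler_wpM2l ?(ltW del0)// lead_ge.
rewrite -[leLHS](divfK (lt0r_neq0 (expR_gt0 (n%:R * (support P f (Log w) - e / 2))))).
rewrite ler_wpM2r ?expR_ge0// -mulrA -expRN -expRD.
by apply: le_trans hdec; rewrite -!mulrBr le_eqVlt; apply/orP; left; apply/eqP; congr (_ * expR _); field.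
Unshelve. all: by end_near.
Qed.

End small_values.

(** * The random coefficients are rarely large *)

Section union_bound.
Context disp (Omega : measurableType disp) (R : realType) (mu : {measure set Omega -> \bar R}).

Lemma measurable_exists_seq (I : eqType) (s : seq I) (A : I -> set Omega) :
  (forall i, measurable (A i)) -> measurable [set o | exists2 i, i \in s & A i o].
Proof.
move=> mA; elim: s => [|i s IH].
  by rewrite (_ : [set o | _] = set0)//; apply/seteqP; split=> // o [].
rewrite (_ : [set o | _] = A i `|` [set o | exists2 i, i \in s & A i o]); first exact: measurableU.
apply/seteqP; split=> [w [k]|w [Ai|[k ks Ak]]].
- by rewrite inE => /orP[/eqP->|ks Ak]; [left|right; exists k].
- by exists i; rewrite ?inE ?eqxx.
- by exists k; rewrite ?inE ?ks ?orbT.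
Qed.

Lemma measure_exists_le (I : eqType) (s : seq I) (A : I -> set Omega) :
  (forall i, measurable (A i)) ->
  (mu [set o | exists2 i, i \in s & A i o] <= \sum_(i <- s) mu (A i))%E.
Proof.
move=> mA; elim: s => [|i s IH].
  rewrite big_nil (_ : [set o | _] = set0) ?measure0//.
  by apply/seteqP; split=> // o [].
rewrite big_cons (_ : [set o | _] = A i `|` [set o | exists2 i, i \in s & A i o]).
  apply: (@le_trans _ _ (mu (A i) + mu [set o | exists2 i, i \in s & A i o])%E).
    by apply: measureU2 => //; exact: measurable_exists_seq.
  exact: leeD2l.
apply/seteqP; split=> [w [k]|w [Ai|[k ks Ak]]].
- by rewrite inE => /orP[/eqP->|ks Ak]; [left|right; exists k].
- by exists i; rewrite ?inE ?eqxx.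
- by exists k; rewrite ?inE ?ks ?orbT.
Qed.

End union_bound.

Section tails.
Context {R : realType} {d : nat} (hd : (1 <= d)%N).
Local Notation C := R[i].
Local Notation normc := (@Normc.normc R).
Variable P : set 'rV[R]_d.
Variable T : R.
Hypothesis T0 : 0 < T.
Hypothesis PT : forall (t : 'rV[R]_d) j, P t -> 0 <= t ord0 j <= T.

Lemma card_lattice_le n : (0 < n)%N -> (#|` lattice P n|)%:R <= (n%:R * (T + 1)) ^+ d :> R.
Proof.
move=> n0; apply: (@le_trans _ _ ((lattice_bound T n ^ d)%:R)).
  by rewrite ler_nat; exact: card_lattice.
have n1 : 1 <= n%:R :> R by rewrite ler1n.
rewrite natrX lerXn2r ?nnegrE ?mulr_ge0 ?addr_ge0 ?(ltW T0)//.
rewrite /lattice_bound -natr1 mulrDr mulr1; apply: lerD => //.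
by rewrite truncn_le// mulr_ge0 ?(ltW T0).
Qed.

(** A polynomial in n is eventually below an exponential: with h = e/(2d),
    n (T + 1) <= (n h)^2 <= e^(2 n h). *)
Lemma card_lattice_near (e : R) : 0 < e ->
  \forall n \near \oo, (#|` lattice P n|)%:R <= expR (n%:R * e).
Proof.
move=> e0; pose h := e / d%:R / 2.
have d0 : 0 < d%:R :> R by rewrite ltr0n.
have h0 : 0 < h by rewrite !divr_gt0.
exists (Num.truncn ((T + 1) / h ^+ 2)).+1 => // n /= hn.
have n0 : (0 < n)%N by exact: leq_trans hn.
have nR : 0 < n%:R :> R by rewrite ltr0n.
apply: le_trans (card_lattice_le n0) _.
have -> : n%:R * e = d%:R * (n%:R * (e / d%:R)).
  by field; exact: lt0r_neq0.
rewrite expRM_natl; apply: lerXn2r; rewrite ?nnegrE ?expR_ge0 ?mulr_ge0 ?addr_ge0 ?(ltW T0)//.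
have -> : n%:R * (e / d%:R) = 2%:R * (n%:R * h) by rewrite /h; field; exact: lt0r_neq0.
rewrite expRM_natl; apply: (@le_trans _ _ ((n%:R * h) ^+ 2)); last first.
  apply: lerXn2r; rewrite ?nnegrE ?expR_ge0 ?(ltW (mulr_gt0 nR h0))//.
  by apply: le_trans (expR_ge1Dx _); rewrite lerDr.
have : (T + 1) / h ^+ 2 <= n%:R.
  by rewrite ltW//; apply: lt_le_trans (truncnS_gt _) _; rewrite ler_nat.
rewrite ler_pdivrMr ?exprn_gt0// => hT.
by rewrite exprMn [n%:R ^+ 2]expr2 -mulrA ler_wpM2l.
Qed.

Context disp (Omega : measurableType disp) (Pr : probability Omega R).
Variable xi : 'rV[nat]_d -> {RV Pr >-> C}.
Hypothesis xi_id : identically_distributed xi.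
Hypothesis xi_tail :
  (fun t : R => fine (Pr [set w | t < ln (1 + normc (xi 0 w))]))
        =o_+oo (fun t : R => t ^- d).

Definition large_event n (e : R) : set Omega :=
  [set o | exists2 a, a \in (lattice P n : seq _) & expR (n%:R * e) < normc (xi a o)].

Lemma measurable_large a t : measurable [set o | (t : R) < normc (xi a o)].
Proof.
rewrite -[X in measurable X]setTI; apply: measurable_fun_ltr => //.
by apply: measurable_normc; exact: measurable_funPT.
Qed.

Lemma measurable_large_event n e : measurable (large_event n e).
Proof.
apply: (@measurable_exists_seq _ _ _ _ (fun a => [set o | expR (n%:R * e) < normc (xi a o)])) => a.
exact: measurable_large.
Qed.

(** The number of lattice points is at most (n (T + 1))^d and the tail at n e is
    o((n e)^-d): this is where the exponent d of the tail condition enters. *)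
Lemma large_event_near (e eta : R) : 0 < e -> 0 < eta ->
  \forall n \near \oo, (Pr (large_event n e) <= eta%:E)%E.
Proof.
move=> e0 eta0; pose K := ((T + 1) / e) ^+ d.
have K0 : 0 < K by rewrite exprn_gt0 ?divr_gt0 ?addr_gt0.
have [M [_ hM]] := (eqoP _ _ _).1 xi_tail (eta / K) (divr_gt0 eta0 K0).
exists (Num.truncn (`|M| / e)).+1 => // n /= hn.
have n0 : (0 < n)%N by exact: leq_trans hn.
have nR : 0 < n%:R :> R by rewrite ltr0n.
have Mn : M < n%:R * e.
  apply: le_lt_trans (ler_norm _) _; rewrite -ltr_pdivrMr//.
  by apply: lt_le_trans (truncnS_gt _) _; rewrite ler_nat.
have mL t : measurable [set z : C | t < ln (1 + normc z)].
  rewrite -[X in measurable X]setTI; apply: measurable_fun_ltr => //.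
  apply: (measurableT_comp (f := fun x : measurableTypeR R => ln x : measurableTypeR R)).
    exact: measurable_ln.
  by apply: measurable_funD; [exact: measurable_cst|exact: measurable_normc].
pose p := fine (Pr [set w | n%:R * e < ln (1 + normc (xi 0 w))]).
have pE : Pr [set w | n%:R * e < ln (1 + normc (xi 0 w))] = p%:E.
  rewrite /p fineK// fin_num_measure//.
  have := mL (n%:R * e); move/(@measurable_funPT _ _ _ _ (xi 0) measurableT); rewrite setTI; exact.
have hp : p <= eta / K * (n%:R * e) ^- d.
  have := hM (n%:R * e) Mn; rewrite /= -/p ger0_norm; last by rewrite fine_ge0.
  by rewrite ger0_norm// invr_ge0 exprn_ge0// mulr_ge0// ltW.
apply: (@le_trans _ _ (\sum_(a <- lattice P n) p%:E)%E).
  apply: le_trans (measure_exists_le _ _ _) _ => [a|]; first exact: measurable_large.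
  apply: lee_sum => a _; rewrite -pE.
  have -> : Pr [set w | n%:R * e < ln (1 + normc (xi 0 w))] =
     Pr [set w | n%:R * e < ln (1 + normc (xi a w))].
    exact: (xi_id 0 a (mL (n%:R * e))).
  apply: le_measure; rewrite ?inE.
  - exact: measurable_large.
  - have := mL (n%:R * e); move/(@measurable_funPT _ _ _ _ (xi a) measurableT); rewrite setTI; exact.
  move=> o /= ho; rewrite -[ltLHS]expRK ltr_ln ?posrE ?expR_gt0//.
    by apply: (lt_le_trans ho); rewrite lerDr.
  by rewrite ltr_pwDl// normc_ge0.
rewrite sumEFin lee_fin big_const_seq count_predT iter_addr addr0 -[p *+ _]mulr_natl.
apply: le_trans (_ : (n%:R * (T + 1)) ^+ d * (eta / K * (n%:R * e) ^- d) <= _).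
  apply: ler_pM => //; last exact: card_lattice_le.
  by rewrite /p fine_ge0.
rewrite /K expr_div_n !exprMn le_eqVlt; apply/orP; left; apply/eqP; field.
by rewrite !expf_neq0//; apply: lt0r_neq0 => //; rewrite addr_gt0.
Qed.

End tails.

(** * The limit function *)

Section complex_topology.
Context {R : realType} {d : nat}.
Local Notation C := R[i].
Local Notation normc := (@Normc.normc R).

(** The norm topology on vectors over the numerical field C has radii in C; this
    is its description by real radii. *)
Lemma nbhs_rVP (z : 'rV[C]_d) (A : set 'rV[C]_d) :
  nbhs z A <-> exists2 r : R, 0 < r &
    forall zeta : 'rV[C]_d, (forall j, normc (zeta ord0 j - z ord0 j) < r) -> A zeta.
Proof.
split=> [/nbhs_ballP[[r s] /= r0 h]|[r r0 h]].
  move: (r0); rewrite ltcE /= => /andP[/eqP s0 rp]; exists r => // zeta hz.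
  apply: h; split=> // i j; rewrite (ord1 i) -ball_normE /= distrC.
  by rewrite -normc_normr s0; rewrite ltcE /= eqxx; exact: hz.
apply/nbhs_ballP; exists r%:C => /=; first by rewrite ltcR.
move=> zeta [_ hz]; apply: h => j; have := hz ord0 j.
by rewrite -ball_normE /= distrC -normc_normr ltcR.
Qed.

Definition rational_center (q : 'rV[rat * rat]_d) : 'rV[C]_d :=
  \row_j (ratr (q ord0 j).1 +i* ratr (q ord0 j).2).

Definition rational_cube (p : 'rV[rat * rat]_d * nat) : set 'rV[C]_d :=
  [set z | forall j, `|complex.Re (z ord0 j) - complex.Re (rational_center p.1 ord0 j)| < p.2.+1%:R^-1
    /\ `|complex.Im (z ord0 j) - complex.Im (rational_center p.1 ord0 j)| < p.2.+1%:R^-1].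

Lemma measurable_rational_cube p : measurable (rational_cube p).
Proof.
apply: (@measurable_rV_box _ _ d (fun j => [set z : C |
   `|complex.Re z - complex.Re (rational_center p.1 ord0 j)| < p.2.+1%:R^-1
    /\ `|complex.Im z - complex.Im (rational_center p.1 ord0 j)| < p.2.+1%:R^-1])) => j.
apply: measurableI.
- rewrite -[X in measurable X]setTI; apply: measurable_fun_ltr => //.
  apply: measurableT_comp => //; apply: measurable_funB; last exact: measurable_cst.
  exact: measurable_Re.
- rewrite -[X in measurable X]setTI; apply: measurable_fun_ltr => //.
  apply: measurableT_comp => //; apply: measurable_funB; last exact: measurable_cst.
  exact: measurable_Im.
Qed.

Lemma normc_le_ReIm (z : C) : normc z <= `|complex.Re z| + `|complex.Im z|.
Proof.
case: z => a b /=; rewrite -[leRHS]ger0_norm ?addr_ge0// -sqrtr_sqr.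
rewrite ler_wsqrtr// sqrrD !real_normK ?num_real//.
by rewrite addrAC lerDl mulrn_wge0// mulr_ge0.
Qed.

Lemma rational_cube_small (U : set 'rV[C]_d) z : open U -> U z ->
  exists p, rational_cube p z /\ rational_cube p `<=` U.
Proof.
move=> oU Uz; have /nbhs_rVP[r r0 h] : nbhs z U by exact: open_nbhs_nbhs.
pose k := Num.truncn (4 / r).
have k0 : 0 < k.+1%:R^-1 :> R by rewrite invr_gt0.
have kr : k.+1%:R^-1 *+ 4 < r.
  by rewrite -[_ *+ 4]mulr_natl ltr_pdivrMr// mulrC -ltr_pdivrMr// truncnS_gt.
have approx (x : R) : exists q : rat, `|x - ratr q| < k.+1%:R^-1.
  have : x - k.+1%:R^-1 < x + k.+1%:R^-1 by rewrite ltrBlDr -addrA ltrDl addr_gt0.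
  move=> /rat_in_itvoo[q]; rewrite in_itv /= => /andP[q1 q2]; exists q.
  by rewrite ltr_distlC q1.
have /choice[q0 hq0] := approx.
pose q j := (q0 (complex.Re (z ord0 j)), q0 (complex.Im (z ord0 j))).
have hq j : `|complex.Re (z ord0 j) - ratr (q j).1| < k.+1%:R^-1 /\
    `|complex.Im (z ord0 j) - ratr (q j).2| < k.+1%:R^-1 by split; exact: hq0.
exists (\row_j q j, k); split=> [j|zeta hz].
  by rewrite !mxE /=; exact: hq.
apply: h => j; have [h1 h2] := hq j; have := hz j; rewrite !mxE /= => -[h3 h4].
apply: le_lt_trans (normc_le_ReIm _) _; apply: le_lt_trans kr.
move: h1 h2 h3 h4; rewrite /q; case: (zeta ord0 j) => a b; case: (z ord0 j) => a' b' /=.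
move: (ratr (q0 a')) (ratr (q0 b')) => u v h1 h2 h3 h4.
have e1 : `|a - a'| <= k.+1%:R^-1 + k.+1%:R^-1.
  rewrite (_ : a - a' = (a - u) + (u - a')); last by ring.
  by apply: (le_trans (ler_normD _ _)); rewrite lerD ?(ltW h3)// distrC ltW.
have e2 : `|b - b'| <= k.+1%:R^-1 + k.+1%:R^-1.
  rewrite (_ : b - b' = (b - v) + (v - b')); last by ring.
  by apply: (le_trans (ler_normD _ _)); rewrite lerD ?(ltW h4)// distrC ltW.
by apply: (le_trans (lerD e1 e2)); rewrite -addrA.
Qed.

(** Every open set is a countable union of rational cubes. *)
Lemma open_measurable_rV (U : set 'rV[C]_d) : open U -> measurable U.
Proof.
move=> oU; rewrite (_ : U = \bigcup_(p : 'rV[rat * rat]_d * nat)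
    (if `[< rational_cube p `<=` U >] then rational_cube p else set0)).
  apply: countable_bigcupT_measurable => [|p]; first exact: countableP.
  case: ifP => // _.
  exact: measurable_rational_cube.
apply/seteqP; split=> [z Uz|z [p _]].
  have [p [zp pU]] := rational_cube_small oU Uz.
  by exists p => //; rewrite ifT//; apply/asboolP.
by case: asboolP => // pU; exact: pU.
Qed.

End complex_topology.

Section Phi_theory.
Context {R : realType} {d : nat}.
Local Notation C := R[i].
Local Notation normc := (@Normc.normc R).
Variables (P : set 'rV[R]_d) (f : 'rV[R]_d -> R).
Hypothesis P_orthant : P `<=` orthant.
Hypothesis P_body : convex_body P.
Hypothesis P0 : P 0.
Hypothesis f_gt0 : forall t, P t -> 0 < f t.
Hypothesis f_cont : {within P, continuous f}.

(** Near z the strict inequalities persist, and the support function is monotone. *)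
Lemma Phi_le (z : 'rV[C]_d) (Z : 'I_d -> R) : (forall j, normc (z ord0 j) < Z j) ->
  (Phi P f z <= (support P f (log_vec Z))%:E)%E.
Proof.
move=> zZ.
pose V := [set zeta : 'rV[C]_d | torus zeta /\ forall j, normc (zeta ord0 j) < Z j].
have [r r0 hr] : exists2 r : R, 0 < r & forall j, r <= Z j - normc (z ord0 j).
  exists (\big[Num.min/1]_j (Z j - normc (z ord0 j))).
    by elim/big_ind: _ => // [x y x0 y0|j _]; rewrite ?lt_min ?x0 ?subr_gt0 ?zZ.
  by move=> j; rewrite (bigD1 j)//= ge_min lexx.
have nV : within torus (nbhs z) V.
  apply/nbhs_rVP; exists r => // zeta hz tz; split=> // j.
  rewrite -(subrK (z ord0 j) (zeta ord0 j)); apply: le_lt_trans (normcD_le _ _) _.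
  by have := hz j; have := hr j => ? ?; lra.
apply: (@le_trans _ _ (ereal_sup [set weighted_support P f (Log zeta) | zeta in V])).
  by apply: ereal_inf_lbound; exists V.
apply: ge_ereal_sup => _ [zeta [tz hz] <-].
rewrite weighted_supportE// lee_fin; apply: support_mono => // j.
by rewrite !mxE ler_ln ?posrE ?normc_gt0 ?tz ?(ltW (hz j))// (le_lt_trans (normc_ge0 _) (hz j)).
Qed.

Lemma Phi_ge_torus (z : 'rV[C]_d) : torus z ->
  ((support P f (Log z))%:E <= Phi P f z)%E.
Proof.
move=> tz; apply: le_ereal_inf_tmp => _ [V nV <-].
have Vz : V z by exact: (nbhs_singleton nV).
by rewrite -weighted_supportE//; apply: ereal_sup_ubound; exists z.
Qed.

(** Test the weight at t = 0, at points of the torus arbitrarily close to z. This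
    keeps Phi bounded below at the points of the coordinate hyperplanes. *)
Lemma Phi_ge (z : 'rV[C]_d) : ((ln (f 0))%:E <= Phi P f z)%E.
Proof.
apply: le_ereal_inf_tmp => _ [V /nbhs_rVP[r r0 hr] <-].
pose zeta : 'rV[C]_d := \row_j (if z ord0 j == 0 then (r / 2)%:C else z ord0 j).
have tz : torus zeta.
  move=> j; rewrite mxE; case: ifPn => // _.
  by rewrite -normc_gt0 normc_real normr_gt0 gt_eqF// divr_gt0.
have Vz : V zeta.
  apply: hr => // j; rewrite mxE; case: eqP => [->|_]; last by rewrite subrr Normc.normc0.
  by rewrite subr0 normc_real gtr0_norm ?divr_gt0//; lra.
apply: (@le_trans _ _ (weighted_support P f (Log zeta))).
  by rewrite weighted_supportE// lee_fin support_ge_ln0.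
by apply: ereal_sup_ubound; exists zeta.
Qed.

Lemma Phi_fin_num (z : 'rV[C]_d) : Phi P f z \is a fin_num.
Proof.
rewrite fin_real//; apply/andP; split; first exact: lt_le_trans (ltNyr _) (Phi_ge z).
apply: le_lt_trans (@Phi_le z (fun j => normc (z ord0 j) + 1) _) (ltry _) => j.
by rewrite ltrDl.
Qed.

(** An upper limit is upper semicontinuous. *)
Lemma Phi_open_lt (a : \bar R) : open [set z : 'rV[C]_d | (Phi P f z < a)%E].
Proof.
rewrite openE => z /= /ereal_inf_lt[_ [V nV <-] ha].
apply: filterS (nbhs_interior nV) => z' nz' /=; apply: le_lt_trans ha.
by apply: ereal_inf_lbound; exists V.
Qed.

Lemma measurable_Phi : measurable_fun setT (Phi P f : 'rV[C]_d -> \bar R).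
Proof.
apply: (measurability _ (ErealGenCInfty.measurableE R)).
move=> /= _ [_ [a ->]] <-; rewrite setTI.
rewrite (_ : _ @^-1` _ = ~` [set z | (Phi P f z < a%:E)%E]).
  by apply: measurableC; apply: open_measurable_rV; exact: Phi_open_lt.
by apply/seteqP; split=> z /=; rewrite in_itv /= andbT leNgt => /negP.
Qed.

End Phi_theory.

(** * The local L^1 estimate *)

Section local_estimate.
Context {R : realType} {d : nat}.
Local Notation C := R[i].
Local Notation normc := (@Normc.normc R).
Local Notation vol := (@lebesgue_Cd R d).
Variables (P : set 'rV[R]_d) (f : 'rV[R]_d -> R).
Hypothesis P_orthant : P `<=` orthant.
Hypothesis P_body : convex_body P.
Hypothesis P0 : P 0.
Hypothesis f_gt0 : forall t, P t -> 0 < f t.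
Hypothesis f_cont : {within P, continuous f}.
Variable T : R.
Hypothesis PT : forall (t : 'rV[R]_d) j, P t -> 0 <= t ord0 j <= T.

Local Notation area := (@lebesgue_complex R).

(** Bounds |z_j| on the polydisc of centre w' and radii 2 rho, where w' is within
    rho of w. *)
Definition outer (w : 'rV[C]_d) (rho : 'I_d -> R) (j : 'I_d) : R :=
  normc (w ord0 j) + 3%:R * rho j.

(** The volume of the product of squares of sides 4 rho_j that contain the discs of
    radii 2 rho_j. *)
Definition box_volume (rho : 'I_d -> R) : R := \prod_j (16%:R * rho j ^+ 2).

Lemma volume_polydisc_le (w : 'rV[C]_d) (rho : 'I_d -> R) :
  (vol (polydisc w (fun j => 2%:R * rho j)%R) <= (box_volume rho)%:E)%E.
Proof.
have -> : vol (polydisc w (fun j => 2%:R * rho j)%R) =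
    (\prod_j area (disc (w ord0 j) (2%:R * rho j)%R))%E by exact: volume_polydisc.
have e j : (area (disc (w ord0 j) (2%:R * rho j)%R) =
    (fine (area (disc (w ord0 j) (2%:R * rho j)%R)))%:E)%E.
  by rewrite fineK//; exact: area_disc_fin.
under eq_bigr do rewrite e.
rewrite prodEFin lee_fin; apply: ler_prod => j _.
apply/andP; split; first exact: fine_ge0.
rewrite -lee_fin -e; apply: le_trans (area_disc_le _ _) _.
by rewrite lee_fin le_eqVlt; apply/orP; left; apply/eqP; ring.
Qed.

Lemma normalized_log_neq0 n (p : 'rV[C]_d -> C) z' z : p z' != 0 ->
  normalized_log n p z = (n%:R^-1%:E * log_modulus (p z))%E.
Proof.
by move=> pz; rewrite /normalized_log ifF//; apply/asboolP => h; move: pz; rewrite h eqxx.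
Qed.

Variables (n : nat) (x c : 'rV[nat]_d -> C) (e : R).
Hypothesis n0 : (0 < n)%N.
Hypothesis e0 : 0 < e.
Hypothesis hc : coef_bounds P f n c e.
Hypothesis hx : forall a, a \in lattice P n -> normc (x a) <= expR (n%:R * e).
Hypothesis hA : (#|` lattice P n|)%:R <= expR (n%:R * e).

Local Notation p := (P_polynomial P n x c : 'rV[C]_d -> C).

Lemma P_polynomial_upper_log (Z : 'I_d -> R) (z : 'rV[C]_d) :
  (forall j, 0 < Z j) -> (forall j, normc (z ord0 j) <= Z j) ->
  (log_modulus (p z) <= (n%:R * (support P f (log_vec Z) + 3%:R * e))%:E)%E.
Proof.
move=> Z0 zZ; apply: log_modulus_le.
exact: (P_polynomial_upper P_orthant P_body P0 f_gt0 f_cont PT n0 hc hx hA Z0 zZ).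
Qed.

Variables (w : 'rV[C]_d) (rho : 'I_d -> R) (w' : 'rV[C]_d).
Hypothesis w0 : torus w.
Hypothesis rho0 : forall j, 0 < rho j.
Hypothesis ww' : forall j, normc (w' ord0 j - w ord0 j) <= rho j.
Hypothesis pw' : expR (n%:R * (support P f (Log w) - e)) < normc (p w').

Let A := support P f (log_vec (outer w rho)) + 3%:R * e.

Let outer_gt0 j : 0 < outer w rho j.
Proof. by rewrite /outer ltr_wpDl ?normc_ge0// mulr_gt0. Qed.

Let pw'0 : p w' != 0.
Proof. by rewrite -normc_gt0 (lt_trans _ pw')// expR_gt0. Qed.

Let support_outer_ge : support P f (Log w) <= support P f (log_vec (outer w rho)).
Proof.
apply: support_mono => // j; rewrite !mxE ler_ln ?posrE ?normc_gt0 ?(w0 j) ?outer_gt0//.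
by rewrite /outer lerDl mulr_ge0// ltW.
Qed.

Lemma near_upper z : polydisc w' (fun j => 2%:R * rho j)%R z ->
  (log_modulus (p z) <= (n%:R * A)%:E)%E.
Proof.
move=> hz; apply: P_polynomial_upper_log => // j.
rewrite (_ : z ord0 j = (z ord0 j - w' ord0 j) + ((w' ord0 j - w ord0 j) + w ord0 j)); last by ring.
apply: le_trans (normcD_le _ _) _; apply: le_trans (lerD (ltW (hz j)) (normcD_le _ _)) _.
by have := ww' j; rewrite /outer => ?; lra.
Qed.

(** The good point w' is only known to be within rho of w, so the mean value
    inequality is used on a polydisc of twice the radii. *)
Lemma polydisc_sub_recentred : polydisc w rho `<=` polydisc w' (fun j => 2%:R * rho j)%R.
Proof.
move=> z hz j; rewrite /disc /=.
rewrite (_ : z ord0 j - w' ord0 j = (z ord0 j - w ord0 j) + (w ord0 j - w' ord0 j)); last by ring.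
apply: le_lt_trans (normcD_le _ _) _; have := ww' j; have /= := hz j.
by rewrite /disc /= normcB (normcB (w ord0 j)) => ? ?; lra.
Qed.

(** The sub-mean value inequality at w': the mean deficit A - u_n is at most the
    deficit A - u_n(w'), and u_n(w') > I(Log w) - e. *)
Lemma local_deficit :
  (\int[vol]_(z in polydisc w rho) (A%:E - normalized_log n p z) <=
   ((A - support P f (Log w) + e) * box_volume rho)%:E)%E.
Proof.
pose D := polydisc w' (fun j => 2%:R * rho j)%R.
have mD : measurable D by exact: measurable_polydisc.
have nR : 0 < n%:R :> R by rewrite ltr0n.
have nV : 0 < (n%:R^-1 : R) by rewrite invr_gt0.
have mp : measurable_fun setT p by exact: (measurable_P_polynomial PT).
have mg : measurable_fun setT (fun z => (n%:R * A)%:E - log_modulus (p z))%E.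
  by apply: emeasurable_funB; [exact: measurable_cst|exact: measurable_log_modulus].
have g0 z : D z -> (0 <= (n%:R * A)%:E - log_modulus (p z))%E.
  by move=> Dz; rewrite sube_ge0 ?orbT// near_upper.
have eqg z : (A%:E - normalized_log n p z = n%:R^-1%:E * ((n%:R * A)%:E - log_modulus (p z)))%E.
  rewrite (normalized_log_neq0 _ _ pw'0).
  have := log_modulus_neqy (p z); case: (log_modulus (p z)) => [l| |]//= _.
    by rewrite -!(EFinM,EFinB); congr EFin; field; exact: lt0r_neq0.
  by rewrite gt0_muleNy ?lte_fin// gt0_muley ?lte_fin.
under eq_integral do rewrite eqg.
apply: (@le_trans _ _ (\int[vol]_(z in D) (n%:R^-1%:E * ((n%:R * A)%:E - log_modulus (p z))))%E).
  apply: ge0_subset_integral => //.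
  - exact: measurable_polydisc.
  - apply: emeasurable_funM; first exact: measurable_cst.
    exact: measurable_funTS.
  - by move=> z Dz; rewrite mule_ge0 ?lee_fin ?(ltW nV)// g0.
  - exact: polydisc_sub_recentred.
rewrite ge0_integralZl//; last exact: measurable_funTS.
have h1 : (\int[vol]_(z in D) ((n%:R * A)%:E - log_modulus (p z)) <=
   ((n%:R * A)%:E - log_modulus (p w')) * vol D)%E.
  apply: polydisc_log_mean => //.
  - exact: (P_polynomial_separately PT).
  - by move=> j; rewrite mulr_gt0.
  - exact: near_upper.
have h2 : ((n%:R * A)%:E - log_modulus (p w') <= (n%:R * (A - support P f (Log w) + e))%:E)%E.
  rewrite log_modulusE// -EFinB lee_fin.
  have : n%:R * (support P f (Log w) - e) <= ln (normc (p w')).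
    by rewrite -[leLHS]expRK ler_ln ?posrE ?expR_gt0 ?normc_gt0// ltW.
  by rewrite !mulrDr !mulrN; lra.
have As0 : 0 <= A - support P f (Log w) + e.
  by have := support_outer_ge; rewrite /A => ?; have := e0 => ?; lra.
have h3 : (vol D <= (box_volume rho)%:E)%E by exact: volume_polydisc_le.
apply: (@le_trans _ _ (n%:R^-1%:E * ((n%:R * (A - support P f (Log w) + e))%:E * (box_volume rho)%:E))%E).
  rewrite lee_wpmul2l ?lee_fin ?(ltW nV)//; apply: (le_trans h1).
  apply: lee_pmul => //.
  by rewrite g0// => j; rewrite /disc /= subrr Normc.normc0 mulr_gt0.
by rewrite -!EFinM lee_fin !mulrA mulVf ?mul1r// lt0r_neq0.
Qed.

(** By |u - Phi| <= (A - u) + (A - Phi) with u and Phi both below A; the first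
    term is the deficit and the second one is at most osc + 3 e. *)
Lemma local_L1 (osc : R) :
  support P f (log_vec (outer w rho)) - support P f (Log w) <= osc ->
  (forall z, polydisc w rho z -> ((support P f (log_vec (outer w rho)) - osc)%:E <= Phi P f z)%E) ->
  (\int[vol]_(z in polydisc w rho) `|normalized_log n p z - Phi P f z| <=
   ((2%:R * osc + 7%:R * e) * box_volume rho)%:E)%E.
Proof.
move=> osc1 osc2.
have mD : measurable (polydisc w rho) by exact: measurable_polydisc.
have nR : 0 < n%:R :> R by rewrite ltr0n.
have nV : 0 < (n%:R^-1 : R) by rewrite invr_gt0.
have mp : measurable_fun setT p by exact: (measurable_P_polynomial PT).
have ue : normalized_log n p = fun z => (n%:R^-1%:E * log_modulus (p z))%E.
  by apply/funext => z; exact: normalized_log_neq0 pw'0.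
have mu : measurable_fun setT (normalized_log n p).
  by rewrite ue; apply: emeasurable_funM; [exact: measurable_cst|exact: measurable_log_modulus].
have mPhi : measurable_fun setT (Phi P f : 'rV[C]_d -> \bar R) by exact: measurable_Phi.
have uA z : polydisc w rho z -> (normalized_log n p z <= A%:E)%E.
  move=> /polydisc_sub_recentred/near_upper h; rewrite ue /=.
  have -> : A%:E = (n%:R^-1%:E * (n%:R * A)%:E)%E.
    by rewrite -EFinM mulKf// lt0r_neq0.
  by rewrite lee_wpmul2l ?lee_fin ?(ltW nV).
have PhiA z : polydisc w rho z -> (Phi P f z <= (support P f (log_vec (outer w rho)))%:E)%E.
  move=> hz; apply: Phi_le => // j; rewrite -(subrK (w ord0 j) (z ord0 j)).
  apply: le_lt_trans (normcD_le _ _) _; have /= := hz j.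
  by rewrite /disc /outer /= => ?; have := rho0 j => ?; lra.
have osc0 : 0 <= osc by apply: le_trans osc1; rewrite subr_ge0.
have mAu : measurable_fun (polydisc w rho) (fun z => A%:E - normalized_log n p z)%E.
  by apply: measurable_funTS; apply: emeasurable_funB => //; exact: measurable_cst.
apply: (@le_trans _ _ (\int[vol]_(z in polydisc w rho)
   ((A%:E - normalized_log n p z) + cst (osc + 3%:R * e)%:E z))%E).
  apply: ge0_le_integral => //.
  - apply: measurable_funTS; apply: measurableT_comp => //; exact: emeasurable_funB.
  - by apply: emeasurable_funD => //; exact: measurable_cst.
  - move=> z hz; have := uA z hz; have := PhiA z hz; have := osc2 z hz.
    have := Phi_fin_num P_orthant P_body P0 f_gt0 f_cont z.
    case: (Phi P f z) => [phi| |]// _; rewrite !lee_fin => h1 h2.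
    case: (normalized_log n p z) => [u| |]//=.
    rewrite !lee_fin => h3; have := e0 => e0'.
    by rewrite /A in h3 *; rewrite ler_norml; apply/andP; split; lra.
rewrite ge0_integralD//; last 2 first.
- by move=> z hz; rewrite sube_ge0 ?orbT// uA.
- by move=> z hz; rewrite lee_fin addr_ge0// mulr_ge0// ltW.
rewrite integral_cst//.
have h3 : (vol (polydisc w rho) <= (box_volume rho)%:E)%E.
  apply: le_trans (volume_polydisc_le w' rho); apply: le_measure; rewrite ?inE//.
    exact: measurable_polydisc.
  exact: polydisc_sub_recentred.
have bv0 : 0 <= box_volume rho.
  by apply: prodr_ge0 => j _; rewrite mulr_ge0// sqr_ge0.
apply: (@le_trans _ _ (((osc + 4%:R * e) * box_volume rho)%:E + (osc + 3%:R * e)%:E * (box_volume rho)%:E)%E).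
  apply: leeD.
    apply: le_trans local_deficit _; rewrite lee_fin ler_wpM2r// /A.
    by lra.
  by rewrite lee_wpmul2l// lee_fin addr_ge0// mulr_ge0// ltW.
by rewrite -EFinM -EFinD lee_fin le_eqVlt; apply/orP; left; apply/eqP; ring.
Qed.

End local_estimate.

(** * Covering a ball by polydiscs of small total oscillation *)

Section covering.
Context {R : realType} {d : nat}.
Local Notation C := R[i].
Local Notation normc := (@Normc.normc R).
Variables (P : set 'rV[R]_d) (f : 'rV[R]_d -> R).
Hypothesis P_orthant : P `<=` orthant.
Hypothesis P_body : convex_body P.
Hypothesis P0 : P 0.
Hypothesis f_gt0 : forall t, P t -> 0 < f t.
Hypothesis f_cont : {within P, continuous f}.
Variable T : R.
Hypothesis T0 : 0 < T.
Hypothesis PT : forall (t : 'rV[R]_d) j, P t -> 0 <= t ord0 j <= T.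

(** A polydisc (centre and radii) together with a bound for the oscillation of Phi
    on it. *)
Definition piece : Type := ('rV[C]_d * 'rV[R]_d * R)%type.
Definition centre (p : piece) : 'rV[C]_d := p.1.1.
Definition radii (p : piece) : 'I_d -> R := fun j => p.1.2 ord0 j.
Definition oscillation (p : piece) : R := p.2.

(** The two bounds are those required by the local estimate: near the coordinate
    hyperplanes the lower bound of Phi cannot be deduced from its value at the
    centre. *)
Definition good_piece (p : piece) : Prop :=
  [/\ torus (centre p), forall j, 0 < radii p j,
      support P f (log_vec (outer (centre p) (radii p))) - support P f (Log (centre p))
        <= oscillation p
    & forall z, polydisc (centre p) (radii p) z ->
      ((support P f (log_vec (outer (centre p) (radii p))) - oscillation p)%:E <= Phi P f z)%E].

Lemma ln_add_le (a b : R) : 0 < a -> 0 <= b -> ln (a + b) <= ln a + b / a.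
Proof.
move=> a0 b0; have -> : a + b = a * (1 + b / a) by field; exact: lt0r_neq0.
have ba : 0 <= b / a by rewrite divr_ge0// ltW.
rewrite lnM ?posrE ?ltr_wpDr// lerD2l; apply: le_ln1Dx.
by apply: lt_le_trans ba; rewrite ltrN10.
Qed.

Lemma euclidean_cball_coord (r : R) (z : 'rV[C]_d) j :
  euclidean_cball r z -> normc (z ord0 j) <= r.
Proof.
apply: le_trans; rewrite /euclidean_norm -[leLHS]ger0_norm ?normc_ge0// -sqrtr_sqr.
rewrite ler_wsqrtr// (bigD1 j)//= lerDl; apply: sumr_ge0 => i _; exact: sqr_ge0.
Qed.

Section slab.
Variables (M kappa : R).
Hypothesis M0 : 0 < M.
Hypothesis kappa0 : 0 < kappa.
Hypothesis kappa1 : kappa <= 1.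

(** A bound for the oscillation of Phi on all the slabs, independent of their
    width kappa. *)
Definition slab_osc : R := support P f (log_vec (fun=> 3%:R * M + 7%:R)) - ln (f 0).

(** Contains the points of the ball with |z_j| < kappa. The j-th centre is kappa
    rather than 0, since the centre must lie in the torus. *)
Definition slab (j : 'I_d) : piece :=
  (\row_i (if i == j then kappa%:C else 1), \row_i (if i == j then 2%:R * kappa else M + 2%:R),
   slab_osc).

Lemma slab_osc_ge0 : 0 <= slab_osc.
Proof. by rewrite subr_ge0 support_ge_ln0. Qed.

Lemma slab_good j : good_piece (slab j).
Proof.
have outle : support P f (log_vec (outer (centre (slab j)) (radii (slab j)))) <=
    support P f (log_vec (fun=> 3%:R * M + 7%:R)).
  apply: support_mono => // i; rewrite !mxE /outer /centre /radii /= !mxE.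
  have := M0; have := kappa0; have := kappa1 => k1 k0 m0.
  case: eqP => _.
    rewrite normc_real gtr0_norm// ler_ln ?posrE; lra.
  by rewrite Normc.normc1 ler_ln ?posrE; lra.
split.
- move=> i; rewrite mxE; case: (i =P j) => _; last exact: oner_neq0.
  by rewrite -normc_gt0 normc_real normr_gt0 gt_eqF.
- by move=> i; rewrite /radii mxE; case: eqP => _; rewrite ?mulr_gt0 ?addr_gt0.
- by rewrite /oscillation /slab_osc /=; apply: lerB => //; exact: support_ge_ln0.
- move=> z _; apply: le_trans (Phi_ge P_orthant P_body P0 f_gt0 f_cont z).
  by rewrite lee_fin lerBlDr (_ : oscillation _ = slab_osc)// addrC subrK.
Qed.

Lemma slab_cover (z : 'rV[C]_d) j : (forall i, normc (z ord0 i) <= M) ->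
  normc (z ord0 j) < kappa -> polydisc (centre (slab j)) (radii (slab j)) z.
Proof.
move=> zM zj i; rewrite /disc /centre /radii /= !mxE.
apply: (@le_lt_trans _ _ (normc (z ord0 i) + normc (if i == j then kappa%:C else 1))).
  by apply: le_trans (normcD_le _ _) _; rewrite lerD2l normcN.
case: eqP => [->|_]; first by rewrite normc_real gtr0_norm//; lra.
by rewrite Normc.normc1; have := zM i => ?; lra.
Qed.

Lemma slab_volume j : box_volume (radii (slab j)) =
  64%:R * kappa ^+ 2 * \prod_(i < d | i != j) (16%:R * (M + 2%:R) ^+ 2).
Proof.
rewrite /box_volume /radii (bigD1 j)//= mxE eqxx; congr (_ * _); first by ring.
by apply: eq_bigr => i ij; rewrite mxE (negbTE ij).
Qed.

End slab.

Section grid.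
Variables (M kappa : R) (N : nat).
Hypothesis M0 : 0 < M.
Hypothesis kappa0 : 0 < kappa.
Hypothesis N0 : (0 < N)%N.
Local Notation h := (M / N%:R).
Hypothesis hk : h <= kappa / 16%:R.

(** The centre of the a-th of the N intervals of length 2 h that divide [-M, M]. *)
Definition grid_coord (a : 'I_N) : R := - M + (2%:R * (a : nat)%:R + 1) * h.

Definition grid_centre (s : {ffun 'I_d -> 'I_N * 'I_N}) : 'rV[C]_d :=
  \row_j (grid_coord (s j).1 +i* grid_coord (s j).2).

(** On the cells retained below, |z_j| >= kappa/4 while the bound for |z_j| on the
    enlarged cell exceeds |z_j| by at most 12 h; so the logarithms differ by at
    most 48 h / kappa. *)
Definition cell_osc : R := 48%:R * h / kappa * (d%:R * T).

Definition cell (s : {ffun 'I_d -> 'I_N * 'I_N}) : piece :=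
  (grid_centre s, \row_j (3%:R * h), cell_osc).

Let h0 : 0 < h.
Proof. by rewrite divr_gt0// ltr0n. Qed.

Lemma grid_coord_near (x : R) : `|x| <= M -> exists a : 'I_N, `|x - grid_coord a| <= h.
Proof.
rewrite ler_norml => /andP[x1 x2].
have NR : 0 < N%:R :> R by rewrite ltr0n.
have hN : h * N%:R = M by rewrite divfK// gt_eqF.
pose y := (x + M) / (2%:R * h); have h20 : 0 < 2%:R * h by rewrite mulr_gt0.
have yE : y * (2%:R * h) = x + M by rewrite divfK// gt_eqF.
have y0 : 0 <= y by rewrite divr_ge0// ?(ltW h20)//; lra.
have [yN|Ny] := ltnP (Num.truncn y) N.
  exists (Ordinal yN); rewrite /grid_coord /=; have := truncn_itv y0.
  move: (Num.truncn y) => u; rewrite -natr1 => /andP[u1 u2].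
  have v1 : u%:R * (2%:R * h) <= x + M by rewrite -yE ler_wpM2r// ltW.
  have v2 : x + M <= (u%:R + 1) * (2%:R * h) by rewrite -yE ler_wpM2r// ltW.
  rewrite ler_norml; move: v1 v2; set t := h => v1 v2; apply/andP; split; lra.
have N1 : (N.-1 < N)%N by rewrite prednK.
(* The right end of [-M, M] belongs to the last interval. *)
exists (Ordinal N1); rewrite /grid_coord /=.
have yN : N%:R <= y by rewrite -truncn_ge_nat.
have v1 : N%:R * (2%:R * h) <= x + M by rewrite -yE ler_wpM2r// ltW.
have NE : N%:R = N.-1%:R + 1 :> R by rewrite natr1 prednK.
have e1 : (2%:R * N.-1%:R + 1) * h = 2%:R * M - h.
  have aux t : M = t * (N.-1%:R + 1) -> (2%:R * N.-1%:R + 1) * t = 2%:R * M - t by move=> ->; ring.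
  by apply: aux; rewrite -NE.
rewrite e1; have e2 : N%:R * (2%:R * h) = 2%:R * M by rewrite mulrCA [N%:R * _]mulrC hN.
rewrite ler_norml; rewrite e2 in v1; move: h0; set t := h => t0; apply/andP; split; lra.
Qed.

Lemma radii_cell s j : radii (cell s) j = 3%:R * h.
Proof. by rewrite /radii mxE. Qed.

Lemma cell_good s : (forall j, kappa / 2 <= normc (grid_centre s ord0 j)) ->
  good_piece (cell s).
Proof.
move=> hs; have k20 : 0 < kappa / 2 by rewrite divr_gt0.
have w0 j : 0 < normc (grid_centre s ord0 j) by exact: lt_le_trans (hs j).
have hk' := hk; have h0' := h0; have kp := kappa0.
have eta0 : 0 <= 48%:R * h / kappa by rewrite divr_ge0 ?mulr_ge0// ltW.
have key (z : 'rV[C]_d) : (forall j, kappa / 4 <= normc (z ord0 j)) ->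
    (forall j, outer (centre (cell s)) (radii (cell s)) j <= normc (z ord0 j) + 12%:R * h) ->
    support P f (log_vec (outer (centre (cell s)) (radii (cell s)))) <= support P f (Log z) + cell_osc.
  move=> zk zo; apply: support_shift => // j; rewrite !mxE.
  have k40 : 0 < kappa / 4 by rewrite divr_gt0.
  have z0 : 0 < normc (z ord0 j) by exact: lt_le_trans (zk j).
  have h12 : 0 <= 12%:R * h by rewrite mulr_ge0// ltW.
  apply: (@le_trans _ _ (ln (normc (z ord0 j) + 12%:R * h))).
    rewrite ler_ln ?posrE; [exact: zo| |exact: ltr_wpDr].
    by apply: ltr_wpDl; rewrite ?normc_ge0// mulr_gt0// radii_cell mulr_gt0.
  apply: le_trans (ln_add_le z0 h12) _; rewrite lerD2l.
  rewrite ler_pdivrMr//; apply: le_trans (_ : 48%:R * h / kappa * (kappa / 4) <= _).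
    rewrite le_eqVlt; apply/orP; left; apply/eqP; field.
    by rewrite gt_eqF//= pnatr_eq0 -lt0n.
  by rewrite ler_wpM2l.
split.
- by move=> j; rewrite -normc_gt0; exact: w0.
- by move=> j; rewrite radii_cell mulr_gt0.
- rewrite lerBlDl addrC; have := key (centre (cell s)); rewrite [X in _ <= X]addrC.
  apply=> j.
    by apply: le_trans (hs j); lra.
  by rewrite /outer radii_cell lerD2l mulrA ler_wpM2r ?(ltW h0')// -natrM ler_nat.
- move=> z hz; have zk j : normc (grid_centre s ord0 j) <= normc (z ord0 j) + 3%:R * h.
    have := hz j; rewrite /disc /= radii_cell normcB => hzj.
    rewrite -lerBlDl; apply: le_trans (normcB_ge _ _) (ltW hzj).
  have zk4 j : kappa / 4 <= normc (z ord0 j).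
    have := zk j; have := hs j; move: hk' h0'; move: (M / N%:R) => t ? ? ? ?; lra.
  have tz : torus z.
    by move=> j; rewrite -normc_gt0; apply: lt_le_trans (zk4 j); rewrite divr_gt0.
  apply: le_trans (Phi_ge_torus P_orthant P_body P0 f_gt0 f_cont tz).
  rewrite lee_fin lerBlDr; apply: key => // j.
  rewrite /outer radii_cell; have := zk j; rewrite [centre _]/(grid_centre s).
  by move: h0'; move: (_ / N%:R) => t ? ?; lra.
Qed.

Lemma cell_cover (z : 'rV[C]_d) : (forall j, kappa <= normc (z ord0 j) <= M) ->
  exists s, (forall j, kappa / 2 <= normc (grid_centre s ord0 j)) /\
    polydisc (centre (cell s)) (radii (cell s)) z.
Proof.
move=> hz.
have hR j : `|complex.Re (z ord0 j)| <= M.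
  have /andP[_] := hz j; apply: le_trans; case: (z ord0 j) => a b /=.
  by rewrite -sqrtr_sqr ler_wsqrtr// lerDl sqr_ge0.
have hI j : `|complex.Im (z ord0 j)| <= M.
  have /andP[_] := hz j; apply: le_trans; case: (z ord0 j) => a b /=.
  by rewrite -sqrtr_sqr ler_wsqrtr// lerDr sqr_ge0.
have /choice[a ha] := fun j => grid_coord_near (hR j).
have /choice[b hb] := fun j => grid_coord_near (hI j).
pose s := [ffun j => (a j, b j)].
have near j : normc (z ord0 j - grid_centre s ord0 j) <= 2%:R * h.
  apply: le_trans (normc_le_ReIm _) _; rewrite !mxE !ffunE /=.
  have := lerD (ha j) (hb j); case: (z ord0 j) => u v /= hh.
  by apply: (le_trans hh); rewrite [leRHS]mulr_natl mulr2n.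
have hk' := hk; have h0' := h0.
exists s; split=> j.
  have := normcB_ge (z ord0 j) (z ord0 j - grid_centre s ord0 j).
  rewrite (_ : _ - (_ - _) = grid_centre s ord0 j); last by ring.
  have := near j; have /andP[+ _] := hz j; move: hk' h0'; move: (M / N%:R) => t ? ? ? ? ?; lra.
rewrite /disc /= radii_cell; apply: le_lt_trans (near j) _.
by rewrite ltr_pM2r// ltr_nat.
Qed.

Lemma cell_volume s : box_volume (radii (cell s)) = (144%:R * h ^+ 2) ^+ d.
Proof.
rewrite /box_volume; under eq_bigr do rewrite radii_cell.
by rewrite prodr_const card_ord; congr (_ ^+ _); ring.
Qed.

(** The total volume does not depend on N, whereas the oscillation of the cells is
    of order 1/N. *)
Lemma cell_total_volume :
  \sum_(s : {ffun 'I_d -> 'I_N * 'I_N}) box_volume (radii (cell s)) = (144%:R * M ^+ 2) ^+ d.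
Proof.
under eq_bigr do rewrite cell_volume.
rewrite sumr_const card_ffun card_prod !card_ord -[_ *+ _]mulr_natl natrX -exprMn.
congr (_ ^+ _); rewrite natrM; field.
by rewrite pnatr_eq0 -lt0n.
Qed.

End grid.

(** First choose the width kappa of the slabs, whose volume is of order kappa^2
    and whose oscillation is bounded; then the mesh of the grid in terms of
    kappa. Cells with centre too close to a hyperplane are discarded: a point with
    all |z_j| >= kappa lies in a retained cell, any other one in a slab. *)
Lemma exists_pieces (M eta : R) : 0 < M -> 0 < eta ->
  exists s : seq piece, [/\ forall p, p \in s -> good_piece p,
    forall z, euclidean_cball M z -> exists2 p, p \in s & polydisc (centre p) (radii p) z
  & \sum_(p <- s) oscillation p * box_volume (radii p) <= eta].
Proof.
move=> M0 eta0.
pose V := \sum_(j < d) \prod_(i < d | i != j) (16%:R * (M + 2%:R) ^+ 2) : R.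
have V0 : 0 <= V.
  by apply: sumr_ge0 => j _; apply: prodr_ge0 => i _; rewrite mulr_ge0// sqr_ge0.
have K0 := slab_osc_ge0 M; set K := slab_osc M in K0.
(* The slabs contribute 64 kappa^2 K V, which is at most eta / 2. *)
pose kappa := Num.min 1 (eta / 2 / (64%:R * (K + 1) * (V + 1))).
have D0 : 0 < 64%:R * (K + 1) * (V + 1).
  by rewrite !mulr_gt0// ltr_wpDl.
have kappa0 : 0 < kappa by rewrite lt_min ltr01 divr_gt0// divr_gt0.
have kappa1 : kappa <= 1 by rewrite ge_min lexx.
have kappa2 : kappa * (64%:R * (K + 1) * (V + 1)) <= eta / 2.
  by rewrite -ler_pdivlMr// ge_min lexx orbT.
pose B := (144%:R * M ^+ 2) ^+ d.
have B0 : 0 <= B by rewrite exprn_ge0// mulr_ge0// sqr_ge0.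
pose Q := 48%:R * M / kappa * (d%:R * T) * B.
have Q0 : 0 <= Q by rewrite !mulr_ge0// ?invr_ge0 ltW.
(* The first bound makes the mesh fine with respect to kappa; the second one
   makes the contribution Q / N of the cells at most eta / 2. *)
pose N := (maxn (Num.truncn (16%:R * M / kappa)) (Num.truncn (2%:R * Q / eta))).+1.
have N0 : (0 < N)%N by [].
have NR : 0 < N%:R :> R by rewrite ltr0n.
have N1 : 16%:R * M / kappa <= N%:R.
  by rewrite ltW//; apply: lt_le_trans (truncnS_gt _) _; rewrite ler_nat ltnS leq_maxl.
have N2 : 2%:R * Q / eta <= N%:R.
  by rewrite ltW//; apply: lt_le_trans (truncnS_gt _) _; rewrite ler_nat ltnS leq_maxr.
have hk : M / N%:R <= kappa / 16%:R.
  rewrite ler_pdivrMr// mulrAC ler_pdivlMr// [leRHS]mulrC.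
  by rewrite -ler_pdivrMr// [M * _]mulrC.
pose far := [pred s : {ffun 'I_d -> 'I_N * 'I_N} |
  [forall j, kappa / 2 <= normc (grid_centre M s ord0 j)]].
exists ([seq slab M kappa j | j <- index_enum 'I_d] ++
  [seq cell M kappa s | s <- [seq s <- index_enum _ | far s]]).
split.
- move=> p; rewrite mem_cat => /orP[/mapP[j _ ->]|/mapP[s]].
    exact: slab_good.
  by rewrite mem_filter => /andP[/forallP hs _] ->; exact: cell_good.
- move=> z zM; have zM' j : normc (z ord0 j) <= M by exact: euclidean_cball_coord.
  have [[j zj]|/forallNP hz] := pselect (exists j, normc (z ord0 j) < kappa).
    exists (slab M kappa j); last exact: slab_cover.
    by rewrite mem_cat; apply/orP; left; apply/mapP; exists j; rewrite ?mem_index_enum.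
  have [|s [hs hzs]] := @cell_cover M kappa N M0 N0 hk z.
    by move=> j; rewrite zM' andbT leNgt; apply/negP; exact: hz.
  exists (cell M kappa s) => //.
  rewrite mem_cat; apply/orP; right; apply/mapP; exists s => //.
  by rewrite mem_filter mem_index_enum andbT; apply/forallP.
rewrite big_cat /= !big_map [leRHS]splitr; apply: lerD.
  have -> : \sum_(i < d) oscillation (slab M kappa i) * box_volume (radii (slab M kappa i)) =
      kappa ^+ 2 * (64%:R * K * V).
    rewrite /V !mulr_sumr; apply: eq_bigr => j _; rewrite slab_volume /oscillation /= -/K.
    by ring.
  apply: le_trans kappa2; rewrite expr2 -mulrA ler_wpM2l ?(ltW kappa0)//.
  apply: (@le_trans _ _ (1 * (64%:R * K * V))).
    by rewrite ler_wpM2r// !mulr_ge0.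
  by rewrite mul1r; nra.
rewrite big_filter.
apply: (@le_trans _ _ (\sum_(s : {ffun 'I_d -> 'I_N * 'I_N})
   cell_osc M kappa N * box_volume (radii (cell M kappa s)))).
  rewrite [leRHS](bigID far) /= lerDl; apply: sumr_ge0 => s _; rewrite mulr_ge0//.
    by rewrite !mulr_ge0// ?invr_ge0 ?ltW.
  by apply: prodr_ge0 => j _; rewrite mulr_ge0// sqr_ge0.
rewrite -mulr_sumr cell_total_volume// -/B.
have -> : cell_osc M kappa N * B = Q / N%:R.
  by rewrite /cell_osc /Q; field; rewrite !gt_eqF.
rewrite ler_pdivrMr//; move: N2; rewrite ler_pdivrMr// => N2.
by rewrite mulrAC ler_pdivlMr// mulrC [eta * _]mulrC.
Qed.

End covering.

(** * The L^1_loc distance *)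

Lemma measurable_integral_param d1 d2 (T1 : measurableType d1) (T2 : measurableType d2)
    (R : realType) (mu : {sigma_finite_measure set T2 -> \bar R}) (B : set T2)
    (g : T1 * T2 -> \bar R) : measurable B -> measurable_fun setT g ->
  (forall p, (0 <= g p)%E) ->
  measurable_fun setT (fun x => (\int[mu]_(y in B) g (x, y))%E).
Proof.
move=> mB mg g0.
pose h := g \_ ([set: T1] `*` B).
have mh : measurable_fun setT h.
  apply/(measurable_restrictT g (measurableX measurableT mB)).
  exact: measurable_funTS.
have h0 p : (0 <= h p)%E by rewrite /h patchE; case: ifP.
rewrite (_ : (fun x => _) = fubini_F mu h).
  exact: measurable_fun_fubini_tonelli_F.
apply/funext => x; rewrite /fubini_F [LHS]integral_mkcond; apply: eq_integral => y _.
by rewrite /h !patchE in_setX in_setT.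
Qed.

Section L1loc_distance.
Context {R : realType} {d : nat}.
Local Notation C := R[i].
Local Notation vol := (@lebesgue_Cd R d).

Lemma measurable_euclidean_cball (r : R) : measurable (euclidean_cball r : set 'rV[C]_d).
Proof.
rewrite -[X in measurable X]setTI; apply: measurable_fun_ler => //.
apply: (measurableT_comp (f := fun x : measurableTypeR R => Num.sqrt x : measurableTypeR R)).
  by apply: continuous_measurable_fun; exact: sqrt_continuous.
apply: measurable_sum => j; apply: measurable_funX; apply: measurable_normc.
exact: measurable_mx_entry.
Qed.

Lemma L1_dist_le (r r' : R) (u v : 'rV[C]_d -> \bar R) :
  measurable_fun setT u -> measurable_fun setT v -> r <= r' ->
  (L1_dist r u v <= L1_dist r' u v)%E.
Proof.
move=> mu mv rr'; apply: ge0_subset_integral => //.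
- exact: measurable_euclidean_cball.
- exact: measurable_euclidean_cball.
- by apply: measurable_funTS; apply: measurableT_comp => //; exact: emeasurable_funB.
- by move=> z /le_trans; exact.
Qed.

Lemma sum_half (N : nat) : \sum_(1 <= m < N.+1) (2^-1 : R) ^+ m = 1 - 2^-1 ^+ N.
Proof.
elim: N => [|N IH]; first by rewrite big_nil expr0 subrr.
by rewrite big_nat_recr//= IH exprS; field.
Qed.

Lemma sum_half_tail (m0 N : nat) :
  \sum_(1 <= m < N.+1) (if (m0 < m)%N then (2^-1 : R) ^+ m else 0) <= 2^-1 ^+ m0.
Proof.
suff : \sum_(1 <= m < N.+1) (if (m0 < m)%N then (2^-1 : R) ^+ m else 0) <=
    2^-1 ^+ m0 - 2^-1 ^+ (maxn m0 N).
  by move/le_trans; apply; rewrite gerBl exprn_ge0.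
elim: N => [|N IH]; first by rewrite big_nil maxn0 subrr.
rewrite big_nat_recr//=; apply: (le_trans (lerD IH (lexx _))).
have [m0N|Nm0] := ltnP m0 N.+1.
  rewrite (maxn_idPr (m0N : (m0 <= N)%N)) exprS.
  by rewrite le_eqVlt; apply/orP; left; apply/eqP; field.
by rewrite (maxn_idPl (ltnW Nm0)) addr0.
Qed.

(** The terms m <= m0 are at most 2^-m times the distance on the ball of radius
    m0, and the remaining ones are at most 2^-m. *)
Lemma L1loc_dist_le (m0 : nat) (u v : 'rV[C]_d -> \bar R) :
  measurable_fun setT u -> measurable_fun setT v ->
  (L1loc_dist u v <= L1_dist m0%:R u v + (2^-1 ^+ m0)%:E)%E.
Proof.
move=> mu mv; have L0 r : (0 <= L1_dist r u v)%E by exact: integral_ge0.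
have h0 m : (0 <= (2^-1 : R) ^+ m)%R by rewrite exprn_ge0.
have t0 m : (0 <= (2^-1 ^+ m)%:E * mine 1 (L1_dist m%:R u v))%E.
  by rewrite mule_ge0 ?lee_fin// le_min lee01 L0.
apply: lime_le; first exact: is_cvg_nneseries.
apply: nearW => N; case: N => [|N].
  by rewrite big_geq// adde_ge0// lee_fin.
apply: (@le_trans _ _ (\sum_(1 <= m < N.+1) ((2^-1 ^+ m)%:E * L1_dist m0%:R u v +
    (if (m0 < m)%N then 2^-1 ^+ m else 0)%:E))%E).
  apply: lee_sum => m _; case: ltnP => [_|mm0].
    rewrite -[leLHS]add0e; apply: leeD; first by rewrite mule_ge0 ?lee_fin.
    by rewrite -[leRHS]mule1 lee_wpmul2l ?lee_fin// ge_min lexx.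
  rewrite adde0 lee_wpmul2l ?lee_fin// ge_min; apply/orP; right.
  by apply: L1_dist_le => //; rewrite ler_nat.
rewrite big_split /= -ge0_sume_distrl; last by move=> i _; rewrite lee_fin.
apply: leeD; last by rewrite sumEFin lee_fin sum_half_tail.
rewrite -[leRHS]mul1e lee_wpmul2r// sumEFin lee_fin sum_half gerBl//.
Qed.

Lemma measurable_L1loc_dist_gt disp (O : measurableType disp)
    (u : O -> 'rV[C]_d -> \bar R) (v : 'rV[C]_d -> \bar R) (eps : R) :
  measurable_fun setT (fun p : O * 'rV[C]_d => u p.1 p.2) -> measurable_fun setT v ->
  measurable [set o | (eps%:E < L1loc_dist (u o) v)%E].
Proof.
move=> mu mv; rewrite -[X in measurable X]setTI; apply: emeasurable_fun_o_infty => //.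
rewrite /L1loc_dist.
have t0 m o : (0 <= (2^-1 ^+ m)%:E * mine 1 (L1_dist m%:R (u o) v))%E.
  by rewrite mule_ge0 ?lee_fin ?exprn_ge0// le_min lee01 integral_ge0.
under eq_fun do rewrite -nneseries_addn//.
apply: ge0_emeasurable_sum => // m _.
apply: emeasurable_funM; first exact: measurable_cst.
apply: measurable_mine; first exact: measurable_cst.
apply: (measurable_integral_param vol (measurable_euclidean_cball _)
  (g := fun p => `|u p.1 p.2 - v p.2|)%E) => //.
apply: measurableT_comp => //; apply: emeasurable_funB => //.
by apply: measurableT_comp => //; exact: measurable_snd.
Qed.

End L1loc_distance.

Lemma ge0_integral_cover disp (X : measurableType disp) (R : realType)
    (mu : {measure set X -> \bar R}) (I : eqType) (s : seq I) (A : I -> set X) (K : set X)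
    (g : X -> \bar R) :
  measurable K -> (forall i, measurable (A i)) -> measurable_fun setT g ->
  (forall x, 0 <= g x)%E ->
  (forall x, K x -> exists2 i, i \in s & A i x) ->
  (\int[mu]_(x in K) g x <= \sum_(i <- s) \int[mu]_(x in A i) g x)%E.
Proof.
move=> mK mA mg g0 cov.
have mr (B : set X) : measurable B -> measurable_fun setT (g \_ B).
  by move=> mB; apply/(measurable_restrictT g mB); exact: measurable_funTS.
have r0 (B : set X) x : (0 <= (g \_ B) x)%E by rewrite patchE; case: ifP.
under eq_bigr do rewrite integral_mkcond.
rewrite integral_mkcond -(@ge0_integral_sum _ _ _ mu setT measurableT _ (fun i => g \_ (A i)))//.
- apply: ge0_le_integral => //.
  + exact: mr.
  + by apply: emeasurable_sum => i; exact: mr.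
  + move=> x _; rewrite patchE; case: ifPn => [|_]; last exact: sume_ge0.
    rewrite inE => /cov[i si Aix]; rewrite (big_rem i)//= patchE mem_set//.
    by rewrite leeDl// sume_ge0.
- by move=> i; exact: mr.
Qed.

Section joint_measurability.
Context {R : realType} {d : nat}.
Local Notation C := R[i].
Local Notation normc := (@Normc.normc R).

Lemma measurable_normalized_log n (p : 'rV[C]_d -> C) : measurable_fun setT p ->
  measurable_fun setT (normalized_log n p).
Proof.
move=> mp; rewrite /normalized_log; case: asboolP => _; first exact: measurable_cst.
apply: emeasurable_funM; first exact: measurable_cst.
exact: measurable_log_modulus.
Qed.

Variable P : set 'rV[R]_d.
Variable T : R.
Hypothesis PT : forall (t : 'rV[R]_d) j, P t -> 0 <= t ord0 j <= T.

(** The convention for the zero polynomial splits the definition over an event of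
    Omega, which is measurable because it is read off the coefficients. *)
Lemma measurable_normalized_log_joint disp (O : measurableType disp) n
    (X : 'rV[nat]_d -> O -> C) c : (forall a, measurable_fun setT (X a)) ->
  measurable_fun setT (fun p : O * 'rV[C]_d =>
    normalized_log n (P_polynomial P n (fun a => X a p.1) c) p.2).
Proof.
move=> mX; pose E := [set o | exists2 a, a \in (lattice P n : seq _) & 0 < normc (X a o * c a)].
have mE : measurable E.
  apply: (@measurable_exists_seq _ _ _ _ (fun a => [set o | 0 < normc (X a o * c a)])) => a.
  rewrite -[Y in measurable Y]setTI; apply: measurable_fun_ltr => //.
  by apply: measurable_normc; apply: measurable_complexM => //; exact: measurable_cst.
have EP o : (forall z, P_polynomial P n (fun a => X a o) c z = 0) <-> ~ E o.
  rewrite (P_polynomial_eq0 PT); split=> [h [a /h ->]|h a ha]; first by rewrite Normc.normc0 ltxx.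
  by apply/eqP/negPn/negP => Xa; apply: h; exists a; rewrite ?normc_gt0.
have ifE (p : O * 'rV[C]_d) : normalized_log n (P_polynomial P n (fun a => X a p.1) c) p.2 =
    if p.1 \in E then (n%:R^-1%:E * log_modulus (P_polynomial P n (fun a => X a p.1) c p.2))%E
    else 0%E.
  rewrite /normalized_log; case: asboolP => [/EP h|h]; first by rewrite memNset.
  by rewrite ifT// inE; apply: contrapT => /EP.
under eq_fun do rewrite ifE.
apply: measurable_fun_ifT.
- apply: (@measurableT_comp _ _ _ _ _ _ (fun o => o \in E) _ fst); last exact: measurable_fst.
  apply: (measurable_fun_bool true); rewrite setTI.
  by rewrite (_ : _ @^-1` _ = E)//; apply/seteqP; split=> o; [exact: set_mem|exact: mem_set].
- apply: emeasurable_funM; first exact: measurable_cst.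
  by apply: measurable_log_modulus; exact: (measurable_P_polynomial_joint PT).
- exact: measurable_cst.
Qed.

End joint_measurability.

(** * Convergence in probability *)

Lemma near_seq_forall (I : eqType) (s : seq I) (Q : I -> nat -> Prop) :
  (forall i, i \in s -> \forall n \near \oo, Q i n) ->
  \forall n \near \oo, forall i, i \in s -> Q i n.
Proof.
elim: s => [_|i s IH h]; first exact: nearW.
have hi := h i (mem_head _ _).
have hs : \forall n \near \oo, forall k, k \in s -> Q k n.
  by apply: IH => k ks; apply: h; rewrite inE ks orbT.
near=> n => k; rewrite inE => /orP[/eqP->|ks]; first by near: n.
by move: k ks; near: n.
Unshelve. all: by end_near.
Qed.

Lemma cvge0_of_le (R : realType) (u : nat -> \bar R) : (forall n, (0 <= u n)%E) ->
  (forall eta : R, 0 < eta -> \forall n \near \oo, (u n <= eta%:E)%E) ->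
  u n @[n --> \oo] --> 0%E.
Proof.
move=> u0 h; apply/fine_cvgP; split.
  near=> n; rewrite ge0_fin_numE//; apply: (@le_lt_trans _ _ 1%:E); last exact: ltry.
  by near: n; exact: h.
apply/cvgr0Pnorm_le => eta eta0; near=> n.
have hn : (u n <= eta%:E)%E by near: n; exact: h.
rewrite ger0_norm ?fine_ge0//= -lee_fin fineK// ge0_fin_numE//.
exact: le_lt_trans hn (ltry _).
Unshelve. all: by end_near.
Qed.

Section convergence.
Context {R : realType} {d : nat}.
Local Notation C := R[i].
Local Notation normc := (@Normc.normc R).
Local Notation vol := (@lebesgue_Cd R d).

Lemma node_near1 (w : 'rV[C]_d) (rho : 'I_d -> R) m : (forall j, 0 < rho j) ->
  exists2 q : R, 1 < q & forall i, (i < m)%N ->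
    forall j, normc ((node q i *: w) ord0 j - w ord0 j) <= rho j.
Proof.
move=> rho0.
have h (i : 'I_m) (j : 'I_d) :
    \forall q \near (1 : R)^'+, normc (w ord0 j) * (q ^+ i - 1) <= rho j.
  have cv : normc (w ord0 j) * (q ^+ i - 1) @[q --> (1 : R)] --> (0 : R).
    rewrite -[X in _ --> X](_ : normc (w ord0 j) * (1 ^+ i - 1) = 0); last by rewrite expr1n subrr mulr0.
    apply: cvgMl_tmp; apply: cvgB; last exact: cvg_cst.
    exact: exprn_continuous.
  exact: (cvgr_le _ (cvg_at_right_filter cv) _ (rho0 j)).
have : \forall q \near (1 : R)^'+, 1 < q /\
    forall (i : 'I_m) j, normc (w ord0 j) * (q ^+ i - 1) <= rho j.
  near=> q; split; first by near: q; exact: nbhs_right_gt.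
  by near: q; apply: filter_forall => i; exact: filter_forall.
move=> /filter_ex[q [q1 hq]]; exists q => // i im j.
rewrite mxE /node -rmorphXn /= -[X in _ - X]mul1r -mulrBl -(rmorph1 (real_complex R)) -rmorphB.
rewrite Normc.normcM normc_real ger0_norm ?subr_ge0 ?exprn_ege1 ?(ltW q1)// mulrC.
exact: (hq (Ordinal im)).
Unshelve. all: by end_near.
Qed.

Variables (P : set 'rV[R]_d) (f : 'rV[R]_d -> R).
Hypothesis P_orthant : P `<=` orthant.
Hypothesis P_body : convex_body P.
Hypothesis P0 : P 0.
Hypothesis f_gt0 : forall t, P t -> 0 < f t.
Hypothesis f_cont : {within P, continuous f}.
Variable T : R.
Hypothesis PT : forall (t : 'rV[R]_d) j, P t -> 0 <= t ord0 j <= T.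

Lemma L1_dist_pieces (s : seq (@piece R d)) (M e : R) n (x c : 'rV[nat]_d -> C) :
  (forall p, p \in s -> good_piece P f p) ->
  (forall z : 'rV[C]_d, euclidean_cball M z -> exists2 p, p \in s & polydisc (centre p) (radii p) z) ->
  (0 < n)%N -> 0 < e -> coef_bounds P f n c e ->
  (forall a, a \in lattice P n -> normc (x a) <= expR (n%:R * e)) ->
  (#|` lattice P n|)%:R <= expR (n%:R * e) ->
  (forall p, p \in s -> exists2 w' : 'rV[C]_d,
     (forall j, normc (w' ord0 j - centre p ord0 j) <= radii p j) &
     expR (n%:R * (support P f (Log (centre p)) - e)) < normc (P_polynomial P n x c w')) ->
  (L1_dist M (normalized_log n (P_polynomial P n x c)) (Phi P f) <=
    (2%:R * (\sum_(p <- s) oscillation p * box_volume (radii p)) +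
     7%:R * e * \sum_(p <- s) box_volume (radii p))%:E)%E.
Proof.
move=> good cov n0 e0 hc hx hA hw.
have mu : measurable_fun setT (normalized_log n (P_polynomial P n x c) : 'rV[C]_d -> \bar R).
  by apply: measurable_normalized_log; exact: (measurable_P_polynomial PT).
apply: (@le_trans _ _ (\sum_(p <- s) \int[vol]_(z in polydisc (centre p) (radii p))
    `|normalized_log n (P_polynomial P n x c) z - Phi P f z|)%E).
  apply: (@ge0_integral_cover _ _ _ _ _ s (fun p : piece => polydisc (centre p) (radii p))) => //.
  - exact: measurable_euclidean_cball.
  - by move=> p; exact: measurable_polydisc.
  - apply: measurableT_comp => //; apply: emeasurable_funB => //.
    exact: measurable_Phi.
rewrite !mulr_sumr -big_split /= -sumEFin big_seq [leRHS]big_seq.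
apply: lee_sum => p ps; have [tp rp osc1 osc2] := good p ps.
have [w' ww' pw'] := hw p ps.
rewrite mulrA -mulrDl.
exact: (local_L1 P_orthant P_body P0 f_gt0 f_cont PT n0 e0 hc hx hA tp rp ww' pw' osc1 osc2).
Qed.

End convergence.

Theorem theorem1p1 (R : realType) (d : nat) (hd : (1 <= d)%N)
    (P : set 'rV[R]_d)
    (P_orthant : P `<=` orthant) (P_body : convex_body P) (P0 : P 0)
    (disp : measure_display) (Omega : measurableType disp)
    (Pr : probability Omega R)
    (xi : 'rV[nat]_d -> {RV Pr >-> R[i]})
    (xi_indep : mutually_independent xi)
    (xi_id : identically_distributed xi)
    (xi_nondeg : nondegenerate_RV (xi 0))
    (f : 'rV[R]_d -> R)
    (f_gt0 : forall t, P t -> 0 < f t)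
    (f_cont : {within P, continuous f})
    (c : nat -> 'rV[nat]_d -> R[i])
    (c_asymp :
      ereal_sup [set `| n%:R^-1%:E * log_modulus (c n a)
                        - (ln (f (n%:R^-1 *: natv a)))%:E |%E
                | a in lattice_points P n] @[n --> \oo] --> 0%E)
    (xi_tail :
      (fun t : R => fine (Pr [set w | t < ln (1 + Normc.normc (xi 0 w))]))
        =o_+oo (fun t : R => t ^- d)) :
  cvg_in_probability_L1loc Pr
    (fun n w => normalized_log n
       (P_polynomial P n (fun a => xi a w) (c n)))
    (Phi P f).
Proof.
have [T T0 PT] := body_bounded P_orthant P_body.
have [del del0 [theta /andP[theta0 theta1] small_ball]] := iid_small_ball xi_id xi_nondeg.
have c_asymp' e : 0 < e -> \forall n \near \oo, coef_bounds P f n (c n) e.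
  by move=> e0; exact: (coef_bounds_near PT e0 c_asymp).
move=> eps eps0; apply: cvge0_of_le => [n|eta eta0]; first exact: measure_ge0.
pose poly n o := P_polynomial P n (fun a => xi a o) (c n) : 'rV[R[i]]_d -> R[i].
have [m0 m0eps] : exists m0 : nat, 2^-1 ^+ m0.+1 <= eps / 2.
  have : \forall m \near \oo, (2^-1 : R) ^+ m < eps / 2.
    have h : (2^-1 : R) ^+ m @[m --> \oo] --> (0 : R).
      by apply: cvg_expr; rewrite ger0_norm// invf_lt1// ltr1n.
    by apply: (cvgr_lt _ h); rewrite divr_gt0.
  move=> [N _ hN]; exists N; apply/ltW; exact: (hN N.+1 (leqnSn N)).
have M0 : 0 < m0.+1%:R :> R by [].
have eps8 : 0 < eps / 8%:R by rewrite divr_gt0.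
have [s [s_good s_cover s_small]] :=
  exists_pieces P_orthant P_body P0 f_gt0 f_cont T0 PT M0 eps8.
pose V := \sum_(p <- s) box_volume (radii p).
have V0 : 0 <= V.
  by apply: sumr_ge0 => p _; apply: prodr_ge0 => j _; rewrite mulr_ge0// sqr_ge0.
(* The total error is 2 sum (osc vol) + 7 e V <= eps/4 + eps/4 on the ball. *)
pose e := eps / 4 / (7%:R * (V + 1)).
have V1 : 0 < V + 1 by rewrite ltr_wpDl.
have e0 : 0 < e by rewrite !divr_gt0// mulr_gt0.
have eV : 7%:R * e * V <= eps / 4.
  apply: (@le_trans _ _ (7%:R * e * (V + 1))); first by rewrite ler_wpM2l ?lerDl// mulr_ge0// ltW.
  by rewrite /e le_eqVlt; apply/orP; left; apply/eqP; field; exact: lt0r_neq0.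
have eta20 : 0 < eta / 2 by rewrite divr_gt0.
(* The number of pieces is fixed before m, so theta^m beats it. *)
have [m m_small] : exists m, theta ^+ m * (size s)%:R <= eta / 2.
  have h : theta ^+ m * (size s)%:R @[m --> \oo] --> (0 * (size s)%:R : R).
    by apply: cvgMr_tmp; apply: cvg_expr; rewrite ger0_norm.
  rewrite mul0r in h.
  have [N _ hN] := cvgr_lt _ h _ eta20.
  by exists N; apply/ltW; exact: (hN N (leqnn N)).
have /choice[q hq] : forall p : @piece R d, exists q : R, good_piece P f p ->
    1 < q /\ forall i, (i < m)%N ->
      forall j, Normc.normc ((node q i *: centre p) ord0 j - centre p ord0 j) <= radii p j.
  move=> p; have [[_ rp _ _]|np] := pselect (good_piece P f p); last by exists 0.
  by have [q q1 hq] := node_near1 (centre p) m rp; exists q.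
pose small n (p : @piece R d) := small_event P xi c n (centre p) (q p) m
  (expR (n%:R * (support P f (Log (centre p)) - e))).
near=> n.
have n0 : (0 < n)%N by near: n; exact: nbhs_infty_gt.
have hc : coef_bounds P f n (c n) e by near: n; exact: c_asymp'.
have hA : (#|` lattice P n|)%:R <= expR (n%:R * e) by near: n; exact: (card_lattice_near hd T0 PT e0).
have large_small : (Pr (large_event P xi n e) <= (eta / 2)%:E)%E.
  by near: n; exact: (large_event_near T0 PT xi_id xi_tail e0 eta20).
have small_small : forall p, p \in s -> (Pr (small n p) <= (theta ^+ m)%:E)%E.
  near: n; apply: near_seq_forall => p ps; have gp := s_good p ps; have [tp _ _ _] := gp.
  have [q1 _] := hq p gp.
  exact: (small_event_near hd P_orthant P_body P0 f_gt0 f_cont PT xi_indep theta0 del0 small_ball c_asymp').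
have m_large := measurable_large_event P xi n e.
have m_small_event p : measurable (small n p) by exact: (measurable_small_event PT).
(* Outside this event the distance is at most eps, deterministically. *)
pose bad := large_event P xi n e `|` [set o | exists2 p, p \in s & small n p o].
have m_bad2 : measurable [set o | exists2 p, p \in s & small n p o].
  exact: (measurable_exists_seq s m_small_event).
apply: (@le_trans _ _ (Pr bad)).
  apply: le_measure; rewrite ?inE.
  - apply: measurable_L1loc_dist_gt; last exact: measurable_Phi.
    apply: (@measurable_normalized_log_joint _ _ _ _ PT _ _ n (fun a o => xi a o)) => a.
    exact: measurable_funPT.
  - exact: measurableU.
  move=> o /= ho; apply: contrapT => nbad; move: ho; apply/negP; rewrite -leNgt.
  have /not_orP[nlarge nsmall] : ~ (large_event P xi n e o \/ exists2 p, p \in s & small n p o) by [].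
  have hx a : a \in lattice P n -> Normc.normc (xi a o) <= expR (n%:R * e).
    by move=> aP; rewrite leNgt; apply/negP => h; apply: nlarge; exists a.
  have mu : measurable_fun setT (normalized_log n (poly n o)).
    by apply: measurable_normalized_log; exact: (measurable_P_polynomial PT).
  have hw p : p \in s -> exists2 w' : 'rV[R[i]]_d,
      (forall j, Normc.normc (w' ord0 j - centre p ord0 j) <= radii p j) &
      expR (n%:R * (support P f (Log (centre p)) - e)) < Normc.normc (poly n o w').
    move=> ps; have [q1 hqp] := hq p (s_good p ps).
    apply: contrapT => /forall2NP hno; apply: nsmall; exists p => // i im.
    have [//|] := hno (node (q p) i *: centre p); first by move=> /(_ (hqp i im)).
    by move=> /negP; rewrite -leNgt.
  have mPhi : measurable_fun setT (Phi P f : 'rV[R[i]]_d -> \bar R) by exact: measurable_Phi.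
  apply: (le_trans (L1loc_dist_le m0.+1 mu mPhi)).
  apply: le_trans (leeD2r _ (L1_dist_pieces P_orthant P_body P0 f_gt0 f_cont PT s_good s_cover n0 e0 hc hx hA hw)) _.
  rewrite -EFinD lee_fin -/V; move: m0eps eV s_small.
  set a := _ ^+ _; set b := 7%:R * e * V; set g := \sum_(p <- s) _ => h1 h2 h3; lra.
apply: (le_trans (measureU2 _ _ _)) => //.
rewrite [eta]splitr EFinD; apply: leeD => //.
apply: (le_trans (measure_exists_le Pr s m_small_event)).
apply: (@le_trans _ _ (\sum_(p <- s) (theta ^+ m)%:E)%E).
  by rewrite big_seq [leRHS]big_seq; apply: lee_sum => p ps; exact: small_small.
rewrite sumEFin lee_fin big_const_seq count_predT iter_addr addr0.
by rewrite -[_ *+ _]mulr_natr.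
Unshelve. all: by end_near.
Qed.
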